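(* Let $2\le k\le 30$ and $\varepsilon\in[0,1]$. Any graphon $g$ with $t_1(g)=\varepsilon$ that maximizes $t_k$ among all graphons with edge density $\varepsilon$ is equivalent either to the g-clique with $c=\sqrt{\varepsilon}$ or to the g-anticlique with $c=1-\sqrt{1-\varepsilon}$.
   Context: A graphon is a symmetric measurable function $g:[0,1]^2\to[0,1]$, with degree function $d_g(x)=\int_0^1 g(x,y)\,dy$ and $k$-star density $t_k(g)=\int_0^1 d_g(x)^k\,dx$ ($t_1$ is the edge density). The g-clique with parameter $c\in[0,1]$ is the graphon equal to $1$ when $x<c$ and $y<c$, and $0$ otherwise. The g-anticlique with parameter $c\in[0,1]$ is the graphon equal to $0$ when $x>c$ and $y>c$, and $1$ otherwise. Two graphons $g,h$ are equivalent if their cut distance is zero, equivalently $t_F(g)=t_F(h)$ for every finite simple graph $F$, where $t_F$ denotes homomorphism density; in particular $g$ is equivalent to $h(\psi(x),\psi(y))$ for any measure-preserving $\psi:[0,1]\to[0,1]$. *)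

(* Defs.v *)
From HB Require Import structures.
From mathcomp Require Import all_boot all_order all_algebra.
From mathcomp Require Import all_classical all_reals all_analysis.
Set Implicit Arguments. Unset Strict Implicit. Unset Printing Implicit Defensive.
Import Order.TTheory GRing.Theory Num.Theory.
Local Open Scope classical_set_scope.
Local Open Scope ring_scope.

Section Graphons.
Variable R : realType.
Notation mu := (@lebesgue_measure R).
Notation I01 := (`[0%R, 1%R]%classic : set R).

(* A graphon: a measurable function on [0,1]^2 (Lebesgue x Lebesgue product
   sigma-algebra), symmetric and with values in [0,1] on [0,1]^2.  Values outside
   [0,1]^2 are irrelevant. *)
Definition is_graphon (g : R * R -> R) : Prop :=
  [/\ measurable_fun (I01 `*` I01) g,
      (forall x y, x \in `[0, 1] -> y \in `[0, 1] -> g (x, y) = g (y, x)) &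
      (forall x y, x \in `[0, 1] -> y \in `[0, 1] -> 0 <= g (x, y) <= 1)].

Definition deg (g : R * R -> R) (x : R) : R :=
  fine (\int[mu]_(y in I01) (g (x, y))%:E)%E.

Definition tstar (k : nat) (g : R * R -> R) : R :=
  fine (\int[mu]_(x in I01) ((deg g x) ^+ k)%:E)%E.

Definition gclique (c : R) : R * R -> R :=
  fun p => if (p.1 < c) && (p.2 < c) then 1 else 0.
Definition ganticlique (c : R) : R * R -> R :=
  fun p => if (c < p.1) && (c < p.2) then 0 else 1.

(* iterated integral over [0,1]^n of a nonnegative function of (x_0,...,x_{n-1}) *)
Fixpoint iint (n : nat) (f : (nat -> R) -> \bar R) : \bar R :=
  match n with
  | 0%N => f (fun _ => 0)
  | m.+1 => (\int[mu]_(t in I01)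
               iint m (fun x => f (fun i => if i == m then t else x i)))%E
  end.

Definition homdens (n : nat) (E : rel 'I_n) (g : R * R -> R) : \bar R :=
  iint n (fun x =>
    (\prod_(i < n) \prod_(j < n | (i < j)%N && E i j) g (x i, x j))%:E).

Definition graphon_equiv (g h : R * R -> R) : Prop :=
  forall (n : nat) (E : rel 'I_n), irreflexive E -> symmetric E ->
    homdens E g = homdens E h.

End Graphons.

(* Main.v *)
Require Import Defs.
From HB Require Import structures.
From mathcomp Require Import all_boot all_order all_algebra.
From mathcomp Require Import all_classical all_reals all_analysis.
From mathcomp Require Import measurable_realfun ring lra.
Set Implicit Arguments. Unset Strict Implicit. Unset Printing Implicit Defensive.
Import Order.TTheory GRing.Theory Num.Theory.
Local Open Scope classical_set_scope.
Local Open Scope ring_scope.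

(** Since t -> t^k is convex, a competitor with the same density and a first-order gain in t_k is an
    actual gain. With d the degree function, s(x,y) = d(x)^(k-1) + d(y)^(k-1) therefore determines a
    maximizer: moving mass from small s to large s makes it the indicator of s > l or s >= l almost
    everywhere. Such a kernel is constant on the square of {2 d^(k-1) > l} (or >= l) and on that of its
    complement. Reweighting the vertices inside one of these two sets by 1 + psi and by 1 - psi, with
    psi orthogonal to 1 and d, shows that psi is in the kernel of the integral operator of g; as the
    neighbourhoods are nested, d^2 is in the range of that operator, so d takes at most two values on
    the set. This leaves nested 0/1 kernels with four blocks. Those that are neither a clique nor an
    anticlique are excluded by perturbing the block sizes along the curve of constant density: by
    AM-GM in the rectangle case, and by the second derivative along the hyperbola (2 S - b) b = const
    in the others. The bound k <= 30 enters only in the three-part case, through the inequality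
    3/40 <= ((k+1)/(k+4))^(k-2). *)

(** * Bounded measurable functions *)

Section BoundedMeasurable.
Context d (T : measurableType d) (R : realType).
Implicit Types f g : T -> R.

(** Every maximizer has to be identified, not only the value of the maximum. On the level set of s
    the exchange of mass gains nothing to first order, and g might be mixed there. A perturbation of
    mass zero on that set must leave almost all degrees unchanged; testing this with phi(x) +
    phi(y), where phi has no atoms, leaves only the constants 0 and 1. Almost-everywhere claims are
    carried as nonnegative functions of expectation 0 whose zeros satisfy the claim; adding such
    functions combines claims. Reweighted kernels live on the same space, because a reweighting of
    [0,1] is composition with an inverse distribution function. The squares on which the kernel is
    constant matter because there psi (K psi) vanishes pointwise, K being the integral operator: the
    density is then preserved exactly, and psi can be compared with - psi. Once only block masses
    remain, the two hyperbola cases share one function [Fval], taken with (a + X)^k or (1 - X)^k. *)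

Definition bm f := measurable_fun setT f /\ exists M, forall x, `|f x| <= M.

Lemma bm_intro f M : measurable_fun setT f -> (forall x, `|f x| <= M) -> bm f.
Proof. by move=> mf hM; split=> //; exists M. Qed.

Lemma bm_meas f : bm f -> measurable_fun setT f.
Proof. by case. Qed.

Lemma bm_bound f : bm f -> exists M, forall x, `|f x| <= M.
Proof. by case. Qed.

Lemma bm_cst c : bm (fun _ => c).
Proof. by split; [exact: measurable_cst | exists `|c|]. Qed.

Lemma bmD f g : bm f -> bm g -> bm (fun x => f x + g x).
Proof.
move=> [mf [M hM]] [mg [N hN]]; split; first exact: measurable_funD.
by exists (M + N) => x; rewrite (le_trans (ler_normD _ _))// lerD.
Qed.

Lemma bmN f : bm f -> bm (fun x => - f x).
Proof.
move=> [mf [M hM]]; split; first exact: measurableT_comp.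
by exists M => x; rewrite normrN.
Qed.

Lemma bmM f g : bm f -> bm g -> bm (fun x => f x * g x).
Proof.
move=> [mf [M hM]] [mg [N hN]]; split; first exact: measurable_funM.
by exists (M * N) => x; rewrite normrM ler_pM.
Qed.

Lemma bmX f n : bm f -> bm (fun x => f x ^+ n).
Proof.
move=> [mf [M hM]]; split; first exact: measurable_funX.
by exists (M ^+ n) => x; rewrite normrX lerXn2r // nnegrE// (le_trans _ (hM x)).
Qed.

Lemma bm_if (b : T -> bool) f g : measurable_fun setT b -> bm f -> bm g ->
  bm (fun x => if b x then f x else g x).
Proof.
move=> mb [mf [M hM]] [mg [N hN]]; split; first exact: measurable_fun_ifT.
exists (M + N) => x; case: (b x).
- by rewrite (le_trans (hM x))// lerDl (le_trans _ (hN x)).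
- by rewrite (le_trans (hN x))// lerDr (le_trans _ (hM x)).
Qed.

Lemma mb_lt f g : bm f -> bm g -> measurable_fun setT (fun x => f x < g x).
Proof. by move=> [mf _] [mg _]; exact: measurable_fun_ltr. Qed.

Lemma mb_le f g : bm f -> bm g -> measurable_fun setT (fun x => f x <= g x).
Proof. by move=> [mf _] [mg _]; exact: measurable_fun_ler. Qed.

Lemma mb_eq f g : bm f -> bm g -> measurable_fun setT (fun x => f x == g x).
Proof. by move=> [mf _] [mg _]; exact: measurable_fun_eqr. Qed.

Lemma bm_max f g : bm f -> bm g -> bm (fun x => Num.max (f x) (g x)).
Proof.
move=> [mf [M hM]] [mg [N hN]]; split; first exact: measurable_maxr.
exists (M + N) => x.
have [_|_] := leP (f x) (g x).
- by rewrite (le_trans (hN x))// lerDr (le_trans _ (hM x)).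
- by rewrite (le_trans (hM x))// lerDl (le_trans _ (hN x)).
Qed.

End BoundedMeasurable.

Section BoundedMeasurableComp.
Context d d' (T : measurableType d) (T' : measurableType d') (R : realType).

Lemma bm_comp (f : T' -> R) (s : T -> T') :
  measurable_fun setT s -> bm f -> bm (fun x => f (s x)).
Proof.
move=> ms [mf [M hM]]; split; last by exists M.
exact: measurableT_comp.
Qed.

End BoundedMeasurableComp.

Section BoundedMeasurableProd.
Context d d' (T : measurableType d) (T' : measurableType d') (R : realType).

Lemma bm_fst (f : T -> R) : bm f -> bm (fun p : T * T' => f p.1).
Proof. exact: bm_comp measurable_fst. Qed.

Lemma bm_snd (f : T' -> R) : bm f -> bm (fun p : T * T' => f p.2).
Proof. exact: bm_comp measurable_snd. Qed.

Lemma bm_swap (f : T * T' -> R) : bm f -> bm (fun p : T' * T => f (p.2, p.1)).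
Proof.
by apply: (@bm_comp _ _ _ _ _ f (fun p : T' * T => (p.2, p.1))); exact: measurable_fun_pair.
Qed.

Lemma bm_pair (f : T * T' -> R) : bm f -> bm (fun p : T * T' => f (p.1, p.2)).
Proof. by move=> h; under eq_fun do rewrite -surjective_pairing. Qed.

Lemma bm_sec1 (f : T * T' -> R) x : bm f -> bm (fun y => f (x, y)).
Proof. by apply: (@bm_comp _ _ _ _ _ f (fun y => (x, y))); exact: measurable_fun_pair. Qed.

Lemma bm_sec2 (f : T * T' -> R) y : bm f -> bm (fun x => f (x, y)).
Proof. by apply: (@bm_comp _ _ _ _ _ f (fun x => (x, y))); exact: measurable_fun_pair. Qed.

End BoundedMeasurableProd.

Ltac bm := repeat first
  [ assumption | exact: bm_cst
  | match goal with |- bm (fun x => _ + _) => apply: bmD end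
  | match goal with |- bm (fun x => - _) => apply: bmN end
  | match goal with |- bm (fun x => _ * _) => apply: bmM end
  | match goal with |- bm (fun x => _ ^+ _) => apply: bmX end
  | match goal with |- bm (fun x => if _ then _ else _) => apply: bm_if end
  | match goal with |- measurable_fun _ (fun x => _ < _) => apply: mb_lt end
  | match goal with |- measurable_fun _ (fun x => _ <= _) => apply: mb_le end
  | match goal with |- measurable_fun _ (fun x => _ == _) => apply: mb_eq end
  | match goal with |- measurable_fun _ (fun x => _ && _) => apply: measurable_and end
  | match goal with |- measurable_fun _ (fun x => _ || _) => apply: measurable_or end
  | match goal with |- measurable_fun _ (fun x => ~~ _) => apply: measurable_neg end
  | match goal with |- bm (fun x => Num.max _ _) => apply: bm_max end
  | match goal with |- bm (fun x => ?f (x.2, x.1)) => apply: (@bm_swap _ _ _ _ _ f) end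
  | match goal with |- bm (fun x => ?f (x.1, x.2)) => apply: (@bm_pair _ _ _ _ _ f) end
  | match goal with |- bm (fun x => ?f (?a, x)) => apply: (@bm_sec1 _ _ _ _ _ f) end
  | match goal with |- bm (fun x => ?f (x, ?a)) => apply: (@bm_sec2 _ _ _ _ _ f) end
  | match goal with |- bm (fun x => ?f x.1) => apply: (@bm_fst _ _ _ _ _ f) end
  | match goal with |- bm (fun x => ?f x.2) => apply: (@bm_snd _ _ _ _ _ f) end ].

(** * Expectation under a probability measure *)

Section Expectation.
Context d (T : measurableType d) (R : realType) (P : probability T R).
Implicit Types (f g : T -> R) (F : T * T -> R).

Definition Ex f : R := \int[P]_x f x.
Definition Ex2 F : R := Ex (fun x => Ex (fun y => F (x, y))).

Lemma bm_integrable f : bm f -> P.-integrable setT (EFin \o f).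
Proof.
move=> [mf [M hM]]; apply: measurable_bounded_integrable => //.
  by rewrite (le_lt_trans (probability_le1 P measurableT))// ltry.
exists M; split; first by rewrite num_real.
by move=> N MN x _ /=; rewrite (le_trans (hM x))// ltW.
Qed.

Lemma ExE f : Ex f = fine (\int[P]_x (f x)%:E)%E.
Proof. by []. Qed.

Lemma EFin_Ex f : bm f -> (Ex f)%:E = (\int[P]_x (f x)%:E)%E.
Proof.
move=> bf; rewrite ExE fineK//.
by apply: integrable_fin_num => //; exact: bm_integrable.
Qed.

Lemma eq_Ex f g : f =1 g -> Ex f = Ex g.
Proof. by move=> fg; congr Ex; apply/funext. Qed.

Lemma Ex_cst c : Ex (fun _ => c) = c.
Proof.
rewrite /Ex Rintegral_cst// -[RHS]mulr1; congr (_ * _).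
by have /= -> := @probability_setT _ _ _ P.
Qed.

Lemma ExD f g : bm f -> bm g -> Ex (fun x => f x + g x) = Ex f + Ex g.
Proof. by move=> bf bg; rewrite /Ex RintegralD//; exact: bm_integrable. Qed.

Lemma ExZ c f : bm f -> Ex (fun x => c * f x) = c * Ex f.
Proof. by move=> bf; rewrite /Ex RintegralZl//; exact: bm_integrable. Qed.

Lemma ExZr c f : bm f -> Ex (fun x => f x * c) = Ex f * c.
Proof. by move=> bf; rewrite /Ex RintegralZr//; exact: bm_integrable. Qed.

Lemma ExN f : bm f -> Ex (fun x => - f x) = - Ex f.
Proof. by move=> bf; rewrite -mulN1r -ExZ//; apply: eq_Ex => x; rewrite mulN1r. Qed.

Lemma ExB f g : bm f -> bm g -> Ex (fun x => f x - g x) = Ex f - Ex g.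
Proof. by move=> bf bg; rewrite ExD ?ExN//; exact: bmN. Qed.

Lemma Ex_ge0 f : (forall x, 0 <= f x) -> 0 <= Ex f.
Proof. by move=> f0; apply: Rintegral_ge0 => x _. Qed.

Lemma le_Ex f g : bm f -> bm g -> (forall x, f x <= g x) -> Ex f <= Ex g.
Proof. by move=> bf bg fg; apply: le_Rintegral => //; exact: bm_integrable. Qed.

Lemma Ex_itv f a b : bm f -> (forall x, a <= f x <= b) -> a <= Ex f <= b.
Proof.
move=> bf h; apply/andP; split.
- by rewrite -[leLHS]Ex_cst; apply: le_Ex; bm => x; case/andP: (h x).
- by rewrite -[leRHS]Ex_cst; apply: le_Ex; bm => x; case/andP: (h x).
Qed.

(** A null set is presented as the complement of the zero set of a nonnegative f of expectation 0,
    which turns later almost-everywhere arguments into pointwise implications. *)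
Lemma Ex_null f g : bm f -> bm g -> (forall x, 0 <= f x) ->
  (forall x, f x = 0 -> g x = 0) -> Ex f = 0 -> Ex g = 0.
Proof.
move=> bf bg f0 fg Ef.
have aef : ae_eq P setT (EFin \o f) (cst 0%E).
  have mEf : measurable_fun setT (EFin \o f) by have [? _] := bf; apply/measurable_EFinP.
  apply: (ae_eq_integral_abs P measurableT mEf).1.
  under eq_integral do rewrite gee0_abs ?lee_fin//.
  have := congr1 EFin Ef; rewrite /Ex /Rintegral fineK//.
  by apply: integrable_fin_num => //; exact: bm_integrable.
have aeg : ae_eq P setT (EFin \o g) (cst 0%E).
  by apply: filterS aef => x /= h _; rewrite fg//; have [] := h I.
rewrite /Ex /Rintegral (ae_eq_integral (cst 0%E))// ?integral0//.
by have [? _] := bg; apply/measurable_EFinP.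
Qed.

Lemma eq_Ex_null f g h : bm f -> bm g -> bm h -> (forall x, 0 <= f x) ->
  (forall x, f x = 0 -> g x = h x) -> Ex f = 0 -> Ex g = Ex h.
Proof.
move=> bf bg bh f0 fgh Ef; apply/eqP; rewrite -subr_eq0 -ExB//; apply/eqP.
by apply: Ex_null f0 _ Ef => //; bm => x /fgh ->; rewrite subrr.
Qed.

Lemma bm_Ex F : bm F -> bm (fun x => Ex (fun y => F (x, y))).
Proof.
move=> bF; have [mF [M hM]] := bF; split; last first.
  exists M => x; rewrite ler_norml; apply: Ex_itv; first bm.
  by move=> y; rewrite -ler_norml.
(* Tonelli applies to nonnegative integrands, hence the shift by the bound M. *)
have bG : bm (fun p => F p + M) by bm.
have G0 p : 0 <= F p + M by have := hM p; rewrite ler_norml; lra.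
have eqf : (fun x => Ex (fun y => F (x, y))) =
    (fun x => Ex (fun y => F (x, y) + M) - M).
  by apply/funext => x; rewrite ExD ?Ex_cst ?addrK//; bm.
rewrite eqf; apply: measurable_funB => //.
apply: (measurableT_comp (f := fine)) => //.
apply: (measurable_fun_fubini_tonelli_F (fun p => (F p + M)%:E)).
- by have [? _] := bG; apply/measurable_EFinP.
- by move=> p; rewrite lee_fin.
Qed.

Lemma Ex2_swap F : bm F -> Ex2 F = Ex (fun y => Ex (fun x => F (x, y))).
Proof.
move=> bF; have [mF [M hM]] := bF.
have bG : bm (fun p => F p + M) by bm.
have G0 p : 0 <= F p + M by have := hM p; rewrite ler_norml; lra.
have E1 x : Ex (fun y => F (x, y) + M) = Ex (fun y => F (x, y)) + M.
  by rewrite ExD ?Ex_cst//; bm.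
have E2 y : Ex (fun x => F (x, y) + M) = Ex (fun x => F (x, y)) + M.
  by rewrite ExD ?Ex_cst//; bm.
have b1 : bm (fun x => Ex (fun y => F (x, y))) by exact: bm_Ex.
have b2 : bm (fun y => Ex (fun x => F (x, y))).
  by apply: (bm_Ex (F := fun p => F (p.2, p.1))); bm.
apply: (addIr M).
rewrite -[X in _ + X = _](Ex_cst M) -[X in _ = _ + X](Ex_cst M) -!ExD//; try exact: bm_cst.
rewrite -(eq_Ex E1) -(eq_Ex E2) /Ex /Rintegral; congr fine.
have fub := fubini_tonelli (m1 := P) (m2 := P) (fun p => (F p + M)%:E).
have fin1 (g : T -> R) : bm g -> (fine (\int[P]_x (g x)%:E))%:E = (\int[P]_x (g x)%:E)%E.
  move=> bg; rewrite fineK//; apply: integrable_fin_num => //; exact: bm_integrable.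
transitivity (\int[P]_x \int[P]_y (F (x, y) + M)%:E)%E.
  by apply: eq_integral => x _; rewrite fin1//; bm.
rewrite fub.
- by apply: eq_integral => y _; rewrite fin1//; bm.
- by have [? _] := bG; apply/measurable_EFinP.
- by move=> p; rewrite lee_fin.
Qed.

End Expectation.

Opaque bm Ex.

Section Expectation2.
Context d (T : measurableType d) (R : realType) (P : probability T R).
Implicit Types (F G H : T * T -> R) (u : T -> R).
Local Notation Ex := (Ex P).
Local Notation Ex2 := (Ex2 P).

Definition dg F x := Ex (fun y => F (x, y)).

Lemma bm_dg F : bm F -> bm (dg F).
Proof. exact: bm_Ex. Qed.

Lemma eq_Ex2 F G : F =1 G -> Ex2 F = Ex2 G.
Proof. by move=> FG; congr Ex2; apply/funext. Qed.

Lemma Ex2D F G : bm F -> bm G -> Ex2 (fun p => F p + G p) = Ex2 F + Ex2 G.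
Proof.
move=> bF bG; rewrite -ExD; [|exact: bm_dg|exact: bm_dg].
by apply: eq_Ex => x; rewrite ExD//; bm.
Qed.

Lemma Ex2Z c F : bm F -> Ex2 (fun p => c * F p) = c * Ex2 F.
Proof.
move=> bF; rewrite -ExZ; last exact: bm_dg.
by apply: eq_Ex => x; rewrite ExZ//; bm.
Qed.

Lemma Ex2N F : bm F -> Ex2 (fun p => - F p) = - Ex2 F.
Proof. by move=> bF; rewrite -mulN1r -Ex2Z//; apply: eq_Ex2 => x; rewrite mulN1r. Qed.

Lemma Ex2B F G : bm F -> bm G -> Ex2 (fun p => F p - G p) = Ex2 F - Ex2 G.
Proof. by move=> bF bG; rewrite Ex2D ?Ex2N//; bm. Qed.

Lemma Ex2_cst c : Ex2 (fun _ => c) = c.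
Proof. by rewrite /Ex2 !Ex_cst. Qed.

Lemma Ex2_ge0 F : (forall p, 0 <= F p) -> 0 <= Ex2 F.
Proof. by move=> F0; apply: Ex_ge0 => x; exact: Ex_ge0. Qed.

Lemma le_Ex2 F G : bm F -> bm G -> (forall p, F p <= G p) -> Ex2 F <= Ex2 G.
Proof.
move=> bF bG FG; apply: le_Ex; [exact: bm_dg|exact: bm_dg|] => x.
by apply: le_Ex; bm => y; exact: FG.
Qed.

Lemma Ex2_itv F a b : bm F -> (forall p, a <= F p <= b) -> a <= Ex2 F <= b.
Proof. by move=> bF h; apply: Ex_itv; [exact: bm_dg|] => x; apply: Ex_itv; bm. Qed.

Lemma Ex2_null F G : bm F -> bm G -> (forall p, 0 <= F p) ->
  (forall p, F p = 0 -> G p = 0) -> Ex2 F = 0 -> Ex2 G = 0.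
Proof.
move=> bF bG F0 FG; apply: Ex_null; [exact: bm_dg|exact: bm_dg| |].
- by move=> x; exact: Ex_ge0.
- by move=> x; apply: Ex_null; bm => y; [exact: F0|exact: FG].
Qed.

Lemma eq_Ex2_null F G H : bm F -> bm G -> bm H -> (forall p, 0 <= F p) ->
  (forall p, F p = 0 -> G p = H p) -> Ex2 F = 0 -> Ex2 G = Ex2 H.
Proof.
move=> bF bG bH F0 FGH EF; apply/eqP; rewrite -subr_eq0 -Ex2B//; apply/eqP.
by apply: Ex2_null F0 _ EF => //; bm => p /FGH ->; rewrite subrr.
Qed.

Lemma Ex2_transp F : bm F -> Ex2 (fun p => F (p.2, p.1)) = Ex2 F.
Proof. by move=> bF; rewrite Ex2_swap//; bm. Qed.

Lemma Ex2_fst F u : bm F -> bm u ->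
  Ex2 (fun p => F p * u p.1) = Ex (fun x => dg F x * u x).
Proof. by move=> bF bu; apply: eq_Ex => x; rewrite /dg -ExZr//; bm. Qed.

Lemma Ex2_symD F u : bm F -> bm u -> (forall x y, F (x, y) = F (y, x)) ->
  Ex2 (fun p => F p * (u p.1 + u p.2)) = 2 * Ex (fun x => dg F x * u x).
Proof.
move=> bF bu sF; rewrite -Ex2_fst//.
rewrite (eq_Ex2 (G := fun p => F p * u p.1 + F p * u p.2)); last first.
  by move=> p; rewrite mulrDr.
rewrite Ex2D; [|bm|bm]; rewrite [2 * _]mulr_natl mulr2n; congr (_ + _).
rewrite -[RHS]Ex2_transp; last by bm.
by apply: eq_Ex2 => -[x y] /=; rewrite sF.
Qed.

End Expectation2.

(** * Tangent line inequality for powers *)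

Section TangentLine.
Variable R : realFieldType.
Implicit Types x y : R.

(** The remainder of the tangent at x obeys a recursion whose coefficients are nonnegative on the
    half-line, so convexity and its equality case need no derivatives. *)
Lemma tangent_rec k x y : y ^+ k.+2 - x ^+ k.+2 - k.+2%:R * x ^+ k.+1 * (y - x) =
  y * (y ^+ k.+1 - x ^+ k.+1 - k.+1%:R * x ^+ k * (y - x))
  + k.+1%:R * x ^+ k * (y - x) ^+ 2.
Proof. by rewrite -[in LHS]natr1 !exprS; ring. Qed.

Lemma tangent_ge0 k x y : 0 <= x -> 0 <= y ->
  0 <= y ^+ k.+1 - x ^+ k.+1 - k.+1%:R * x ^+ k * (y - x).
Proof.
move=> x0 y0; elim: k => [|k IH]; first by rewrite !expr1 expr0; lra.
by rewrite tangent_rec; apply: addr_ge0; rewrite mulr_ge0 ?sqr_ge0// mulr_ge0 ?exprn_ge0.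
Qed.

Lemma tangent_eq0 k x y : 0 <= x -> 0 <= y ->
  y ^+ k.+2 - x ^+ k.+2 - k.+2%:R * x ^+ k.+1 * (y - x) = 0 -> y = x.
Proof.
rewrite le_eqVlt => /predU1P[<-|x0] y0.
  rewrite !expr0n/= mulr0 mul0r !subr0 => /eqP.
  by rewrite expf_eq0/= => /eqP.
rewrite tangent_rec => /eqP; rewrite paddr_eq0; last 2 first.
- by rewrite mulr_ge0// tangent_ge0// ltW.
- by rewrite mulr_ge0 ?sqr_ge0// mulr_ge0// exprn_ge0// ltW.
case/andP => _; rewrite !mulf_eq0 pnatr_eq0/= expf_eq0 gt_eqF// andbF/=.
by rewrite orbb subr_eq0 => /eqP.
Qed.

End TangentLine.

(** * First-order condition at a maximizer *)

Section Maximizers.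
Context d (T : measurableType d) (R : realType) (P : probability T R).
Implicit Types g h : T * T -> R.
Local Notation Ex := (Ex P).
Local Notation Ex2 := (Ex2 P).
Local Notation dg := (dg P).

Definition symker h := [/\ measurable_fun setT h,
  (forall x y, h (x, y) = h (y, x)) & (forall p, 0 <= h p <= 1)].

Definition star k h := Ex (fun x => dg h x ^+ k).

Definition star_max k g := symker g /\
  forall h, symker h -> Ex2 h = Ex2 g -> star k h <= star k g.

Lemma bm_symker h : symker h -> bm h.
Proof. by move=> [mh _ h01]; apply: (bm_intro (M := 1)) => // p; have := h01 p; rewrite ler_norml; lra. Qed.

Lemma dg_itv h x : symker h -> 0 <= dg h x <= 1.
Proof. by move=> sh; have [_ _ h01] := sh; have bh := bm_symker sh; apply: Ex_itv; bm. Qed.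

Definition dsum (n : nat) g (p : T * T) := dg g p.1 ^+ n + dg g p.2 ^+ n.

Lemma bm_dsum n g : bm g -> bm (dsum n g).
Proof. by move=> bg; have := bm_dg P bg => bd; rewrite /dsum; bm. Qed.

(* Convexity of x |-> x^k turns a first order gain into an actual gain. *)
Lemma first_order n g h : star_max n.+2 g -> symker h -> Ex2 h = Ex2 g ->
  0 <= Ex2 (fun p => (h p - g p) * dsum n.+1 g p) ->
  Ex (fun x => (dg h x - dg g x) ^+ 2) = 0 /\
  Ex2 (fun p => (h p - g p) * dsum n.+1 g p) = 0.
Proof.
move=> [sg maxg] sh Ehg; have [_ symg g01] := sg; have [_ symh h01] := sh.
have bg := bm_symker sg; have bh := bm_symker sh.
have bdg := bm_dg P bg; have bdh := bm_dg P bh.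
have dB x : dg (fun p => h p - g p) x = dg h x - dg g x by rewrite /dg ExB//; bm.
rewrite /dsum (Ex2_symD P (F := fun p => h p - g p) (u := fun x => dg g x ^+ n.+1))//; bm; last first.
  by move=> x y; rewrite symg symh.
under eq_Ex do rewrite dB.
move=> pos; set E0 := Ex _ in pos *.
pose psi x := dg h x ^+ n.+2 - dg g x ^+ n.+2 - n.+2%:R * dg g x ^+ n.+1 * (dg h x - dg g x).
have bpsi : bm psi by rewrite /psi; bm.
have psi0 x : 0 <= psi x.
  by apply: tangent_ge0; [case/andP: (dg_itv x sg)|case/andP: (dg_itv x sh)].
have Epsi : Ex psi = star n.+2 h - star n.+2 g - n.+2%:R * E0.
  rewrite /psi /star -ExZ; last by bm.
  rewrite -ExB; [|bm|bm]; rewrite -ExB; [|bm|bm].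
  by apply: eq_Ex => x; ring.
have max_h := maxg h sh Ehg.
have E00 : 0 <= n.+2%:R * E0 by rewrite mulr_ge0//; lra.
have Epsi0 : Ex psi = 0 by apply/eqP; rewrite eq_le Ex_ge0// andbT; lra.
have dheq x : psi x = 0 -> dg h x = dg g x.
  by apply: tangent_eq0; [case/andP: (dg_itv x sg)|case/andP: (dg_itv x sh)].
split; first by apply: Ex_null psi0 _ Epsi0; bm => x /dheq ->; rewrite subrr expr0n.
rewrite [E0](_ : _ = 0) ?mulr0//.
by apply: Ex_null psi0 _ Epsi0; bm => x /dheq ->; rewrite subrr mul0r.
Qed.

End Maximizers.

Lemma max0_lip (R : realFieldType) (w u v : R) : 0 <= w <= 1 ->
  w * Num.max 0 u <= w * Num.max 0 v + `|u - v|.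
Proof.
move=> /andP[w0 w1]; apply: (@le_trans _ _ (w * (Num.max 0 v + `|u - v|))).
  apply: ler_wpM2l => //.
  have := ler_norm (u - v); have := normr_ge0 (u - v).
  by case: (leP 0 u) => ?; case: (leP 0 v) => *; lra.
by rewrite mulrDr lerD2l ler_piMl.
Qed.

(** * A threshold level for the degree sum *)

Section Threshold.
Context d (T : measurableType d) (R : realType) (P : probability T R).
Implicit Types g h : T * T -> R.
Local Notation Ex := (Ex P).
Local Notation Ex2 := (Ex2 P).
Local Notation dg := (dg P).
Local Notation symker := (@symker d T R).
Local Notation star_max := (star_max P).

Variables (n : nat) (g : T * T -> R).
Hypothesis gmax : star_max n.+2 g.
Let s := dsum P n.+1 g.

Let sg : symker g. Proof. by case: gmax. Qed.
Let bg : bm g := bm_symker sg.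
Let bs : bm s. Proof. exact: bm_dsum. Qed.
Let symg x y : g (x, y) = g (y, x). Proof. by case: sg. Qed.
Let g01 p : 0 <= g p <= 1. Proof. by case: sg. Qed.
Let syms x y : s (x, y) = s (y, x). Proof. by rewrite /s /dsum/= addrC. Qed.

Lemma dsum_itv p : 0 <= s p <= 2.
Proof.
have h x : 0 <= dg g x ^+ n.+1 <= 1.
  by have /andP[h0 h1] := dg_itv P x sg; rewrite exprn_ge0// exprn_ile1.
by have := h p.1; have := h p.2; rewrite /s /dsum; lra.
Qed.

(** [gap] detects edges missing above the level l and [excess] edges present below it. The weight,
    the distance of s from l, makes both Lipschitz in l. Both have mean 0 exactly when g is almost
    everywhere the indicator of s > l off the set s = l. *)
Definition gap l p := (1 - g p) * Num.max 0 (s p - l).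
Definition excess l p := g p * Num.max 0 (l - s p).

Lemma bm_gap l : bm (gap l). Proof. by rewrite /gap; bm. Qed.
Lemma bm_excess l : bm (excess l). Proof. by rewrite /excess; bm. Qed.

Lemma gap_itv l p : 0 <= l -> 0 <= gap l p <= 2 * (1 - g p).
Proof.
move=> l0; rewrite /gap; have := dsum_itv p; have := g01 p.
by case: (leP 0 (s p - l)) => h h1 h2; nra.
Qed.

Lemma excess_itv l p : l <= 2 -> 0 <= excess l p <= 2 * g p.
Proof.
move=> l0; rewrite /excess; have := dsum_itv p; have := g01 p.
by case: (leP 0 (l - s p)) => h h1 h2; nra.
Qed.

(* Moving mass from {s < l} to {s > l} preserves the density and would increase the star density. *)
Lemma exchange l : 0 <= l <= 2 -> Ex2 (gap l) = 0 \/ Ex2 (excess l) = 0.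
Proof.
move=> /andP[l0 l2].
have bA := bm_gap l; have bB := bm_excess l.
have A_itv p := gap_itv p l0; have B_itv p := excess_itv p l2.
set a := Ex2 (gap l); set c := Ex2 (excess l).
have a_itv : 0 <= a <= 2.
  by apply: Ex2_itv => // p; have := A_itv p; have := g01 p; lra.
have c_itv : 0 <= c <= 2.
  by apply: Ex2_itv => // p; have := B_itv p; have := g01 p; lra.
(* The crossed coefficients make the added and the removed mass equal, c a = a c; since a and c are
   at most 2, the factor 1/4 keeps h in [0,1]. *)
pose h p := g p + (c * gap l p - a * excess l p) / 4.
have bh : bm h by rewrite /h; bm.
have sh : symker h.
  split; first exact: bm_meas.
  - by move=> x y; rewrite /h /gap /excess symg syms.
  - move=> p; rewrite /h; have := A_itv p; have := B_itv p; have := g01 p.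
    by move: a_itv c_itv; clearbody a c; set A := gap l p; set B := excess l p; nra.
have bqA : bm (fun p => gap l p * Num.max 0 (s p - l)) by bm.
have bqB : bm (fun p => excess l p * Num.max 0 (l - s p)) by bm.
set qA := Ex2 (fun p => gap l p * Num.max 0 (s p - l)).
set qB := Ex2 (fun p => excess l p * Num.max 0 (l - s p)).
have Eh : Ex2 h = Ex2 g.
  rewrite /h Ex2D//; last by bm.
  rewrite [X in _ + X](eq_Ex2 P (G := fun p => (4^-1 * c) * gap l p - (4^-1 * a) * excess l p)); last first.
    by move=> p; ring.
  by rewrite Ex2B ?Ex2Z//; [|bm|bm]; rewrite -/a -/c; ring.
have Egain : Ex2 (fun p => (h p - g p) * s p) = 4^-1 * c * qA + 4^-1 * a * qB.
  rewrite (eq_Ex2 P (G := fun p =>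
     ((4^-1 * c) * (gap l p * Num.max 0 (s p - l)) + (4^-1 * a) * (excess l p * Num.max 0 (l - s p)))
      + ((4^-1 * c * l) * gap l p - (4^-1 * a * l) * excess l p))); last first.
    move=> p; rewrite /h.
    have eA : gap l p * Num.max 0 (s p - l) = gap l p * (s p - l).
      by rewrite /gap; case: (leP 0 (s p - l)) => // _; rewrite !mulr0 mul0r.
    have eB : excess l p * Num.max 0 (l - s p) = excess l p * (l - s p).
      by rewrite /excess; case: (leP 0 (l - s p)) => // _; rewrite !mulr0 mul0r.
    by rewrite eA eB; ring.
  rewrite Ex2D; [|bm|bm]; rewrite Ex2D; [|bm|bm]; rewrite Ex2B; [|bm|bm].
  by rewrite !Ex2Z// -/a -/c -/qA -/qB; ring.
have qA0 : 0 <= qA.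
  by apply: Ex2_ge0 => p; rewrite mulr_ge0 ?le_max ?lexx//; case/andP: (A_itv p).
have qB0 : 0 <= qB.
  by apply: Ex2_ge0 => p; rewrite mulr_ge0 ?le_max ?lexx//; case/andP: (B_itv p).
have gain0 : 0 <= Ex2 (fun p => (h p - g p) * s p).
  by rewrite Egain; clearbody a c qA qB; nra.
have [_] := first_order gmax sh Eh gain0.
rewrite -/s Egain => tot.
have [c0|c0] := eqVneq c 0; [by right|left].
have qA_0 : qA = 0.
  have : c * qA = 0 by clearbody a c qA qB; nra.
  by move/eqP; rewrite mulf_eq0 (negbTE c0) => /eqP.
apply: Ex2_null qA_0 => //.
- by move=> p; rewrite mulr_ge0 ?le_max ?lexx//; case/andP: (A_itv p).
- move=> p /eqP; rewrite mulf_eq0 => /orP[/eqP//|/eqP m0].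
  by rewrite /gap m0 mulr0.
Qed.

Lemma gap_lip l l' : Ex2 (gap l) <= Ex2 (gap l') + `|l - l'|.
Proof.
have bA := bm_gap l; have bB := bm_gap l'.
rewrite -(Ex2_cst P `|l - l'|) -Ex2D//; last by bm.
apply: le_Ex2; bm => p.
have -> : `|l - l'| = `|(s p - l) - (s p - l')| by rewrite -normrN; congr `|_|; ring.
by apply: max0_lip; have := g01 p; lra.
Qed.

Lemma excess_lip l l' : Ex2 (excess l) <= Ex2 (excess l') + `|l - l'|.
Proof.
have bA := bm_excess l; have bB := bm_excess l'.
rewrite -(Ex2_cst P `|l - l'|) -Ex2D//; last by bm.
apply: le_Ex2; bm => p.
have -> : `|l - l'| = `|(l - s p) - (l' - s p)| by congr `|_|; ring.
exact: max0_lip.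
Qed.

(** [lam] is the infimum of the levels in [0,2] with zero gap; the level 2 is one of them because s
    <= 2. *)
Lemma gap_zeros_inf : exists lam, [/\ 0 <= lam <= 2,
  (forall e, 0 < e -> exists l, [/\ Ex2 (gap l) = 0, lam <= l & l < lam + e]) &
  (forall l, 0 <= l -> l < lam -> Ex2 (gap l) <> 0)].
Proof.
pose S := [set l | 0 <= l <= 2 /\ Ex2 (gap l) = 0].
have S2 : S 2.
  split; first by apply/andP; split.
  rewrite (eq_Ex2 P (G := fun _ => 0)) ?Ex2_cst// => p; rewrite /gap.
  rewrite [Num.max _ _](_ : _ = 0) ?mulr0//.
  by have := dsum_itv p; case: (leP 0 (s p - 2)) => h1 h2; lra.
have lbS : lbound S 0 by move=> l [/andP[]].
have hlS : has_lbound S by exists 0.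
have lam2 : inf S <= 2 by exact: ge_inf.
exists (inf S); split.
- by rewrite lam2 lb_le_inf//; exists 2.
- move=> e e0.
  have [|l Sl le] := @inf_adherent _ S e e0; first by split=> //; exists 2.
  by exists l; split=> //; [case: Sl|exact: ge_inf].
- move=> l l0 li El; suff : inf S <= l by rewrite leNgt li.
  by apply: (ge_inf hlS); split; [rewrite l0 (le_trans (ltW li))|exact: El].
Qed.

(** The gap vanishes at levels arbitrarily close to [lam] from above, and below [lam] it does not,
    so that [exchange] forces the excess to vanish there. The Lipschitz bounds carry both to
    [lam]. *)
Lemma exists_level : exists l, Ex2 (gap l) = 0 /\ Ex2 (excess l) = 0.
Proof.
have [lam [/andP[lam0 lam2] lamge lamlt]] := gap_zeros_inf.
have A0 : 0 <= Ex2 (gap lam) by apply: Ex2_ge0 => q; case/andP: (gap_itv q lam0).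
have B0 : 0 <= Ex2 (excess lam) by apply: Ex2_ge0 => q; case/andP: (excess_itv q lam2).
exists lam; split; apply: le_anti; rewrite ?A0 ?B0 andbT.
- apply/ler_addgt0Pr => e e0; rewrite add0r.
  have [l [El il le]] := lamge e e0.
  have := gap_lip lam l; rewrite El add0r ler0_norm ?subr_le0// => h.
  by apply: (le_trans h); rewrite opprB lerBlDl ltW.
(* At level 0 no lower level is at hand, but s >= 0 makes the excess vanish identically. *)
- have [i0|i0] := eqVneq lam 0.
    rewrite (eq_Ex2 P (G := fun _ => 0)) ?Ex2_cst// => p; rewrite /excess i0.
    rewrite [Num.max _ _](_ : _ = 0) ?mulr0//.
    by have := dsum_itv p; case: (leP 0 (0 - s p)) => h1 h2; lra.
  have {}lam0 : 0 < lam by rewrite lt_neqAle eq_sym i0.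
  apply/ler_addgt0Pr => e e0; rewrite add0r.
  have [l [l0 ll le]] : exists l, [/\ 0 <= l, l < lam & lam - l <= e].
    exists (Num.max 0 (lam - e)).
    split; first by rewrite le_max lexx.
    - by rewrite gt_max lam0 ltrBlDr ltrDl.
    - by rewrite lerBlDr -lerBlDl le_max lexx orbT.
  have [|El|El] := @exchange l; first by rewrite l0 (le_trans (ltW ll)).
  + by have := lamlt l l0 ll.
  + have := excess_lip lam l; rewrite El add0r ger0_norm; last by rewrite subr_ge0 ltW.
    by move=> h; exact: le_trans h le.
Qed.

End Threshold.

Lemma convex_perturb (R : realFieldType) (k e : R) :
  0 < k < 1 -> `|e| <= k * (1 - k) -> 0 <= k + e <= 1.
Proof. by move=> /andP[k0 k1]; rewrite ler_norml => /andP[e1 e2]; apply/andP; split; nra. Qed.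

(** * Ties: the level set of the degree sum *)

Section ThresholdKernel.
Context d (T : measurableType d) (R : realType) (P : probability T R).
Implicit Types g h : T * T -> R.
Local Notation Ex := (Ex P).
Local Notation Ex2 := (Ex2 P).
Local Notation dg := (dg P).
Local Notation symker := (@symker d T R).
Local Notation star_max := (star_max P).

Definition threshold (e : bool) (l x : R) := if e then l <= x else l < x.

Lemma threshold_homo e l x y : x <= y -> threshold e l x -> threshold e l y.
Proof.
by case: e => xy /=; [move/le_trans; exact|move/lt_le_trans; exact].
Qed.

Lemma mb_threshold d' (T' : measurableType d') e l (f : T' -> R) : bm f ->
  measurable_fun setT (fun x => threshold e l (f x)).
Proof. by case: e => bf; rewrite /threshold; bm. Qed.

Definition atomless (phi : T -> R) := forall c, Ex (fun y => if phi y == c then 1 else 0) = 0.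

Variables (n : nat) (g : T * T -> R).
Hypothesis gmax : star_max n.+2 g.
Let s := dsum P n.+1 g.

Let sg : symker g. Proof. by case: gmax. Qed.
Let bg : bm g := bm_symker sg.
Let bs : bm s. Proof. exact: bm_dsum. Qed.
Let symg x y : g (x, y) = g (y, x). Proof. by case: sg. Qed.
Let g01 p : 0 <= g p <= 1. Proof. by case: sg. Qed.
Let syms x y : s (x, y) = s (y, x). Proof. by rewrite /s /dsum/= addrC. Qed.

Let onlevel l (f : T * T -> R) p := if s p == l then f p else 0.
Let bm_onlevel l f : bm f -> bm (onlevel l f).
Proof. by move=> bf; rewrite /onlevel; bm. Qed.

(* On a level set of s every perturbation of the same mass leaves the degrees unchanged. *)
Lemma level_perturb l h : bm h -> (forall x y, h (x, y) = h (y, x)) ->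
  (forall p, 0 <= g p + h p <= 1) -> (forall p, s p != l -> h p = 0) ->
  Ex2 h = 0 -> Ex (fun x => dg h x ^+ 2) = 0.
Proof.
move=> bh symh h01 hl Eh.
have sh : symker (fun p => g p + h p).
  split=> //; first by apply: bm_meas; bm.
  by move=> x y; rewrite symg symh.
have Eg : Ex2 (fun p => g p + h p) = Ex2 g by rewrite Ex2D// Eh addr0.
have [|E0 _] := first_order gmax sh Eg.
  rewrite (eq_Ex2 P (G := fun p => l * h p)) ?Ex2Z ?Eh ?mulr0// => p.
  rewrite addrAC subrr add0r mulrC -/s; have [->//|/hl ->] := eqVneq (s p) l.
  by rewrite !mulr0.
rewrite -E0; apply: eq_Ex => x; congr (_ ^+ 2).
by rewrite /dg ExD; [rewrite addrAC subrr add0r|bm|bm].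
Qed.

(** If the average of g on the level set lies strictly between 0 and 1, then g can be replaced there
    by this average, or by the average plus a small multiple of w = phi(x) + phi(y) - m. Neither
    change moves the degrees, so w has zero degrees and E[w^2] = 0. Hence x determines phi(y) on the
    level set, which is null as phi has no atoms. *)
Lemma level_mixed_null (phi : T -> R) l : bm phi -> atomless phi ->
  let z := Ex2 (onlevel l (fun _ => 1)) in
  let zg := Ex2 (onlevel l g) in
  0 < zg -> zg < z -> False.
Proof.
move=> bphi aphi z zg zg0 zgz.
have z0 : 0 < z by exact: lt_trans zgz.
pose kap := zg / z.
have k01 : 0 < kap < 1 by rewrite /kap divr_gt0// ltr_pdivrMr// mul1r.
pose q p := phi p.1 + phi p.2.
have bq : bm q by rewrite /q; bm.
pose m := Ex2 (onlevel l q) / z.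
have [M hM] : exists M, forall p, `|q p - m| <= M.
  by apply: bm_bound; bm.
(* Small enough for [convex_perturb] to keep kap + eta (q - m) in [0,1]; the 1 in the denominator
   keeps it positive. *)
pose eta := kap * (1 - kap) / (1 + `|M|).
have M0 : 0 < 1 + `|M| by rewrite ltr_pwDl.
have eta0 : 0 < eta by rewrite /eta divr_gt0// mulr_gt0; lra.
have etaM p : `|eta * (q p - m)| <= kap * (1 - kap).
  rewrite normrM gtr0_norm// /eta mulrAC ler_pdivrMr//.
  apply: ler_wpM2l; first by rewrite mulr_ge0; lra.
  by rewrite (le_trans (hM p))// (le_trans (ler_norm M))// lerDr.
pose h1 := onlevel l (fun p => kap - g p).
pose h2 := onlevel l (fun p => kap - g p + eta * (q p - m)).
pose w := onlevel l (fun p => q p - m).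
have b1 : bm h1 by apply: bm_onlevel; bm.
have b2 : bm h2 by apply: bm_onlevel; bm.
have bw : bm w by apply: bm_onlevel; bm.
have bZ : bm (onlevel l (fun _ => 1)) by apply: bm_onlevel; bm.
have bZg : bm (onlevel l g) by apply: bm_onlevel; bm.
have bZq : bm (onlevel l q) by apply: bm_onlevel; bm.
have Eh1 : Ex2 h1 = 0.
  rewrite (eq_Ex2 P (G := fun p => kap * onlevel l (fun _ => 1) p - onlevel l g p)); last first.
    by move=> p; rewrite /h1 /onlevel; case: ifP => _; ring.
  by rewrite Ex2B ?Ex2Z//; [rewrite -/z -/zg /kap divfK ?subrr// gt_eqF|bm].
have Ew : Ex2 w = 0.
  rewrite (eq_Ex2 P (G := fun p => onlevel l q p - m * onlevel l (fun _ => 1) p)); last first.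
    by move=> p; rewrite /w /onlevel; case: ifP => _; ring.
  by rewrite Ex2B ?Ex2Z//; [rewrite -/z /m divfK ?subrr// gt_eqF|bm].
have h2E p : h2 p = h1 p + eta * w p by rewrite /h1 /h2 /w /onlevel; case: ifP => _; ring.
have Eh2 : Ex2 h2 = 0.
  by rewrite (eq_Ex2 P h2E) Ex2D ?Ex2Z ?Eh1 ?Ew ?mulr0 ?addr0//; bm.
have D1 : Ex (fun x => dg h1 x ^+ 2) = 0.
  apply: (@level_perturb l) => //.
  - by move=> x y; rewrite /h1 /onlevel syms symg.
  - by move=> p; rewrite /h1 /onlevel; case: ifP => _; rewrite ?addr0// addrC subrK !ltW//; case/andP: k01.
  - by move=> p /negbTE e; rewrite /h1 /onlevel e.
have D2 : Ex (fun x => dg h2 x ^+ 2) = 0.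
  apply: (@level_perturb l) => //.
  - by move=> x y; rewrite /h2 /onlevel syms symg /q/= [phi y + _]addrC.
  - move=> p; rewrite /h2 /onlevel; case: ifP => _; last by rewrite addr0.
    by rewrite addrA [g p + _]addrC subrK; exact: convex_perturb.
  - by move=> p /negbTE e; rewrite /h2 /onlevel e.
have bd1 := bm_dg P b1; have bd2 := bm_dg P b2; have bdw := bm_dg P bw.
have dE x : dg h2 x = dg h1 x + eta * dg w x.
  by rewrite /dg -ExZ -?ExD; [apply: eq_Ex => y; rewrite h2E|bm|bm|bm].
have Dw : Ex (fun x => dg w x * phi x) = 0.
  have bd12 : bm (fun x => dg h1 x ^+ 2 + dg h2 x ^+ 2) by bm.
  apply: (Ex_null bd12); first by bm.
  - by move=> x; rewrite addr_ge0 ?sqr_ge0.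
  - move=> x /eqP; rewrite paddr_eq0 ?sqr_ge0// !sqrf_eq0 => /andP[/eqP e1 /eqP].
    by rewrite dE e1 add0r => /eqP; rewrite mulf_eq0 gt_eqF//= => /eqP ->; rewrite mul0r.
  - by rewrite ExD ?D1 ?D2 ?addr0//; bm.
have symw x y : w (x, y) = w (y, x) by rewrite /w /onlevel syms /q/= [phi y + _]addrC.
(* On the level set w^2 = w (q - m); the mean of w is 0, and by symmetry that of w q is twice the
   mean of phi times the degree of w. *)
have Ewq : Ex2 (fun p => w p ^+ 2) = 0.
  rewrite (eq_Ex2 P (G := fun p => w p * (phi p.1 + phi p.2) - m * w p)).
    rewrite Ex2B ?Ex2Z ?Ew; [|bm|bm|bm].
    by rewrite (Ex2_symD P (F := w) (u := phi))// Dw !mulr0 subrr.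
  by move=> p; rewrite /w /onlevel; case: ifP => _; rewrite /q; ring.
pose diag p : R := if phi p.2 == m - phi p.1 then 1 else 0.
have bdiag : bm diag by rewrite /diag; bm.
have Ediag : Ex2 diag = 0 by rewrite /Ex2 /diag/=; under eq_Ex do rewrite aphi; rewrite Ex_cst.
have : z = 0.
  apply: (@Ex2_null _ _ _ _ (fun p => w p ^+ 2 + diag p)); [bm|exact: bZ| | |].
  - by move=> p; rewrite addr_ge0 ?sqr_ge0// /diag; case: ifP.
  - move=> p /eqP; rewrite paddr_eq0 ?sqr_ge0//; last by rewrite /diag; case: ifP.
    rewrite sqrf_eq0 /w /onlevel /diag; case: ifP => //= _; rewrite subr_eq0 => /andP[/eqP e].
    by rewrite -e /q addrAC subrr add0r eqxx oner_eq0.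
  - by rewrite Ex2D ?Ewq ?Ediag ?addr0//; bm.
by move=> z00; rewrite z00 ltxx in z0.
Qed.

Lemma threshold_kernel (phi : T -> R) : bm phi -> atomless phi ->
  exists e l, Ex2 (fun p => (g p - if threshold e l (s p) then 1 else 0) ^+ 2) = 0.
Proof.
move=> bphi aphi.
have [l [A0 B0]] := exists_level gmax.
have bA := bm_gap gmax l; have bB := bm_excess gmax l.
set z := Ex2 (onlevel l (fun _ => 1)).
set zg := Ex2 (onlevel l g).
have bZ : bm (onlevel l (fun _ => 1)) by apply: bm_onlevel; bm.
have bZg : bm (onlevel l g) by apply: bm_onlevel; bm.
have Zg0 p : 0 <= onlevel l g p <= onlevel l (fun _ => 1) p.
  by rewrite /onlevel; case: ifP => // _; rewrite lexx.
have zg0 : 0 <= zg by apply: Ex2_ge0 => p; case/andP: (Zg0 p).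
have zgz : zg <= z by apply: le_Ex2 => // p; case/andP: (Zg0 p).
(* Off the level set the zeros of gap and excess determine g; on it the decision is delegated to
   r. *)
have conclude e (r : T * T -> R) : bm r -> (forall p, 0 <= r p) -> Ex2 r = 0 ->
    (forall p, r p = 0 -> s p = l -> g p = if threshold e l (s p) then 1 else 0) ->
    Ex2 (fun p => (g p - if threshold e l (s p) then 1 else 0) ^+ 2) = 0.
  move=> br r0 Er rP.
  have bq : bm (fun p => if threshold e l (s p) then 1 else 0 : R).
    by apply: bm_if; [exact: mb_threshold|bm|bm].
  have gap0 p : 0 <= gap P n g l p.
    by rewrite /gap mulr_ge0 ?le_max ?lexx// subr_ge0; case/andP: (g01 p).
  have exc0 p : 0 <= excess P n g l p.
    by rewrite /excess mulr_ge0 ?le_max ?lexx//; case/andP: (g01 p).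
  apply: (@Ex2_null _ _ _ _ (fun p => gap P n g l p + excess P n g l p + r p)); [bm|bm| | |].
  - by move=> p; rewrite !addr_ge0.
  - move=> p /eqP; rewrite paddr_eq0 ?addr_ge0// paddr_eq0// => /andP[/andP[/eqP a0 /eqP b0]] /eqP rp0.
    suff -> : g p = if threshold e l (s p) then 1 else 0 by rewrite subrr expr0n.
    move: a0 b0; rewrite /gap /excess -/s.
    have [sl|sl|sl] := ltgtP (s p) l; last by move=> _ _; exact: rP.
    + move=> _; rewrite max_r ?subr_ge0 ?ltW// => /eqP.
      rewrite mulf_eq0 subr_eq0 [l == s p]gt_eqF// orbF => /eqP ->.
      by rewrite /threshold; case: e {rP bq}; rewrite ?(leNgt l) ?sl// ltNge ltW.
    + rewrite max_r ?subr_ge0 ?ltW// => /eqP.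
      rewrite mulf_eq0 !subr_eq0 [s p == l]gt_eqF// orbF => /eqP <- _.
      by rewrite /threshold sl ltW//; case: e {rP bq}.
  - by rewrite Ex2D ?Ex2D ?A0 ?B0 ?Er ?addr0//; bm.
(* If g vanishes on the level set the threshold is strict, if g is 1 there it is weak;
   [level_mixed_null] excludes the rest. *)
have [zgE|zgN] := eqVneq zg 0.
  exists false, l; apply: (conclude false (onlevel l g)) => //.
  - by move=> p; case/andP: (Zg0 p).
  - by move=> p r0 e; move: r0; rewrite /onlevel e eqxx /= ltxx.
have [zgzE|zgzN] := eqVneq zg z.
  exists true, l; apply: (conclude true (fun p => onlevel l (fun _ => 1) p - onlevel l g p)); first by bm.
  - by move=> p; rewrite subr_ge0; case/andP: (Zg0 p).
  - by rewrite Ex2B// -/z -/zg zgzE subrr.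
  - by move=> p /eqP r0 e; move: r0; rewrite /onlevel e eqxx /= lexx subr_eq0 => /eqP.
exfalso; apply: (@level_mixed_null phi l) => //; rewrite lt_neqAle.
- by rewrite eq_sym zgN.
- by rewrite zgzN.
Qed.

End ThresholdKernel.

(** * Two degrees on a homogeneous set *)

Section TwoValued.
Context d (T : measurableType d) (R : realType) (P : probability T R).
Local Notation Ex := (Ex P).
Local Notation Ex2 := (Ex2 P).
Local Notation dg := (dg P).
Local Notation symker := (@symker d T R).
Local Notation star_max := (star_max P).

(** The law of sigma under P has density 1 + psi, so composing a kernel with sigma reweights its
    vertices without leaving the space. Kept as a hypothesis on P and proved for the uniform law in
    [reweightable_unif]. *)
Definition reweightable := forall psi : T -> R, bm psi ->
  (forall x, `|psi x| <= 2^-1) -> Ex psi = 0 ->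
  exists sigma : T -> T, measurable_fun setT sigma /\
    forall f : T -> R, bm f -> Ex (fun x => f (sigma x)) = Ex (fun x => f x * (1 + psi x)).

Hypothesis rew : reweightable.
Variables (n : nat) (b : T * T -> R).
Hypothesis bmax : star_max n.+2 b.
Let sb : symker b. Proof. by case: bmax. Qed.
Let bb : bm b := bm_symker sb.
Let symb x y : b (x, y) = b (y, x). Proof. by case: sb. Qed.
Let b01 p : 0 <= b p <= 1. Proof. by case: sb. Qed.
Let bd : bm (dg b) := bm_dg P bb.

Definition kop (psi : T -> R) x := Ex (fun y => b (x, y) * psi y).

Lemma bm_kop psi : bm psi -> bm (kop psi).
Proof. by move=> bpsi; apply: (@bm_dg _ _ _ P (fun p => b p * psi p.2)); bm. Qed.

Lemma kop_adj psi chi : bm psi -> bm chi ->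
  Ex (fun x => psi x * kop chi x) = Ex (fun x => kop psi x * chi x).
Proof.
move=> bpsi bchi.
transitivity (Ex2 (fun p => psi p.1 * (b p * chi p.2))).
  by apply: eq_Ex => x; rewrite /kop -ExZ//; bm.
rewrite -Ex2_transp; last by bm.
apply: eq_Ex => x /=; rewrite /kop -ExZr; last by bm.
by apply: eq_Ex => y; rewrite symb; ring.
Qed.

Lemma kop1 psi : bm psi -> Ex (kop psi) = Ex (fun x => dg b x * psi x).
Proof.
move=> bpsi.
have b1 : bm (fun _ : T => 1 : R) by bm.
have := kop_adj bpsi b1; rewrite [X in _ = X](eq_Ex P (g := kop psi)) => [<-|x]; last by rewrite mulr1.
by apply: eq_Ex => x; rewrite mulrC; congr (_ * _); apply: eq_Ex => y; rewrite mulr1.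
Qed.

(** The reweighted kernel has density E[d] + 2 E[d psi] + E[psi (kop psi)]. Orthogonality to d
    removes the second term and the pointwise condition the third, so it is a competitor. *)
Lemma star_reweight psi : bm psi -> (forall x, `|psi x| <= 2^-1) -> Ex psi = 0 ->
  Ex (fun x => dg b x * psi x) = 0 -> (forall x, psi x * kop psi x = 0) ->
  (forall x, 0 <= dg b x + kop psi x) /\
  Ex (fun x => (dg b x + kop psi x) ^+ n.+2 * (1 + psi x)) <= star P n.+2 b.
Proof.
move=> bpsi psi2 Epsi Edpsi psiu.
have bu := bm_kop bpsi.
have duE x : Ex (fun y => b (x, y) * (1 + psi y)) = dg b x + kop psi x.
  by rewrite /dg /kop -ExD; [apply: eq_Ex => y; rewrite mulrDr mulr1|bm|bm].
split.
  move=> x; rewrite -duE; apply: Ex_ge0 => y; apply: mulr_ge0; first by case/andP: (b01 (x, y)).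
  have := psi2 y; rewrite ler_norml => /andP[h _]; rewrite -lerBlDl sub0r (le_trans _ h)// lerN2.
  by rewrite invf_le1 ?ler1n.
have [sigma [ms Es]] := rew bpsi psi2 Epsi.
pose h (p : T * T) := b (sigma p.1, sigma p.2).
have mss : measurable_fun setT (fun p : T * T => (sigma p.1, sigma p.2)).
  by apply: measurable_fun_pair; [exact: measurableT_comp ms measurable_fst|exact: measurableT_comp ms measurable_snd].
have bh : bm h by exact: (bm_comp mss bb).
have sh : symker h by split; [exact: bm_meas|move=> x y; exact: symb|move=> p; exact: b01].
have dh x : dg h x = dg b (sigma x) + kop psi (sigma x).
  by rewrite -duE -(Es (fun y => b (sigma x, y)))//; bm.
have Eh : Ex2 h = Ex2 b.
  transitivity (Ex (fun x => dg h x)) => //.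
  rewrite (eq_Ex P dh) (Es (fun x => dg b x + kop psi x)); last by bm.
  rewrite (eq_Ex P (g := fun x => (dg b x + kop psi x) + dg b x * psi x)).
    by rewrite !ExD ?kop1 ?Edpsi ?addr0//; bm.
  by move=> x; rewrite mulrDr mulr1; congr (_ + _); rewrite mulrDl [kop _ _ * _]mulrC psiu addr0.
have [_ /(_ h sh Eh)] := bmax.
rewrite /star [X in X <= _](_ : _ = Ex (fun x => (dg b x + kop psi x) ^+ n.+2 * (1 + psi x)))//.
rewrite -(Es (fun z => (dg b z + kop psi z) ^+ n.+2)); last by bm.
by apply: eq_Ex => x; rewrite dh.
Qed.

(* Second order condition: psi and -psi give the same first order terms, so convexity forces kop psi = 0. *)
Lemma kop_null_small psi : bm psi -> (forall x, `|psi x| <= 2^-1) -> Ex psi = 0 ->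
  Ex (fun x => dg b x * psi x) = 0 -> (forall x, psi x * kop psi x = 0) ->
  Ex (fun x => kop psi x ^+ 2) = 0.
Proof.
move=> bpsi psi2 Epsi Edpsi psiu.
have bu := bm_kop bpsi.
have kopN x : kop (fun y => - psi y) x = - kop psi x.
  by rewrite /kop -ExN; [apply: eq_Ex => y; rewrite mulrN|bm].
have [du0 Tp] := star_reweight bpsi psi2 Epsi Edpsi psiu.
have [du1 Tn] := @star_reweight (fun y => - psi y) ltac:(bm)
  ltac:(by move=> x; rewrite normrN)
  ltac:(by rewrite ExN// Epsi oppr0)
  ltac:(by rewrite (eq_Ex P (g := fun x => - (dg b x * psi x))); [rewrite ExN ?Edpsi ?oppr0//; bm|move=> x; rewrite mulrN])
  ltac:(by move=> x; rewrite kopN mulrNN).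
have {}du1 x : 0 <= dg b x - kop psi x by have := du1 x; rewrite kopN.
have d0 x : 0 <= dg b x by case/andP: (dg_itv P x sb).
pose tg y x := y ^+ n.+2 - x ^+ n.+2 - n.+2%:R * x ^+ n.+1 * (y - x) : R.
pose c x := tg (dg b x + kop psi x) (dg b x) + tg (dg b x - kop psi x) (dg b x).
have tg1 x : 0 <= tg (dg b x + kop psi x) (dg b x) by exact: tangent_ge0.
have tg2 x : 0 <= tg (dg b x - kop psi x) (dg b x) by exact: tangent_ge0.
have bc : bm c by rewrite /c /tg; bm.
have c0 x : 0 <= c x by rewrite addr_ge0.
(* At each x one of psi and [kop psi] is 0: in the first case the linear terms of the two signs
   cancel, in the second both tangent remainders vanish. *)
have cE x : (dg b x + kop psi x) ^+ n.+2 * (1 + psi x)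
    + (dg b x - kop psi x) ^+ n.+2 * (1 - psi x) = c x + 2 * dg b x ^+ n.+2.
  have /eqP := psiu x; rewrite mulf_eq0 => /orP[/eqP -> |/eqP u0].
    by rewrite /c /tg; ring.
  by rewrite /c /tg u0 !addr0 !subr0; ring.
have Ec : Ex c = 0.
  apply: le_anti; rewrite Ex_ge0// andbT.
  have : Ex (fun x => c x + 2 * dg b x ^+ n.+2) <= star P n.+2 b + star P n.+2 b.
    rewrite -(eq_Ex P cE) ExD; [|bm|bm]; apply: lerD; first exact: Tp.
    by rewrite [leLHS](_ : _ = Ex (fun x => (dg b x + kop (fun y => - psi y) x) ^+ n.+2 * (1 + - psi x)))//;
      apply: eq_Ex => x; rewrite kopN.
  rewrite ExD; [|bm|bm]; rewrite ExZ; last by bm.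
  by rewrite -/(star P n.+2 b) mulr_natl mulr2n -[leRHS]add0r lerD2r.
apply: Ex_null c0 _ Ec; [bm|bm|] => x /eqP; rewrite paddr_eq0// => /andP[/eqP t1 _].
have := tangent_eq0 (d0 x) (du0 x) t1.
by move/eqP; rewrite -subr_eq0 addrAC subrr add0r => /eqP ->; rewrite expr0n.
Qed.

Variables (A : T -> bool) (kap : R).
Hypothesis mA : measurable_fun setT A.
Hypothesis Akap : forall x y, A x -> A y -> b (x, y) = kap.

(** On A, [kop psi] equals kap E[psi] = 0, because psi lives on A and the kernel is constant there;
    off A, psi is 0. Scaling by t meets the size condition of [kop_null_small]. *)
Lemma kop_null psi : bm psi -> (forall x, ~~ A x -> psi x = 0) -> Ex psi = 0 ->
  Ex (fun x => dg b x * psi x) = 0 -> Ex (fun x => kop psi x ^+ 2) = 0.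
Proof.
move=> bpsi psiA Epsi Edpsi.
have [M hM] := bm_bound bpsi.
pose t := 2^-1 / (1 + `|M|).
have M0 : 0 < 1 + `|M| by rewrite ltr_pwDl.
have t0 : 0 < t by rewrite /t divr_gt0// invr_gt0.
have kopZ x : kop (fun y => t * psi y) x = t * kop psi x.
  by rewrite /kop -ExZ; [apply: eq_Ex => y; rewrite mulrCA|bm].
have psiu x : psi x * kop psi x = 0.
  have [Ax|/psiA ->] := boolP (A x); last by rewrite mul0r.
  rewrite /kop (eq_Ex P (g := fun y => kap * psi y)) ?ExZ ?Epsi ?mulr0// => y.
  by have [Ay|/psiA ->] := boolP (A y); [rewrite Akap|rewrite !mulr0].
have bu := bm_kop bpsi.
have : Ex (fun x => kop (fun y => t * psi y) x ^+ 2) = 0.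
  apply: kop_null_small; first by bm.
  - move=> x; rewrite normrM gtr0_norm// /t mulrAC ler_pdivrMr// ler_wpM2l ?invr_ge0//.
    by rewrite (le_trans (hM x))// (le_trans (ler_norm M))// lerDr.
  - by rewrite ExZ// Epsi mulr0.
  - by rewrite (eq_Ex P (g := fun x => t * (dg b x * psi x))); [rewrite ExZ ?Edpsi ?mulr0//; bm|move=> x; rewrite mulrCA].
  - by move=> x; rewrite kopZ mulrACA psiu mulr0.
rewrite (eq_Ex P (g := fun x => t ^+ 2 * kop psi x ^+ 2)); last by move=> x; rewrite kopZ exprMn.
rewrite ExZ; last by bm.
by move/eqP; rewrite mulf_eq0 expf_eq0 gt_eqF//= => /eqP.
Qed.

Variables (r : T -> R) (e : bool) (l : R).
Hypothesis br : bm r.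
Hypothesis bE : forall p, b p = if threshold e l (r p.1 + r p.2) then 1 else 0.

(** d(x)^2 counts pairs (z, z') of neighbours of x. If r z <= r z', adjacency of z implies that of
    z', so each z only has to be weighted by its share of partners z': twice for a strict inequality
    (both orders of the pair), once for a tie. *)
Let chi z := Ex (fun z' => (if r z < r z' then 1 else 0) + (if r z <= r z' then 1 else 0)).
Let bchi : bm chi.
Proof.
by apply: (@bm_dg _ _ _ P (fun p => (if r p.1 < r p.2 then 1 else 0) + (if r p.1 <= r p.2 then 1 else 0))); bm.
Qed.

(* The neighbourhoods are nested, so the square of a degree is again in the range of the kernel operator. *)
Lemma deg_sqr x : dg b x ^+ 2 = kop chi x.
Proof.
pose F (p : T * T) := b (x, p.1) * b (x, p.2).
have bF : bm F.
  by apply: bmM; [apply: (@bm_fst _ _ _ _ _ (fun z => b (x, z)))|apply: (@bm_snd _ _ _ _ _ (fun z => b (x, z)))]; bm.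
have bF1 : bm (fun p => F p * (if r p.1 < r p.2 then 1 else 0)) by bm.
have bF2 : bm (fun p => F p * (if r p.1 <= r p.2 then 1 else 0)) by bm.
have bF3 : bm (fun p => F p * (if r p.2 <= r p.1 then 1 else 0)) by bm.
have -> : dg b x ^+ 2 = Ex2 F.
  rewrite expr2 /dg -ExZr; last by bm.
  by apply: eq_Ex => y; rewrite -ExZ//; bm.
have -> : Ex2 F = Ex2 (fun p => F p * (if r p.1 < r p.2 then 1 else 0) + F p * (if r p.1 <= r p.2 then 1 else 0)).
  rewrite Ex2D// -[X in _ = _ + X]Ex2_transp// -Ex2D; last 2 first.
  - by [].
  - by apply: (@bm_swap _ _ _ _ _ (fun p => F p * (if r p.1 <= r p.2 then 1 else 0))).
  apply: eq_Ex2 => -[y z] /=; rewrite /F/= [b (x, z) * b (x, y)]mulrC -mulrDr.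
  by case: ltP => _; rewrite ?addr0 ?add0r mulr1.
apply: eq_Ex => z; rewrite -ExZ; last by bm.
apply: eq_Ex => z'; rewrite -mulrDr /F /=.
case: (leP (r z) (r z')) => [zz'|zz']; last first.
  by rewrite ltNge ltW//= addr0 !mulr0.
rewrite !bE /=; case: ifP => [th|_]; last by rewrite !mul0r.
by rewrite (threshold_homo _ th) ?lerD2l// !mul1r.
Qed.

(** q is d^2 minus its projection on the span of 1 and d over A, so psi = 1_A q has [kop psi] = 0
    almost everywhere. As d^2 = [kop chi], also E[psi d^2] = E[(kop psi) chi] = 0, whence E[1_A q^2]
    = 0: almost everywhere on A, d is a root of one quadratic. *)
Lemma two_valued : exists v1 v2,
  Ex (fun x => if A x then ((dg b x - v1) * (dg b x - v2)) ^+ 2 else 0) = 0.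
Proof.
pose a x : R := if A x then 1 else 0.
have ba : bm a by rewrite /a; bm.
pose m j := Ex (fun x => a x * dg b x ^+ j).
have bm_ j : bm (fun x => a x * dg b x ^+ j) by bm.
have aa x : a x * a x = a x by rewrite /a; case: ifP; rewrite ?mulr1 ?mulr0.
(* The Gram determinant of 1 and d on A. If it vanishes, either A is null or d has variance 0 on A,
   and one value is enough. *)
have [D0|D0] := eqVneq (m 0 * m 2 - m 1 ^+ 2) 0.
  have [m0|m0] := eqVneq (m 0) 0.
    exists 0, 0; apply: (@Ex_null _ _ _ _ (fun x => a x * dg b x ^+ 0)); [bm|bm| | |exact: m0].
    - by move=> x; rewrite /a; case: ifP; rewrite ?mul1r ?mul0r.
    - by move=> x; rewrite /a; case: ifP => //; rewrite mul1r => _ /eqP; rewrite oner_eq0.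
  exists (m 1 / m 0), (m 1 / m 0).
  have Ev : Ex (fun x => a x * (dg b x - m 1 / m 0) ^+ 2) = 0.
    rewrite (eq_Ex P (g := fun x => (a x * dg b x ^+ 2 - (2 * (m 1 / m 0)) * (a x * dg b x ^+ 1)) + (m 1 / m 0) ^+ 2 * (a x * dg b x ^+ 0))); last first.
      by move=> x; ring.
    rewrite ExD; [|bm|bm]; rewrite ExB; [|bm|bm]; rewrite !ExZ//.
    rewrite -/(m 0) -/(m 1) -/(m 2).
    move: D0 m0; move: (m 0) (m 1) (m 2) => x0 x1 x2 D0' x00.
    by transitivity ((x0 * x2 - x1 ^+ 2) / x0); [field|rewrite D0' mul0r].
  apply: Ex_null _ _ _ _ Ev; [bm|bm| |].
  - by move=> x; rewrite /a; case: ifP; rewrite ?mul1r ?mul0r ?sqr_ge0.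
  - move=> x; rewrite /a; case: ifP => // _; rewrite mul1r => /eqP.
    by rewrite sqrf_eq0 => /eqP ->; rewrite mul0r expr0n.
pose be := (m 0 * m 3 - m 1 * m 2) / (m 0 * m 2 - m 1 ^+ 2).
pose al := (m 2 ^+ 2 - m 1 * m 3) / (m 0 * m 2 - m 1 ^+ 2).
pose q x := dg b x ^+ 2 - be * dg b x - al.
pose psi x := a x * q x.
have bq : bm q by rewrite /q; bm.
have bpsi : bm psi by rewrite /psi; bm.
have Epsi : Ex psi = 0.
  rewrite (eq_Ex P (g := fun x => (a x * dg b x ^+ 2 - be * (a x * dg b x ^+ 1)) - al * (a x * dg b x ^+ 0))); last first.
    by move=> x; rewrite /psi /q; ring.
  rewrite ExB; [|bm|bm]; rewrite ExB; [|bm|bm]; rewrite !ExZ//.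
  by rewrite -/(m 0) -/(m 1) -/(m 2) /be /al; field.
have Edpsi : Ex (fun x => dg b x * psi x) = 0.
  rewrite (eq_Ex P (g := fun x => (a x * dg b x ^+ 3 - be * (a x * dg b x ^+ 2)) - al * (a x * dg b x ^+ 1))); last first.
    by move=> x; rewrite /psi /q; ring.
  rewrite ExB; [|bm|bm]; rewrite ExB; [|bm|bm]; rewrite !ExZ//.
  by rewrite -/(m 3) -/(m 1) -/(m 2) /be /al; field.
have bu := bm_kop bpsi.
have E0 : Ex (fun x => kop psi x ^+ 2) = 0.
  by apply: kop_null => // x /negbTE Ax; rewrite /psi /a Ax mul0r.
have Epd : Ex (fun x => psi x * dg b x ^+ 2) = 0.
  rewrite (eq_Ex P (g := fun x => psi x * kop chi x)); last by move=> x; rewrite deg_sqr.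
  rewrite kop_adj//; apply: Ex_null _ _ _ _ E0; [bm|bm| |].
  - by move=> x; rewrite sqr_ge0.
  - by move=> x /eqP; rewrite sqrf_eq0 => /eqP ->; rewrite mul0r.
have Eq2 : Ex (fun x => a x * q x ^+ 2) = 0.
  rewrite (eq_Ex P (g := fun x => (psi x * dg b x ^+ 2 - be * (dg b x * psi x)) - al * psi x)); last first.
    by move=> x; rewrite /psi /q; ring.
  rewrite ExB; [|bm|bm]; rewrite ExB; [|bm|bm]; rewrite !ExZ//; last by bm.
  by rewrite Epd Edpsi Epsi !mulr0 !subr0.
(* A zero of q in A supplies a real root, and the sum [be] of the roots the other one. Without a
   zero, E[1_A q^2] = 0 makes A null and any two values serve. *)
have [[x [Ax qx]]|nox] := pselect (exists x, A x /\ q x = 0).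
  exists (dg b x), (be - dg b x); rewrite -Eq2; apply: eq_Ex => y.
  rewrite /a; case: ifP => _; rewrite ?mul0r// mul1r; congr (_ ^+ 2); rewrite /q.
  have -> : al = dg b x ^+ 2 - be * dg b x by move: qx; rewrite /q => /eqP; rewrite subr_eq0 => /eqP.
  by ring.
exists 0, 0; apply: Ex_null _ _ _ _ Eq2; [bm|bm| |].
- by move=> x; rewrite /a; case: ifP; rewrite ?mul1r ?mul0r ?sqr_ge0.
- move=> x; rewrite /a; case: ifP => // Ax; rewrite mul1r => /eqP; rewrite sqrf_eq0 => /eqP qx.
  by case: nox; exists x.
Qed.

End TwoValued.

(** * Reweighting the unit interval by an inverse distribution function *)

Section DensityMeasure.
Context d (T : measurableType d) (R : realType) (P : probability T R).
Variable rho : T -> R.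
Hypothesis brho : bm rho.
Hypothesis rho0 : forall x, 0 <= rho x.
Hypothesis Erho : Ex P rho = 1.

(** The conditions on rho are arguments, so that the term itself can carry the structure of a
    probability measure. *)
Definition density_measure of bm rho & (forall x, 0 <= rho x) & Ex P rho = 1 :=
  fun A : set T => (\int[P]_(x in A) (rho x)%:E)%E.

Local Notation Q := (density_measure brho rho0 Erho).

Let Q0 : Q set0 = 0%E. Proof. by rewrite /Q integral_set0. Qed.

Let Q_ge0 A : (0 <= Q A)%E.
Proof. by apply: integral_ge0 => x _; rewrite lee_fin. Qed.

Let Q_sigma_additive : semi_sigma_additive Q.
Proof.
move=> /= F mF tF mUF; rewrite /density_measure; apply: cvg_toP.
  apply: ereal_nondecreasing_is_cvgn => i j ij.
  apply: lee_sum_nneg_natr => // k _ _.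
  by apply: integral_ge0 => /= x Fkx; rewrite lee_fin.
rewrite ge0_integral_bigcup//=.
- by apply: measurable_funTS; apply: measurableT_comp => //; exact: bm_meas.
- by move=> x _; rewrite lee_fin.
Qed.

HB.instance Definition _ := isMeasure.Build _ _ _ Q Q0 Q_ge0 Q_sigma_additive.

Let QT : Q [set: T] = 1%:E.
Proof.
by rewrite /density_measure -EFin_Ex// Erho.
Qed.

HB.instance Definition _ := @Measure_isProbability.Build _ _ R Q QT.

(** rho agrees almost everywhere with the Radon-Nikodym derivative of Q, having the same integral
    over every measurable set. *)
Lemma Ex_density (f : T -> R) : bm f -> Ex Q f = Ex P (fun x => f x * rho x).
Proof.
move=> bf; rewrite !ExE; congr fine.
have dom : Q `<< P.
  apply/null_content_dominatesP => A mA PA0; rewrite /Q; apply: null_set_integral => //.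
  by apply: measurableT_comp => //; apply: measurable_funTS; exact: bm_meas.
rewrite -(Radon_Nikodym_change_of_variables dom)//=; last exact: bm_integrable.
under [RHS]eq_integral do rewrite EFinM.
apply: ae_eq_integral => //.
- apply: emeasurable_funM; first by apply: measurableT_comp => //; exact: bm_meas.
  by apply: (measurable_int P); exact: Radon_Nikodym_integrable.
- by apply: emeasurable_funM; apply: measurableT_comp => //; exact: bm_meas.
- apply: ae_eqe_mul2l => /=.
  rewrite Radon_NikodymE//=.
  case: cid => /= h [h1 h2 h3].
  apply: integral_ae_eq => //=.
  + by apply: measurableT_comp => //; exact: bm_meas.
  + by move=> E _ mE; rewrite -h3.
Qed.

End DensityMeasure.

Section Rays.
Variable R : realType.
Local Notation RT := (measurableTypeR R).

Lemma mb_ltr (c : R) : measurable_fun setT (fun x : RT => x < c).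
Proof. by apply: measurable_fun_ltr => //; exact: measurable_cst. Qed.

(** Open left rays are stable under intersection, generate the Borel sets and exhaust the line, so
    they determine a probability. *)
Lemma eq_Ex_rays (Q1 Q2 : probability RT R) (f : RT -> R) :
  (forall c : R, Ex Q1 (fun x : RT => if x < c then 1 else 0) =
                 Ex Q2 (fun x : RT => if x < c then 1 else 0)) ->
  bm f -> Ex Q1 f = Ex Q2 f.
Proof.
move=> Q12 bf; rewrite !ExE; congr fine.
apply: eq_measure_integral => A mA _.
apply: (@measure_unique _ R RT (@RGenInftyO.G R) (fun k => `]-oo, k%:R[%classic) _ _ _ _ Q1 Q2) => //.
- exact: RGenInftyO.measurableE.
- move=> _ _ [x ->] [y ->]; exists (Num.min x y).
  by apply/seteqP; split=> z /=; rewrite !in_itv/= lt_min; [case=> -> ->|move=> /andP[]].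
- by move=> k; exists k%:R.
- apply/seteqP; split=> // x _; exists (Num.bound `|x|) => //=.
  by rewrite in_itv/= (le_lt_trans (ler_norm x))//; apply: archi_boundP.
- move=> _ [c ->].
  have ray (Q : probability RT R) :
      Q `]-oo, c[%classic = (Ex Q (fun x : RT => if x < c then 1 else 0))%:E.
    rewrite EFin_Ex; last by apply: bm_if; [exact: mb_ltr|bm|bm].
    rewrite -[`]-oo, c[%classic]setIT -integral_indic//; apply: eq_integral => x _.
    rewrite indicE; congr (_%:E); case: ifP => xc; first by rewrite mem_set//= in_itv.
    by rewrite memNset//= in_itv/= xc.
  exact: etrans (ray Q1) (etrans (congr1 EFin (Q12 c)) (esym (ray Q2))).
- by move=> k; rewrite (le_lt_trans (probability_le1 Q1 _))// ltry.
Qed.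

Lemma Ex_distribution (P : probability RT R) (s : RT -> RT)
  (ms : measurable_fun setT s) : exists Q : probability RT R,
  forall f : RT -> R, bm f -> Ex Q f = Ex P (fun x => f (s x)).
Proof.
pose X : {mfun RT >-> RT} := HB.pack s (isMeasurableFun.Build _ _ _ _ s ms).
exists (distribution P X) => f bf; rewrite !ExE; congr fine.
rewrite integral_distribution//.
- by apply: measurableT_comp => //; exact: bm_meas.
- by apply: (bm_integrable P (f := fun x => f (s x))); exact: (bm_comp ms bf).
Qed.

End Rays.

Section UniformProbability.
Variable R : realType.
Notation mu := (@lebesgue_measure R).
Local Notation RT := (measurableTypeR R).
Definition unif : probability RT R := uniform_prob (@ltr01 R).
Local Notation P := unif.
Local Notation Ex := (Ex unif).

Lemma Ex_unif_ge0 (f : RT -> R) : bm f -> (forall x, 0 <= f x) ->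
  Ex f = fine (\int[mu]_(x in `[0%R, 1%R]) (f x)%:E)%E.
Proof.
move=> bf f0; rewrite ExE integral_uniform//.
- by rewrite subr0 invr1 mul1e.
- by apply: measurableT_comp => //; exact: bm_meas.
Qed.

Lemma eq_Ex_unif (f g : RT -> R) : bm f -> bm g ->
  (forall x, 0 <= x <= 1 -> f x = g x) -> Ex f = Ex g.
Proof.
move=> bf bg fg.
have [M hM] := bm_bound bf; have [N hN] := bm_bound bg.
have e (h : RT -> R) : bm h -> Ex (fun x => h x + (`|M| + `|N|)) = Ex h + (`|M| + `|N|).
  by move=> bh; rewrite ExD ?Ex_cst//; bm.
apply: (addIr (`|M| + `|N|)); rewrite -!e//.
have le_abs (h : RT -> R) L x : (forall x, `|h x| <= L) -> - `|L| <= h x.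
  by move=> hL; have := le_trans (hL x) (ler_norm L); rewrite ler_norml => /andP[].
rewrite !Ex_unif_ge0; [|bm| |bm|]; last 2 first.
- by move=> x; have := le_abs _ _ x hN; have := normr_ge0 M; lra.
- by move=> x; have := le_abs _ _ x hM; have := normr_ge0 N; lra.
by congr fine; apply: eq_integral => x; rewrite inE/= in_itv/= => /fg ->.
Qed.

Lemma Ex_unif_set (b : RT -> bool) : measurable_fun setT b ->
  Ex (fun x => if b x then 1 else 0) = fine (mu (`[0, 1] `&` [set x | b x])).
Proof.
move=> mb.
have mB : measurable [set x | b x].
  by rewrite -[X in measurable X]setTI; apply: (mb measurableT [set true]).
rewrite Ex_unif_ge0; last 2 first.
- by apply: bm_if; bm.
- by move=> x; case: ifP.
rewrite setIC -integral_indic//; congr fine.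
apply: eq_integral => x _; rewrite indicE; congr (_%:E).
case: ifP => bx; first by rewrite mem_set.
by rewrite memNset//= bx.
Qed.

Lemma Ex_unif_lt c : 0 <= c <= 1 -> Ex (fun x => if x < c then 1 else 0) = c.
Proof.
move=> /andP[c0 c1]; rewrite Ex_unif_set; last exact: mb_ltr.
rewrite [X in mu X](_ : _ = `[0, c[%classic); last first.
  apply/seteqP; split=> x /=; rewrite !in_itv/=.
  - by move=> [/andP[x0 x1] xc]; rewrite x0.
  - by move=> /andP[x0 xc]; rewrite x0 xc (le_trans (ltW xc)).
rewrite lebesgue_measure_itv/= lte_fin; case: ltP => [_|c0'].
  by rewrite -EFinD/= subr0.
by apply/eqP; rewrite eq_sym eq_le c0 c0'.
Qed.

Lemma Ex_unif_eq c : Ex (fun x => if x == c then 1 else 0) = 0.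
Proof.
rewrite Ex_unif_set; last by apply: measurable_fun_eqr => //; exact: measurable_cst.
rewrite (_ : mu _ = 0%E)//; apply: (subset_measure0 _ _ _ (lebesgue_measure_set1 c)).
- apply: measurableI => //; rewrite [X in measurable X](_ : _ = [set c])//.
  by apply/seteqP; split=> x /= /eqP.
- exact: measurable_set1.
- by move=> x [_ /eqP].
Qed.

(** The identity, cut off because [bm] asks for a bound on the whole line; it serves as the atomless
    phi. *)
Definition unif_id (x : RT) : R := if 0 <= x <= 1 then x else 0.

Lemma bm_unif_id : bm unif_id.
Proof.
apply: (bm_intro (M := 1)) => [|x]; rewrite /unif_id.
  apply: measurable_fun_ifT => //.
  by apply: measurable_and; apply: measurable_fun_ler => //; exact: measurable_cst.
by case: ifP => [/andP[x0 x1]|_]; rewrite ?normr0// ger0_norm.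
Qed.

Lemma atomless_unif_id : atomless unif unif_id.
Proof.
move=> c; have bi := bm_unif_id.
rewrite -[RHS](Ex_unif_eq c); apply: eq_Ex_unif; first by bm.
- apply: bm_if; [|bm|bm].
  by apply: measurable_fun_eqr.
- by move=> x x01; rewrite /unif_id x01.
Qed.

Section Quantile.
Variable rho : RT -> R.
Hypothesis brho : bm rho.
Hypothesis rho02 : forall x, 0 <= rho x <= 2.
Hypothesis Erho : Ex rho = 1.

Let F c := Ex (fun x => if x < c then rho x else 0).
Let bF (c : R) : bm (fun x : RT => if x < c then rho x else 0).
Proof. by apply: bm_if; [exact: mb_ltr|bm|bm]. Qed.

Let F_homo c c' : c <= c' -> F c <= F c'.
Proof.
move=> cc; apply: le_Ex => // x; have /andP[r0 _] := rho02 x.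
by case: ltP => xc; case: ltP => xc' //; have := lt_le_trans xc cc; rewrite ltNge xc'.
Qed.

Let F_lip c c' : 0 <= c -> c <= c' -> c' <= 1 -> F c' - F c <= 2 * (c' - c).
Proof.
move=> c0 cc c1.
have b1 (a : R) : bm (fun x : RT => if x < a then 1 else 0 : R) by apply: bm_if; [exact: mb_ltr|bm|bm].
have b1c := b1 c; have b1c' := b1 c'; have bFc := bF c; have bFc' := bF c'.
have c_itv : 0 <= c <= 1 by rewrite c0 (le_trans cc).
have c'_itv : 0 <= c' <= 1 by rewrite c1 (le_trans c0).
have -> : 2 * (c' - c) = Ex (fun x => 2 * ((if x < c' then 1 else 0) - (if x < c then 1 else 0))).
  by rewrite ExZ ?ExB ?Ex_unif_lt//; bm.
rewrite /F -ExB//; apply: le_Ex; [bm|bm|] => x; have /andP[r0 r2] := rho02 x.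
case: ltP => xc; case: ltP => xc'; rewrite ?subrr ?mulr0 ?subr0 ?mulr1//.
by have := lt_le_trans xc' cc; rewrite ltNge xc.
Qed.

Let F0 : F 0 = 0.
Proof.
rewrite -[RHS](Ex_cst P 0); apply: eq_Ex_unif => //; first by bm.
by move=> x /andP[x0 _]; rewrite ltNge x0.
Qed.

Let S u := [set x : R | 0 <= x <= 1 /\ F x <= u].
(** The generalized inverse of F, the distribution function of the density rho. *)
Let sigma (u : RT) : RT := sup (S u).

Let S0 u : 0 <= u -> S u 0.
Proof. by move=> u0; split; [rewrite lexx ler01|rewrite F0]. Qed.

Let ubS u : ubound (S u) 1. Proof. by move=> x [/andP[]]. Qed.

Let hubS u : has_ubound (S u). Proof. by exists 1. Qed.

Let sigma_N u : u < 0 -> sigma u = 0.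
Proof.
move=> u0; rewrite /sigma (_ : S u = set0) ?sup0//.
apply/seteqP; split=> x //= [/andP[x0 x1] Fu].
by have := F_homo x0; rewrite F0 leNgt (le_lt_trans Fu u0).
Qed.

Let sigma_itv u : 0 <= sigma u <= 1.
Proof.
have [u0|u0] := leP 0 u; last by rewrite sigma_N// lexx ler01.
apply/andP; split; first by apply: (ub_le_sup (hubS u)); exact: S0.
by apply: ge_sup => //; exists 0; exact: S0.
Qed.

Let sigma_homo u v : u <= v -> sigma u <= sigma v.
Proof.
move=> uv; have [u0|u0] := leP 0 u; last by rewrite sigma_N//; case/andP: (sigma_itv v).
apply: ge_sup; first by exists 0; exact: S0.
by move=> x [x01 Fx]; apply: (ub_le_sup (hubS v)); split=> //; exact: le_trans Fx uv.
Qed.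

Let sigma_lt u x : 0 <= u -> 0 < x <= 1 -> (sigma u < x) = (u < F x).
Proof.
move=> u0 /andP[x0 x1]; apply/idP/idP; last first.
(* F is 2-Lipschitz on [0,1], so a step of a quarter of the margin F x - u loses at most half of it:
   F x' still exceeds u, and x' bounds [S u]. *)
- move=> uF; pose x' := Num.max 0 (x - (F x - u) / 4).
  have x'x : x' < x by rewrite /x' gt_max x0 ltrBlDr ltrDl divr_gt0// subr_gt0.
  have x'0 : 0 <= x' by rewrite /x' le_max lexx.
  apply: (le_lt_trans _ x'x); apply: ge_sup; first by exists 0; exact: S0.
  move=> y [/andP[y0 y1] Fy]; rewrite leNgt; apply/negP => x'y.
  have : F x' <= u by apply: le_trans Fy; apply: F_homo; exact: ltW.
  have := F_lip x'0 (ltW x'x) x1.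
  have : x - x' <= (F x - u) / 4.
    by rewrite lerBlDr -lerBlDl /x' le_max lexx orbT.
  by move: (F x) (F x') uF => a b; lra.
- apply: contraTT; rewrite -!leNgt => Fu.
  by apply: (ub_le_sup (hubS u)); split; rewrite // (ltW x0).
Qed.

Let m_sigma : measurable_fun setT sigma.
Proof. by apply: nondecreasing_measurable => // x y; exact: sigma_homo. Qed.

Let sigma_law x : Ex (fun y => if sigma y < x then 1 else 0) = F x.
Proof.
have bs (c : R) : bm (fun y : RT => if sigma y < c then 1 else 0 : R).
  by apply: bm_if; [apply: measurable_fun_ltr => //; exact: measurable_cst|bm|bm].
have [x0|x0] := leP x 0.
  transitivity (Ex (fun _ => 0)).
    apply: eq_Ex => y; rewrite ltNge (le_trans x0)//.
    by case/andP: (sigma_itv y).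
  rewrite Ex_cst; apply: le_anti; apply/andP; split; last by rewrite -F0; exact: F_homo.
  by apply: Ex_ge0 => y; case: ifP => // _; case/andP: (rho02 y).
have [x1|x1] := leP x 1.
  have F01 : 0 <= F x <= 1.
    apply/andP; split; first by rewrite -F0; exact: F_homo (ltW x0).
    rewrite -Erho; apply: le_Ex => // y.
    by case: ifP => // _; case/andP: (rho02 y).
  rewrite -[RHS](Ex_unif_lt F01); apply: eq_Ex_unif => //.
    by apply: bm_if; [exact: mb_ltr|bm|bm].
  by move=> y /andP[y0 y1]; rewrite sigma_lt// x0.
transitivity (Ex (fun _ => 1)).
  apply: eq_Ex => y; rewrite (le_lt_trans _ x1)//.
  by case/andP: (sigma_itv y).
rewrite Ex_cst -Erho; apply: eq_Ex_unif => // y /andP[_ y1].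
by rewrite (le_lt_trans y1 x1).
Qed.

Lemma quantile_transform : exists sigma : RT -> RT, measurable_fun setT sigma /\
  forall f : RT -> R, bm f -> Ex (fun x => f (sigma x)) = Ex (fun x => f x * rho x).
Proof.
exists sigma; split; first exact: m_sigma.
move=> f bf.
have rho0 x : 0 <= rho x by case/andP: (rho02 x).
rewrite -(Ex_density brho rho0 Erho bf).
have [Q HQ] := Ex_distribution P m_sigma.
rewrite -(HQ f bf); apply: eq_Ex_rays => // c.
have bc : bm (fun x : RT => if x < c then 1 else 0 : R) by apply: bm_if; [exact: mb_ltr|bm|bm].
rewrite Ex_density// HQ// sigma_law; apply: eq_Ex => x.
by case: ifP => _; rewrite ?mul1r ?mul0r.
Qed.

End Quantile.

Lemma reweightable_unif : reweightable unif.
Proof.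
move=> psi bpsi psi2 Epsi.
have brho : bm (fun x => 1 + psi x) by bm.
apply: quantile_transform => //.
- move=> x; have := psi2 x; rewrite ler_norml => /andP[p1 p2].
  have h2 : 2^-1 <= 1 :> R by rewrite invf_le1 ?ler1n.
  by apply/andP; split; lra.
- by rewrite ExD ?Ex_cst ?Epsi ?addr0//; bm.
Qed.

End UniformProbability.

(** * Kernels equal almost everywhere *)

Section AlmostEqualKernels.
Context d (T : measurableType d) (R : realType) (P : probability T R).
Implicit Types g h : T * T -> R.
Local Notation Ex := (Ex P).
Local Notation Ex2 := (Ex2 P).

Lemma dg_almost_eq g h : bm g -> bm h -> Ex2 (fun p => (g p - h p) ^+ 2) = 0 ->
  Ex (fun x => (dg P g x - dg P h x) ^+ 2) = 0.
Proof.
move=> bg bh gh; have bdg := bm_dg P bg; have bdh := bm_dg P bh.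
have b2 : bm (fun p => (g p - h p) ^+ 2) by bm.
have b2d := bm_dg P b2.
apply: (Ex_null b2d) gh; [bm| |].
- by move=> x; apply: Ex_ge0 => y; exact: sqr_ge0.
- move=> x e; rewrite (_ : dg P g x = dg P h x) ?subrr ?expr0n//.
  apply: eq_Ex_null e; [bm|bm|bm| |].
  + by move=> y; exact: sqr_ge0.
  + by move=> y /eqP; rewrite sqrf_eq0 subr_eq0 => /eqP.
Qed.

Lemma Ex2_almost_eq g h : bm g -> bm h -> Ex2 (fun p => (g p - h p) ^+ 2) = 0 -> Ex2 g = Ex2 h.
Proof.
move=> bg bh gh; apply: eq_Ex2_null gh; [bm|bm|bm| |].
- by move=> p; exact: sqr_ge0.
- by move=> p /eqP; rewrite sqrf_eq0 subr_eq0 => /eqP.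
Qed.

Lemma star_almost_eq k g h : bm g -> bm h -> Ex2 (fun p => (g p - h p) ^+ 2) = 0 ->
  star P k g = star P k h.
Proof.
move=> bg bh gh; have bdg := bm_dg P bg; have bdh := bm_dg P bh.
apply: eq_Ex_null (dg_almost_eq bg bh gh); [bm|bm|bm| |].
- by move=> x; exact: sqr_ge0.
- by move=> x /eqP; rewrite sqrf_eq0 subr_eq0 => /eqP ->.
Qed.

Lemma star_max_almost_eq k g h : symker h -> Ex2 (fun p => (g p - h p) ^+ 2) = 0 ->
  star_max P k g -> star_max P k h.
Proof.
move=> sh gh [sg maxg]; have bg := bm_symker sg; have bh := bm_symker sh.
split=> // f sf; rewrite -(Ex2_almost_eq bg bh gh) -(star_almost_eq k bg bh gh).
exact: maxg.
Qed.

End AlmostEqualKernels.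

(** * Kernels with four blocks *)

Section BlockSums.
Variable R : realFieldType.
Implicit Types (p F : bool -> bool -> R) (K : bool -> bool -> bool -> bool -> bool).

Definition bsum p F := p true true * F true true + p true false * F true false
  + p false true * F false true + p false false * F false false.
Definition bdeg K p i j := bsum p (fun i' j' => if K i j i' j' then 1 else 0).
Definition bden K p := bsum p (bdeg K p).
Definition bstar k K p := bsum p (fun i j => bdeg K p i j ^+ k).

(* Vertices (true, _) form a clique, vertices (false, _) an independent set, and m rules the edges between them. *)
Definition split_rel (m : bool -> bool -> bool) i j i' j' :=
  if i then if i' then true else m j j' else if i' then m j' j else false.

Definition masses p := (forall i j, 0 <= p i j) /\ bsum p (fun _ _ => 1) = 1.

(** Competitors may change the relation as well as the masses, so that a degenerate shape can be
    read as a member of another family and varied there. *)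
Definition block_max k m p := masses p /\ forall m' q, masses q ->
  bden (split_rel m') q = bden (split_rel m) p ->
  bstar k (split_rel m') q <= bstar k (split_rel m) p.

Definition mono2 (m : bool -> bool -> bool) :=
  forall i j i' j', (i ==> i') -> (j ==> j') -> m i j -> m i' j'.

End BlockSums.

Section BlockKernels.
Context d (T : measurableType d) (R : realType) (P : probability T R).
Variables A B : T -> bool.
Hypotheses (mA : measurable_fun setT A) (mB : measurable_fun setT B).

Definition mass i j : R := Ex P (fun x => if (A x == i) && (B x == j) then 1 else 0).

Let mi (C : T -> bool) i : measurable_fun setT C -> measurable_fun setT (fun x => C x == i).
Proof.
case: i => mC; first by under eq_fun do rewrite eqb_id.
by under eq_fun do rewrite eqbF_neg; exact: measurable_neg.
Qed.

Lemma bm_mass i j : bm (fun x => if (A x == i) && (B x == j) then 1 else 0 : R).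
Proof. by apply: bm_if; bm; apply: mi. Qed.

Lemma Ex_block (F : bool -> bool -> R) : Ex P (fun x => F (A x) (B x)) = bsum mass F.
Proof.
have b := bm_mass.
have e : (fun x => F (A x) (B x)) =1 (fun x =>
    F true true * (if (A x == true) && (B x == true) then 1 else 0)
  + F true false * (if (A x == true) && (B x == false) then 1 else 0)
  + F false true * (if (A x == false) && (B x == true) then 1 else 0)
  + F false false * (if (A x == false) && (B x == false) then 1 else 0)).
  by move=> x; case: (A x); case: (B x); rewrite /= !mulr0 !mulr1 ?addr0 ?add0r.
have b11 := b true true; have b10 := b true false; have b01 := b false true; have b00 := b false false.
rewrite (eq_Ex P e) !ExD ?ExZ//; try bm.
by rewrite /bsum ![mass _ _ * _]mulrC.
Qed.

Lemma bm_block (F : bool -> bool -> R) : bm (fun x => F (A x) (B x)).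
Proof.
have e : (fun x => F (A x) (B x)) = (fun x => if A x then if B x then F true true else F true false
   else if B x then F false true else F false false).
  by apply/funext => x; case: (A x); case: (B x).
by rewrite e; apply: bm_if => //; apply: bm_if => //; bm.
Qed.

Lemma masses_mass : masses mass.
Proof.
split; first by move=> i j; apply: Ex_ge0 => x; case: ifP.
by rewrite -(Ex_block (fun _ _ => 1)) Ex_cst.
Qed.

Variable K : bool -> bool -> bool -> bool -> bool.

Definition block_kernel (p : T * T) : R := if K (A p.1) (B p.1) (A p.2) (B p.2) then 1 else 0.

Lemma bm_block_kernel : bm block_kernel.
Proof.
pose G i j i' j' : R := if K i j i' j' then 1 else 0.
pose a i j (x : T) : R := if (A x == i) && (B x == j) then 1 else 0.
have b (F : bool -> bool -> R) := bm_block F.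
have e : block_kernel = (fun p =>
   a true true p.1 * G true true (A p.2) (B p.2) + a true false p.1 * G true false (A p.2) (B p.2)
 + a false true p.1 * G false true (A p.2) (B p.2) + a false false p.1 * G false false (A p.2) (B p.2)).
  apply/funext => p; rewrite /block_kernel /a /G.
  by case: (A p.1); case: (B p.1); rewrite /= !mul0r mul1r ?addr0 ?add0r.
have h i j : bm (fun p : T * T => a i j p.1 * G i j (A p.2) (B p.2)).
  apply: bmM; first exact: (@bm_fst _ _ _ _ _ (a i j) (bm_mass i j)).
  exact: (@bm_snd _ _ _ _ _ _ (b (G i j))).
by rewrite e; do 3 (apply: bmD => //).
Qed.

Lemma symker_block : (forall i j i' j', K i j i' j' = K i' j' i j) -> symker block_kernel.
Proof.
move=> symK; split.
- exact/bm_meas/bm_block_kernel.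
- by move=> x y; rewrite /block_kernel/= symK.
- by move=> p; rewrite /block_kernel; case: ifP; rewrite ?lexx ler01.
Qed.

Lemma dg_block x : dg P block_kernel x = bdeg K mass (A x) (B x).
Proof. by rewrite /bdeg -(Ex_block (fun i' j' => if K (A x) (B x) i' j' then 1 else 0)). Qed.

Lemma Ex2_block : Ex2 P block_kernel = bden K mass.
Proof. by rewrite /bden -Ex_block; apply: eq_Ex => x; exact: dg_block. Qed.

Lemma star_block k : star P k block_kernel = bstar k K mass.
Proof. by rewrite /bstar -(Ex_block (fun i j => bdeg K mass i j ^+ k)); apply: eq_Ex => x; rewrite dg_block. Qed.

End BlockKernels.

(** * Reduction of a maximizer to four blocks *)

Lemma eq_min_neq_max (R : realFieldType) (a b x : R) :
  (x == a) || (x == b) -> x != Num.max a b -> x = Num.min a b.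
Proof. by case: leP => h /orP[]/eqP -> //; rewrite eqxx. Qed.

Section BlockReduction.
Context d (T : measurableType d) (R : realType) (P : probability T R).
Local Notation Ex := (Ex P).
Local Notation Ex2 := (Ex2 P).
Hypothesis rew : reweightable P.
Variable phi : T -> R.
Hypotheses (bphi : bm phi) (aphi : atomless P phi).
Variables (n : nat) (g : T * T -> R).
Hypothesis gmax : star_max P n.+2 g.

(** A is the side of the threshold on which a vertex lies, and B tells which of the two degrees of
    that side it has, true for the larger one; this choice makes m monotone. *)
Lemma block_reduction : exists A B m,
  [/\ measurable_fun setT A, measurable_fun setT B, mono2 m &
      Ex2 (fun p => (g p - block_kernel R A B (split_rel m) p) ^+ 2) = 0].
Proof.
have sg : symker g by case: gmax.
have bg := bm_symker sg.
have [e [l gE]] := threshold_kernel gmax bphi aphi.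
pose D := dg P g; have bD : bm D by exact: bm_dg.
pose r x := D x ^+ n.+1; have br : bm r by rewrite /r; bm.
(* Equal to g almost everywhere, b obeys the threshold rule at every point, as [two_valued]
   requires. Its levels come from D, the degree of g and not of b. *)
pose b p : R := if threshold e l (r p.1 + r p.2) then 1 else 0.
have bb : bm b.
  by apply: bm_if; [apply: mb_threshold; bm|bm|bm].
have {}gE : Ex2 (fun p => (g p - b p) ^+ 2) = 0 by exact: gE.
have sb : symker b.
  split; first exact: bm_meas.
  - by move=> x y; rewrite /b/= addrC.
  - by move=> p; rewrite /b; case: ifP; rewrite ?lexx ler01.
have bmax := star_max_almost_eq sb gE gmax.
have bdb := bm_dg P bb.
have DE : Ex (fun x => (D x - dg P b x) ^+ 2) = 0 by exact: dg_almost_eq.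
pose A x := threshold e l (r x + r x).
have mA : measurable_fun setT A by apply: mb_threshold; bm.
have A1 x y : A x -> A y -> b (x, y) = 1.
  move=> Ax Ay; rewrite /b/=.
  have [rxy|ryx] := leP (r x) (r y).
  - by rewrite (threshold_homo _ Ax)// lerD2l.
  - by rewrite (threshold_homo _ Ay)// lerD2r ltW.
have A0 x y : ~~ A x -> ~~ A y -> b (x, y) = 0.
  move=> /negP Ax /negP Ay; rewrite /b/=; case: ifP => // th.
  have [rxy|ryx] := leP (r x) (r y).
  - by case: Ay; apply: threshold_homo th; rewrite lerD2r.
  - by case: Ax; apply: threshold_homo th; rewrite lerD2l ltW.
have [v1 [v2 vE]] := two_valued rew bmax mA A1 br (fun p => erefl).
have mAN : measurable_fun setT (fun x => ~~ A x) by exact: measurable_neg.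
have [w1 [w2 wE]] := two_valued rew bmax mAN A0 br (fun p => erefl).
pose vt := Num.max (v1 ^+ n.+1) (v2 ^+ n.+1); pose vf := Num.min (v1 ^+ n.+1) (v2 ^+ n.+1).
pose wt := Num.max (w1 ^+ n.+1) (w2 ^+ n.+1); pose wf := Num.min (w1 ^+ n.+1) (w2 ^+ n.+1).
pose B x := if A x then r x == vt else r x == wt.
have mB : measurable_fun setT B.
  have -> : B = (fun x => A x && (r x == vt) || ~~ A x && (r x == wt)).
    by apply/funext => x; rewrite /B; case: (A x); rewrite ?orbF.
  by bm.
pose m (i j : bool) := threshold e l ((if i then vt else vf) + (if j then wt else wf)).
have vle : vf <= vt by rewrite /vf /vt ge_min !le_max lexx.
have wle : wf <= wt by rewrite /wf /wt ge_min !le_max lexx.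
exists A, B, m; split=> //.
  move=> i j i' j' ii jj; apply: threshold_homo; apply: lerD.
  - by case: i ii; case: i'.
  - by case: j jj; case: j'.
(* Its zeros are the vertices where D is the degree of b and takes one of the two values of their
   side; with (g - b)^2 added, it certifies the block form. *)
pose bad x := (D x - dg P b x) ^+ 2
  + ((if A x then ((dg P b x - v1) * (dg P b x - v2)) ^+ 2 else 0)
   + (if ~~ A x then ((dg P b x - w1) * (dg P b x - w2)) ^+ 2 else 0)).
have bv : bm (fun x => if A x then ((dg P b x - v1) * (dg P b x - v2)) ^+ 2 else 0) by bm.
have bw : bm (fun x => if ~~ A x then ((dg P b x - w1) * (dg P b x - w2)) ^+ 2 else 0) by bm.
have bbad : bm bad by rewrite /bad; bm.
have Ebad : Ex bad = 0 by rewrite /bad ExD ?ExD ?DE ?vE ?wE ?addr0//; bm.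
have bad0 x : 0 <= bad x.
  by rewrite /bad !addr_ge0 ?sqr_ge0//; case: ifP; rewrite ?sqr_ge0.
have goodA x : bad x = 0 -> A x -> r x = if B x then vt else vf.
  move=> /eqP; rewrite /bad => + Ax; rewrite Ax /= addr0 paddr_eq0 ?sqr_ge0//.
  rewrite !sqrf_eq0 subr_eq0 mulf_eq0 !subr_eq0 => /andP[/eqP Dd vv].
  rewrite /B Ax; have [//|] := eqVneq (r x) vt; apply: eq_min_neq_max.
  by rewrite /r Dd; case/orP: vv => /eqP ->; rewrite eqxx ?orbT.
have goodN x : bad x = 0 -> ~~ A x -> r x = if B x then wt else wf.
  move=> /eqP; rewrite /bad => + Ax; rewrite Ax (negbTE Ax) /= add0r paddr_eq0 ?sqr_ge0//.
  rewrite !sqrf_eq0 subr_eq0 mulf_eq0 !subr_eq0 => /andP[/eqP Dd vv].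
  rewrite /B (negbTE Ax); have [//|] := eqVneq (r x) wt; apply: eq_min_neq_max.
  by rewrite /r Dd; case/orP: vv => /eqP ->; rewrite eqxx ?orbT.
have bK := bm_block_kernel R mA mB (split_rel m).
have bb12 : bm (fun p : T * T => bad p.1 + bad p.2).
  by apply: bmD; [exact: (@bm_fst _ _ _ _ _ bad bbad)|exact: (@bm_snd _ _ _ _ _ bad bbad)].
have bgb : bm (fun p => (g p - b p) ^+ 2) by exact: (bmX 2 (bmD bg (bmN bb))).
have bgK : bm (fun p => (g p - block_kernel R A B (split_rel m) p) ^+ 2).
  exact: (bmX 2 (bmD bg (bmN bK))).
apply: (@Ex2_null _ _ _ _ (fun p => (g p - b p) ^+ 2 + (bad p.1 + bad p.2))); [exact: bmD|exact: bgK| | |].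
- by move=> p; apply: addr_ge0; [exact: sqr_ge0|apply: addr_ge0; exact: bad0].
- move=> [x y] /eqP; rewrite (paddr_eq0 (sqr_ge0 _) (addr_ge0 (bad0 _) (bad0 _))) (paddr_eq0 (bad0 _) (bad0 _))/= => /and3P[gb /eqP bx /eqP by_].
  move: gb; rewrite sqrf_eq0 subr_eq0 => /eqP ->.
  suff -> : b (x, y) = block_kernel R A B (split_rel m) (x, y) by rewrite subrr expr0n.
  rewrite /block_kernel /split_rel /=.
  have [Ax|Ax] := boolP (A x); have [Ay|Ay] := boolP (A y).
  + exact: A1.
  + by rewrite /b/= (goodA x bx Ax) (goodN y by_ Ay); exact: erefl.
  + by rewrite /b/= (goodN x bx Ax) (goodA y by_ Ay) addrC; exact: erefl.
  + exact: A0.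
- have bb1 := @bm_fst _ _ T T _ bad bbad; have bb2 := @bm_snd _ _ T T _ bad bbad.
  have e1 : Ex2 (fun p => bad p.1) = 0.
    by apply: etrans Ebad; apply: eq_Ex => x; exact: (Ex_cst P (bad x)).
  have e2 : Ex2 (fun p => bad p.2) = 0.
    by apply: etrans (Ex_cst P 0); apply: eq_Ex => x; exact: Ebad.
  by rewrite (Ex2D _ bgb bb12) gE add0r (Ex2D _ bb1 bb2) e1 e2 addr0.
Qed.

End BlockReduction.

(** * Prescribed block masses on the unit interval *)

Lemma block_indicators (R : pzRingType) (b1 b2 b3 : bool) : (b1 -> b2) -> (b2 -> b3) ->
  let B := b1 || (~~ b2 && b3) in
  [/\ (if (b2 == true) && (B == true) then 1 else 0) = (if b1 then 1 else 0) :> R,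
      (if (b2 == true) && (B == false) then 1 else 0) =
        (if b2 then 1 else 0) - (if b1 then 1 else 0) :> R,
      (if (b2 == false) && (B == true) then 1 else 0) =
        (if b3 then 1 else 0) - (if b2 then 1 else 0) :> R &
      (if (b2 == false) && (B == false) then 1 else 0) = 1 - (if b3 then 1 else 0) :> R].
Proof.
case: b1; case: b2; case: b3 => h1 h2; try (by have := h1 isT); try (by have := h2 isT);
by rewrite /= ?subrr ?subr0.
Qed.

Section UniformBlocks.
Variable R : realType.
Local Notation RT := (measurableTypeR R).
Local Notation Ex := (Ex (unif R)).

(** The partial sums t1 <= t2 <= t3 cut [0,1] into consecutive intervals, one for each cell;
    [block_indicators] writes their indicators as differences of indicators of rays. *)
Lemma exists_blocks (q : bool -> bool -> R) : masses q -> exists A B : RT -> bool,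
  [/\ measurable_fun setT A, measurable_fun setT B & mass (unif R) A B = q].
Proof.
move=> [q0 q1]; set t1 := q true true; set t2 := t1 + q true false; set t3 := t2 + q false true.
move: q1; rewrite /bsum !mulr1 -/t1 -/t2 -/t3 => q1.
have q11 := q0 true true; have q10 := q0 true false.
have q01 := q0 false true; have q00 := q0 false false.
have t1_0 : 0 <= t1 by [].
have t12 : t1 <= t2 by rewrite lerDl.
have t23 : t2 <= t3 by rewrite lerDl.
have t3_1 : t3 <= 1 by rewrite -q1 lerDl.
have E1 := @Ex_unif_lt R t1 ltac:(by apply/andP; split; lra).
have E2 := @Ex_unif_lt R t2 ltac:(by apply/andP; split; lra).
have E3 := @Ex_unif_lt R t3 ltac:(by apply/andP; split; lra).
have b1 (a : R) : bm (fun x : RT => if x < a then 1 else 0 : R) by apply: bm_if; [exact: mb_ltr|bm|bm].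
have bt1 := b1 t1; have bt2 := b1 t2; have bt3 := b1 t3.
pose A (x : RT) := x < t2.
pose B (x : RT) := (x < t1) || ((~~ (x < t2)) && (x < t3)).
have mA : measurable_fun setT A by exact: mb_ltr.
have mB : measurable_fun setT B.
  apply: measurable_or; first exact: mb_ltr.
  by apply: measurable_and; [apply: measurable_neg|]; exact: mb_ltr.
exists A, B; split=> //; apply/funext => i; apply/funext => j; rewrite /mass.
have lt12 (x : RT) : x < t1 -> x < t2 by move=> h; exact: lt_le_trans h t12.
have lt23 (x : RT) : x < t2 -> x < t3 by move=> h; exact: lt_le_trans h t23.
have ind x := block_indicators R (lt12 x) (lt23 x).
case: i; case: j.
- by rewrite -[RHS]E1; apply: eq_Ex => x; case: (ind x).
- transitivity (Ex (fun x : RT => (if x < t2 then 1 else 0) - (if x < t1 then 1 else 0))).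
    by apply: eq_Ex => x; case: (ind x).
  by rewrite (ExB (unif R) bt2 bt1) E1 E2 /t2 addrAC subrr add0r.
- transitivity (Ex (fun x : RT => (if x < t3 then 1 else 0) - (if x < t2 then 1 else 0))).
    by apply: eq_Ex => x; case: (ind x).
  by rewrite (ExB (unif R) bt3 bt2) E3 E2 /t3 addrAC subrr add0r.
- transitivity (Ex (fun x : RT => 1 - (if x < t3 then 1 else 0))).
    by apply: eq_Ex => x; case: (ind x).
  rewrite (ExB (unif R) (bm_cst _ 1) bt3) Ex_cst E3.
  by rewrite -q1 [_ + q _ _]addrC addrK.
Qed.

Lemma split_rel_sym m i j i' j' : split_rel m i j i' j' = split_rel m i' j' i j.
Proof. by rewrite /split_rel; case: i; case: i'. Qed.

Lemma block_max_unif n m (A B : RT -> bool) :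
  measurable_fun setT A -> measurable_fun setT B ->
  star_max (unif R) n (block_kernel R A B (split_rel m)) ->
  block_max n m (mass (unif R) A B).
Proof.
move=> mA mB [sK maxK]; split; first exact: masses_mass.
move=> m' q /exists_blocks[A' [B' [mA' mB' <-]]] denE.
rewrite -!star_block//; apply: maxK; last by rewrite !Ex2_block.
by apply: symker_block => // i j i' j'; exact: split_rel_sym.
Qed.

End UniformBlocks.

(** * A second-order test in one variable *)

Import numFieldNormedType.Exports.

Section SecondOrderTest.
Variable R : realType.
Implicit Types f g : R -> R.

Lemma is_derive_add f g (x a b : R) : is_derive x 1 f a -> is_derive x 1 g b ->
  is_derive x 1 (fun t => f t + g t) (a + b).
Proof. by move=> hf hg; exact: is_deriveD. Qed.

Lemma is_derive_opp f (x a : R) : is_derive x 1 f a -> is_derive x 1 (fun t => - f t) (- a).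
Proof. by move=> hf; exact: is_deriveN. Qed.

Lemma is_derive_mul f g (x a b : R) : is_derive x 1 f a -> is_derive x 1 g b ->
  is_derive x 1 (fun t => f t * g t) (f x * b + g x * a).
Proof. by move=> hf hg; exact: is_deriveM. Qed.

Lemma is_derive_horner f (x a : R) (p : {poly R}) : is_derive x 1 f a ->
  is_derive x 1 (fun t => p.[f t]) (p^`().[f x] * a).
Proof. by move=> hf; exact: (@is_derive1_comp R (horner p) f). Qed.

Lemma is_derive_const (c x : R) : is_derive x 1 (fun _ => c) 0.
Proof. exact: is_derive_cst. Qed.

Lemma is_derive_pos_right f (x d : R) : is_derive x 1 f d -> f x = 0 -> 0 < d ->
  exists2 e, 0 < e & forall t, x < t < x + e -> 0 < f t.
Proof.
move=> [fd fE] fx0 d0.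
have cv : h^-1 *: ((f \o shift x) (h *: 1) - f x) @[h --> 0^'] --> d.
  by rewrite -fE; exact: fd.
have [e /= e0 He] := cvgr_gt d cv 0 d0.
exists e => // t /andP[xt te].
have h0 : 0 < t - x by rewrite subr_gt0.
have := He (t - x); rewrite /= sub0r normrN gtr0_norm// ltrBlDl => /(_ te (lt0r_neq0 h0)).
by rewrite fx0 subr0 scaler1 subrK pmulr_rgt0// invr_gt0.
Qed.

(** Were [ddf] positive, [df] would be positive just to the right of its zero at 0, and the mean
    value theorem would give f t > f 0. *)
Lemma second_order_test f df (ddf e : R) : 0 < e ->
  (forall t, `|t| < e -> f t <= f 0) ->
  (forall t, is_derive (t : R) 1 f (df t)) -> is_derive (0 : R) 1 df ddf -> df 0 = 0 /\ ddf <= 0.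
Proof.
move=> e0 fmax fd dfd.
have df0 : df 0 = 0.
  have h : is_derive (0 : R) 1 f 0.
    apply: (@derive1_at_max R f (- e) e).
    - by rewrite (le_trans _ (ltW e0))// oppr_le0 ltW.
    - by move=> t _; case: (fd t).
    - by rewrite in_itv/= oppr_lt0 e0.
    - by move=> t; rewrite in_itv/= => te; apply: fmax; rewrite ltr_norml.
  by have := @derive_val _ _ _ _ _ _ _ (fd 0); rewrite (@derive_val _ _ _ _ _ _ _ h).
split=> //; rewrite leNgt; apply/negP => dd0.
have [e' e'0 pos] := is_derive_pos_right dfd df0 dd0.
pose t := Num.min e e' / 2.
have m0 : 0 < Num.min e e' by rewrite lt_min e0.
have t0 : 0 < t by rewrite /t divr_gt0.
have tm : t < Num.min e e' by rewrite /t ltr_pdivrMr// ltr_pMr// ltr1n.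
have [te te'] : t < e /\ t < e' by move: tm; rewrite lt_min => /andP.
have [|c cI] := MVT t0 (fun x _ => fd x).
  apply: derivable_within_continuous => x _; by case: (fd x).
move: cI; rewrite in_itv/= subr0 => /andP[c0 ct] fE.
have : 0 < df c * t by rewrite mulr_gt0// pos// add0r c0 (lt_trans ct).
by rewrite -fE subr_gt0 ltNge fmax// gtr0_norm.
Qed.

End SecondOrderTest.

(** * The curve of constant density *)

Section HyperbolaCurve.
Variable R : realType.
Variable Phi : {poly R}.
Implicit Types b S : R.

(** Up to a constant, a star density in which b and S - b are the sizes of two parts: Phi = (a +
    X)^k when a dominating part of size a is fixed, Phi = (1 - X)^k for three parts. In both, the
    edge density depends on (2 S - b) b only. *)
Definition Fval b S := b * Phi.[S] + (S - b) * Phi.[b] - S * Phi.[0].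

(* First and second derivatives of Fval along the flow b' = - b, S' = S - b, which preserves (2 S - b) b. *)
Definition Hval b S := - (b * Phi.[S]) + b * (S - b) * Phi^`().[S] + S * Phi.[b]
  - (S - b) * b * Phi^`().[b] - (S - b) * Phi.[0].
Definition DHval b S := b * Phi.[S] - b * (S - b) * Phi^`().[S] - b * (S - b) * Phi^`().[S]
  + b * S * Phi^`().[S] + b * (S - b) ^+ 2 * Phi^`()^`().[S]
  + (S - b) * Phi.[b] - S * b * Phi^`().[b] - S * b * Phi^`().[b]
  + (S - b) * b * Phi^`().[b] + (S - b) * b ^+ 2 * Phi^`()^`().[b] - S * Phi.[0].

Section Flow.
Variables b S : R.
(** In the coordinates b and 2 S - b the hyperbola is a constant product, and the flow scales them
    by exp(-t) and exp(t). *)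
Definition flow_b (t : R) : R := b * expR (- t).
Definition flow_S (t : R) : R := ((2 * S - b) * expR t + b * expR (- t)) / 2.

Lemma flow_invariant t : (2 * flow_S t - flow_b t) * flow_b t = (2 * S - b) * b.
Proof.
have e : expR t * expR (- t) = 1 by rewrite -expRD subrr expR0.
rewrite /flow_S /flow_b mulrC.
transitivity ((2 * S - b) * b * (expR t * expR (- t))); first by field.
by rewrite e mulr1.
Qed.

Lemma flow_b0 : flow_b 0 = b. Proof. by rewrite /flow_b oppr0 expR0 mulr1. Qed.
Lemma flow_S0 : flow_S 0 = S. Proof. by rewrite /flow_S oppr0 expR0; field. Qed.

Let is_derive_expRN (t : R) : is_derive t 1 (fun u => expR (- u)) (- expR (- t)).
Proof.
have h : is_derive t 1 (fun u : R => - u) (- 1) by exact: is_derive_opp (is_derive_id t 1).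
apply: is_derive_eq (@is_derive1_comp R expR (fun u => - u) t _ _ (is_derive_expR _) h) _.
by rewrite mulrN1.
Qed.

Lemma is_derive_flow_b (t : R) : is_derive t 1 flow_b (- flow_b t).
Proof.
apply: is_derive_eq (is_derive_mul (is_derive_const b t) (is_derive_expRN t)) _.
by rewrite /flow_b; ring.
Qed.

Lemma is_derive_flow_S (t : R) : is_derive t 1 flow_S (flow_S t - flow_b t).
Proof.
apply: is_derive_eq (is_derive_mul (is_derive_add
  (is_derive_mul (is_derive_const (2 * S - b) t) (is_derive_expR t))
  (is_derive_mul (is_derive_const b t) (is_derive_expRN t))) (is_derive_const 2^-1 t)) _.
by rewrite /flow_S /flow_b; field.
Qed.

Lemma is_derive_Fval (t : R) :
  is_derive t 1 (fun u => Fval (flow_b u) (flow_S u)) (Hval (flow_b t) (flow_S t)).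
Proof.
have db := is_derive_flow_b t; have dS := is_derive_flow_S t.
have dSb := is_derive_add dS (is_derive_opp db).
apply: is_derive_eq (is_derive_add (is_derive_add (is_derive_mul db (is_derive_horner Phi dS))
  (is_derive_mul dSb (is_derive_horner Phi db)))
  (is_derive_opp (is_derive_mul dS (is_derive_const Phi.[0] t)))) _.
by rewrite /Hval; ring.
Qed.

Lemma is_derive_Hval (t : R) :
  is_derive t 1 (fun u => Hval (flow_b u) (flow_S u)) (DHval (flow_b t) (flow_S t)).
Proof.
have db := is_derive_flow_b t; have dS := is_derive_flow_S t.
have dSb := is_derive_add dS (is_derive_opp db).
have d1 := is_derive_opp (is_derive_mul db (is_derive_horner Phi dS)).
have d2 := is_derive_mul (is_derive_mul db dSb) (is_derive_horner Phi^`() dS).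
have d3 := is_derive_mul dS (is_derive_horner Phi db).
have d4 := is_derive_opp (is_derive_mul (is_derive_mul dSb db) (is_derive_horner Phi^`() db)).
have d5 := is_derive_opp (is_derive_mul dSb (is_derive_const Phi.[0] t)).
apply: is_derive_eq (is_derive_add (is_derive_add (is_derive_add (is_derive_add d1 d2) d3) d4) d5) _.
by rewrite /DHval; ring.
Qed.

Lemma flow_near u : 0 < b -> b < S -> S < u -> exists2 e, 0 < e &
  forall t, `|t| < e -> [/\ 0 < flow_b t, flow_b t < flow_S t & flow_S t < u].
Proof.
move=> b0 bS Su.
have cb : {for (0 : R), continuous flow_b}.
  by apply: differentiable_continuous; apply/derivable1_diffP; case: (is_derive_flow_b 0).
have cS : {for (0 : R), continuous flow_S}.
  by apply: differentiable_continuous; apply/derivable1_diffP; case: (is_derive_flow_S 0).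
have near1 : \forall t \near (0 : R), flow_b t < (b + S) / 2.
  by apply: (cvgr_lt _ cb); rewrite flow_b0; lra.
have near2 : \forall t \near (0 : R), (b + S) / 2 < flow_S t.
  by apply: (cvgr_gt _ cS); rewrite flow_S0; lra.
have near3 : \forall t \near (0 : R), flow_S t < u.
  by apply: (cvgr_lt _ cS); rewrite flow_S0.
have [e /= e0 He] : \forall t \near (0 : R), [/\ flow_b t < (b + S) / 2, (b + S) / 2 < flow_S t & flow_S t < u].
  by apply: filterS3 near1 near2 near3.
exists e => // t te; have [|h1 h2 h3] := He t; first by rewrite /= sub0r normrN.
split=> //; last exact: lt_trans h1 h2.
by rewrite /flow_b mulr_gt0// expR_gt0.
Qed.

End Flow.

Lemma hyperbola_local_max b S u : 0 < b -> b < S -> S < u ->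
  (forall b' S', 0 < b' -> b' < S' -> S' < u -> (2 * S' - b') * b' = (2 * S - b) * b ->
     Fval b' S' <= Fval b S) ->
  Hval b S = 0 /\ DHval b S <= 0.
Proof.
move=> b0 bS Su Fmax.
have [e e0 near] := flow_near b0 bS Su.
have := second_order_test e0 _ (is_derive_Fval b S) (is_derive_Hval b S 0).
rewrite flow_b0 flow_S0; apply => t /near[? ? ?].
by apply: Fmax => //; exact: flow_invariant.
Qed.

End HyperbolaCurve.

(** * No local maximum along the curve for shifted powers *)

Section MonomialConvexity.
Variable R : realType.
Implicit Types (b S x : R) (Phi Psi : {poly R}).

(** Linear in Phi and, where [Hval] vanishes, of the sign of [DHval]. With this multiple of [Hval]
    subtracted, every monomial contributes a nonnegative amount, whether or not the point is
    critical for it. *)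
Definition Xval Phi b S := (S - b) * DHval Phi b S - S * Hval Phi b S.

Lemma XvalD Phi Psi b S : Xval (Phi + Psi) b S = Xval Phi b S + Xval Psi b S.
Proof. by rewrite /Xval /DHval /Hval !derivD !hornerD; ring. Qed.

Lemma XvalZ c Phi b S : Xval (c *: Phi) b S = c * Xval Phi b S.
Proof. by rewrite /Xval /DHval /Hval !derivZ !hornerZ; ring. Qed.

Lemma Xval0 b S : Xval 0 b S = 0.
Proof. by rewrite /Xval /DHval /Hval !deriv0 !horner0; ring. Qed.

(** T is 1 + x + ... + x^(m-1), and V is the sum of the quotients (x^j - 1)/(x - 1) for j from 1 to
    m. *)
Lemma geometric_sums (x : R) m : 0 <= x -> exists T V, [/\ 0 <= T, 0 <= V,
  x ^+ m = 1 + (x - 1) * T & (x - 1) * V = x * T - m%:R].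
Proof.
move=> x0; elim: m => [|m [T [V [T0 V0 xm VE]]]].
  by exists 0, 0; split=> //; rewrite ?expr0; ring.
have xT0 : 0 <= x * T by rewrite mulr_ge0.
exists (1 + x * T), (V + (1 + x * T)); split.
- by rewrite addr_ge0.
- by rewrite !addr_ge0.
- by rewrite exprS xm; ring.
- by rewrite mulrDr VE -natr1; ring.
Qed.

Lemma Xval_monomial m b x : Xval ('X^(m.+2)) b (b * x) =
  b ^+ m.+2 * b ^+ 2 * ((x - 1) * ((x ^+ 2 * x ^+ m - m.+2%:R * (x - 1) * (x * x ^+ m)
     - m.+2%:R * (x - 1) * (x * x ^+ m)
     + m.+2%:R * x * (x * x ^+ m) + m.+2%:R * m.+1%:R * (x - 1) ^+ 2 * x ^+ m
     + (x - 1) - m.+2%:R * x - m.+2%:R * x + m.+2%:R * (x - 1) + m.+2%:R * m.+1%:R * (x - 1)))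
   - x * (- (x ^+ 2 * x ^+ m) + m.+2%:R * (x - 1) * (x * x ^+ m) + x - m.+2%:R * (x - 1))).
Proof.
rewrite /Xval /DHval /Hval !derivXn/= !derivMn !derivXn/= !hornerMn !hornerXn expr0n/=.
rewrite !exprMn !exprS; move: (b ^+ m) (x ^+ m) => bm xm.
by ring.
Qed.

(** The maximum over d is (2 N - 3)^2 / (4 N (N - 1)), at most 1 once 8 N >= 9. *)
Lemma quadratic_bound (N d : R) : 2 <= N -> 0 <= d -> d * (2 * N - 3 - N * (N - 1) * d) <= 1.
Proof.
move=> N2 d0.
have NN : 0 < N * (N - 1) by apply: mulr_gt0; lra.
have : 0 <= (2 * (N * (N - 1)) * d - (2 * N - 3)) ^+ 2 by exact: sqr_ge0.
have : (2 * N - 3) ^+ 2 <= 4 * (N * (N - 1)) by nra.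
move: NN; set M := N * (N - 1) => M0 h1 h2.
have : 0 <= 4 * M * (1 - d * (2 * N - 3 - M * d)) by nra.
by rewrite pmulr_rge0 ?subr_ge0//; lra.
Qed.

Lemma Xval_monomial_pos m b S : 0 < b -> b < S -> 0 < Xval ('X^(m.+2)) b S.
Proof.
move=> b0 bS; pose x := S / b.
have SE : S = b * x by rewrite /x mulrC divfK// gt_eqF.
have x1 : 1 < x by rewrite /x ltr_pdivlMr// mul1r.
have x0 : 0 <= x by lra.
have [T [V [T0 V0 xm VE]]] := geometric_sums m x0.
rewrite SE Xval_monomial; apply: mulr_gt0; first by rewrite mulr_gt0// exprn_gt0.
pose N : R := m.+1%:R.
(* The cofactor of the double root at x = 1; T and V express it without division by x - 1. *)
pose G := N * (N - 1) * x * (1 + (x - 1) * T) - (N ^+ 2 + N - 3) * (1 + (x - 1) * T)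
  + V + 3 * T + N * (N + 1).
suff [G0 ->] : 0 < G /\ (x - 1) * ((x ^+ 2 * x ^+ m - m.+2%:R * (x - 1) * (x * x ^+ m)
     - m.+2%:R * (x - 1) * (x * x ^+ m)
     + m.+2%:R * x * (x * x ^+ m) + m.+2%:R * m.+1%:R * (x - 1) ^+ 2 * x ^+ m
     + (x - 1) - m.+2%:R * x - m.+2%:R * x + m.+2%:R * (x - 1) + m.+2%:R * m.+1%:R * (x - 1)))
   - x * (- (x ^+ 2 * x ^+ m) + m.+2%:R * (x - 1) * (x * x ^+ m) + x - m.+2%:R * (x - 1))
   = (x - 1) ^+ 2 * G.
  by rewrite mulr_gt0// exprn_gt0// subr_gt0.
split; last first.
  have VE' : (x - 1) ^+ 2 * V = (x - 1) * (x * T - (N - 1)).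
    by rewrite expr2 -mulrA VE /N -natr1 addrK.
  have -> : (x - 1) ^+ 2 * G = (x - 1) ^+ 2 * (N * (N - 1) * x * (1 + (x - 1) * T)
      - (N ^+ 2 + N - 3) * (1 + (x - 1) * T) + 3 * T + N * (N + 1)) + (x - 1) ^+ 2 * V.
    by rewrite /G; ring.
  by rewrite VE' xm -[m.+2%:R]natr1 -/N; ring.
(* m = 0 gives N = 1, outside the range of [quadratic_bound]. *)
have [m0|m0] := posnP m.
  move: VE xm; rewrite /G /N m0 expr0 => VE xm; nra.
have N2 : 2 <= N by rewrite /N ler_nat.
have d0 : 0 <= x - 1 by lra.
have qb := quadratic_bound N2 d0.
have : (x - 1) * (2 * N - 3 - N * (N - 1) * (x - 1)) * T <= T by rewrite ler_piMl.
(* By the quadratic bound the last term costs at most T, against 3 T available, and N (N + 1)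
   outweighs 2 N - 3. *)
have -> : G = N * (N - 1) * (x - 1) - (2 * N - 3) + N * (N + 1) + V + 3 * T
   - (x - 1) * (2 * N - 3 - N * (N - 1) * (x - 1)) * T by rewrite /G; ring.
have : 0 <= N * (N - 1) * (x - 1) by rewrite !mulr_ge0//; lra.
by move: N N2 {qb G} => N N2 h1 h2; nra.
Qed.

Lemma Xval_monomial_ge0 j b S : 0 < b -> b < S -> 0 <= Xval ('X^j) b S.
Proof.
move=> b0 bS; case: j => [|[|m]]; last by rewrite ltW// Xval_monomial_pos.
  rewrite expr0 -polyC1 /Xval /DHval /Hval !derivC ?deriv0 ?horner0 !hornerC ?horner0.
  by rewrite le_eqVlt; apply/orP; left; apply/eqP; ring.
rewrite expr1 /Xval /DHval /Hval !derivX -polyC1 !derivC ?horner0 !hornerX !hornerC ?horner0.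
by rewrite le_eqVlt; apply/orP; left; apply/eqP; ring.
Qed.

(** For a >= 0 the binomial coefficients are nonnegative weights; the leading weight 1 gives
    strictness. *)
Lemma Xval_shift_pos (a : R) n b S : 0 <= a -> 0 < b -> b < S ->
  0 < Xval ((a%:P + 'X) ^+ n.+2) b S.
Proof.
move=> a0 b0 bS.
have -> : (a%:P + 'X) ^+ n.+2 =
    \sum_(i < n.+3) (a ^+ (n.+2 - i) * 'C(n.+2, i)%:R) *: 'X^i :> {poly R}.
  rewrite exprDn; apply: eq_bigr => i _.
  by rewrite mulr_natr -scalerMnl -polyC_exp mul_polyC.
rewrite big_ord_recr /= XvalD subnn binn expr0 mulr1 scale1r.
rewrite ltr_wpDl ?Xval_monomial_pos//.
elim/big_ind: _ => [|P Q hP hQ|i _]; first by rewrite Xval0.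
- by rewrite XvalD addr_ge0.
- by rewrite XvalZ mulr_ge0 ?Xval_monomial_ge0// mulr_ge0 ?exprn_ge0.
Qed.

Lemma shift_not_local_max (a : R) n b S : 0 <= a -> 0 < b -> b < S -> a + S < 1 ->
  exists b' S', [/\ 0 < b', b' < S', a + S' < 1, (2 * S' - b') * b' = (2 * S - b) * b &
    Fval ((a%:P + 'X) ^+ n.+2) b S < Fval ((a%:P + 'X) ^+ n.+2) b' S'].
Proof.
move=> a0 b0 bS aS; apply: contrapT => no.
have [||||H0 DH0] := @hyperbola_local_max R ((a%:P + 'X) ^+ n.+2) b S (1 - a) => //.
- by lra.
- move=> b' S' b'0 b'S' S'u e; rewrite leNgt; apply/negP => lt.
  by apply: no; exists b', S'; split=> //; lra.
have X0 := Xval_shift_pos n a0 b0 bS.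
have Sb : 0 < S - b by rewrite subr_gt0.
by move: X0; rewrite /Xval H0 mulr0 subr0 (pmulr_rgt0 _ Sb) ltNge DH0.
Qed.

End MonomialConvexity.

(** * Power sums for the three-part case *)

Section PowerSumEstimates.
Variable R : realFieldType.
Implicit Types t x z : R.

(** [vsum], [wsum] and [zsum] are the factors left in the derivatives along the curve once (1 -
    t)^2, z - 1 and (z - 1)^2 are split off; as sums they have visible signs. *)
Definition vsum n t : R := \sum_(i < n) i.+1%:R * t ^+ i.
Definition wsum n z : R := \sum_(j < n) (z ^+ j.+1 - 1).
Definition zsum n z : R := \sum_(j < n) j.+1%:R * z ^+ j.+1.

Lemma vsumS n t : vsum n.+1 t = vsum n t + n.+1%:R * t ^+ n.
Proof. exact: big_ord_recr. Qed.

Lemma wsumS n z : wsum n.+1 z = wsum n z + (z ^+ n.+1 - 1).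
Proof. exact: big_ord_recr. Qed.

Lemma zsumS n z : zsum n.+1 z = zsum n z + n.+1%:R * z ^+ n.+1.
Proof. exact: big_ord_recr. Qed.

Lemma vsumE n t : (1 - t) ^+ 2 * vsum n t = 1 - t ^+ n - n%:R * t ^+ n * (1 - t).
Proof.
elim: n => [|n IH]; first by rewrite /vsum big_ord0 expr0; ring.
by rewrite vsumS mulrDr IH [t ^+ n.+1]exprS -natr1; ring.
Qed.

Lemma wsumE n z : (z - 1) * wsum n z = z ^+ n.+1 - 1 - n.+1%:R * (z - 1).
Proof.
elim: n => [|n IH]; first by rewrite /wsum big_ord0 expr1; ring.
by rewrite wsumS mulrDr IH [z ^+ n.+2]exprS -[n.+2%:R]natr1; ring.
Qed.

Lemma zsumE n z : (z - 1) ^+ 2 * zsum n z = n%:R * z ^+ n.+2 - n.+1%:R * z ^+ n.+1 + z.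
Proof.
elim: n => [|n IH]; first by rewrite /zsum big_ord0 expr1; ring.
by rewrite zsumS mulrDr IH [z ^+ n.+3]exprS [z ^+ n.+2]exprS -[n.+2%:R]natr1 -[n.+1%:R]natr1; ring.
Qed.

Lemma vsum_ge0 n t : 0 <= t -> 0 <= vsum n t.
Proof. by move=> t0; apply: sumr_ge0 => i _; rewrite mulr_ge0// exprn_ge0. Qed.

(** The chord bound for the convex sequence t^i, i from 0 to m, summed with the weights i + 1. In
    the induction the slack grows by 2 (m + 2) (1 - t)^2 [vsum m t]. *)
Lemma vsum_le m t : 0 <= t ->
  6 * vsum m.+1 t <= m.+1%:R * m.+2%:R * (1 + 2 * t ^+ m).
Proof.
move=> t0; elim: m => [|m IH]; first by rewrite /vsum big_ord1/= !expr0; lra.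
have bern' : 0 <= (1 - t) ^+ 2 * vsum m t by rewrite mulr_ge0 ?sqr_ge0 ?vsum_ge0.
rewrite vsumS mulrDr -subr_ge0.
apply: (@le_trans _ _ (m.+2%:R * (2 * ((1 - t) ^+ 2 * vsum m t)))); first by apply: mulr_ge0 => //; apply: mulr_ge0.
rewrite -subr_ge0 vsumE.
have : 0 <= m.+1%:R * m.+2%:R * (1 + 2 * t ^+ m) - 6 * vsum m.+1 t by rewrite subr_ge0.
move/le_trans; apply; rewrite le_eqVlt; apply/orP; left; apply/eqP.
rewrite [t ^+ m.+1]exprS -[m.+3%:R]natr1 -[m.+2%:R]natr1 -[m.+1%:R]natr1.
by move: (vsum m.+1 t) (t ^+ m) (m%:R) => v tm M; ring.
Qed.

Lemma bernoulli n z : 1 <= z -> n%:R * (z - 1) <= z ^+ n - 1.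
Proof.
move=> z1; elim: n => [|n IH]; first by rewrite expr0; lra.
have : z * (n%:R * (z - 1)) <= z * (z ^+ n - 1) by rewrite ler_wpM2l//; lra.
have : 0 <= n%:R * (z - 1) * (z - 1) by rewrite !mulr_ge0//; lra.
by rewrite exprS -natr1; move: (z ^+ n) (n%:R : R) => zn N; lra.
Qed.

Lemma wsum_ge n z : 1 <= z -> n%:R * n.+1%:R * (z - 1) <= 2 * wsum n z.
Proof.
move=> z1; elim: n => [|n IH]; first by rewrite /wsum big_ord0; lra.
rewrite wsumS; have := bernoulli n.+1 z1; move: IH; rewrite -[n.+2%:R]natr1 -[n.+1%:R]natr1.
by move: (wsum n z) (z ^+ n.+1) (n%:R : R) => w zn N; lra.
Qed.

Lemma power_step N z : 1 <= z -> 0 <= N%:R * z ^+ N.+1 - N.+1%:R * z ^+ N + 1.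
Proof.
move=> z1; elim: N => [|N IH]; first by rewrite expr0; lra.
have : 0 <= N.+1%:R * (z ^+ N * (z - 1) ^+ 2).
  by rewrite mulr_ge0// mulr_ge0 ?sqr_ge0// exprn_ge0// (le_trans ler01).
move: IH; rewrite ![z ^+ _.+1]exprS -[N.+2%:R]natr1 -[N.+1%:R]natr1.
by move: (z ^+ N) (N%:R : R) => zn M; lra.
Qed.

Lemma power_bound N z : 1 <= z ->
  0 <= N%:R * (z - 1) * z ^+ N.+1 - 2 * (z ^+ N.+1 - 1) + N.+2%:R * (z - 1).
Proof.
move=> z1; elim: N => [|N IH]; first by rewrite expr1; lra.
have : 0 <= (z - 1) * (N.+1%:R * z ^+ N.+2 - N.+2%:R * z ^+ N.+1 + 1).
  by rewrite mulr_ge0 ?power_step//; lra.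
move: IH; rewrite [z ^+ N.+2]exprS -[N.+3%:R]natr1 -[N.+2%:R]natr1 -[N.+1%:R]natr1.
by move: (z ^+ N.+1) (N%:R : R) => zn M; lra.
Qed.

(** Each increment in n is twice the expression of [power_bound], whose own increments are z - 1
    times the expression of [power_step]. *)
Lemma zsum_ge n z : 1 <= z -> (3 + n.+2%:R * (z - 1)) * wsum n z <= 3 * (z - 1) * zsum n z.
Proof.
move=> z1; elim: n => [|n IH]; first by rewrite /wsum /zsum !big_ord0; lra.
have := power_bound n z1; have := wsumE n z; move: IH.
rewrite wsumS zsumS -[n.+3%:R]natr1 -[n.+2%:R]natr1 -[n.+1%:R]natr1.
move: (wsum n z) (zsum n z) (z ^+ n.+1) (n%:R : R) => w y zn N; lra.
Qed.

(** ((m + 3)/(m + 6))^m decreases to exp(-3), which is below 3/40; it is about 0.0753 at m = 28 and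
    drops under 3/40 at m = 29. Hence a check of the 29 cases. *)
Lemma tail_power m t : (m <= 28)%N -> m.+3%:R / m.+4.+2%:R <= t -> 3 / 40 <= t ^+ m.
Proof.
move=> m28 h; apply: (@le_trans _ _ ((m.+3%:R / m.+4.+2%:R) ^+ m)); last first.
  by rewrite lerXn2r ?nnegrE// ?(le_trans _ h)// divr_ge0.
move: m m28 {h}.
do 29! (case; [by move=> _; lra|]).
by [].
Qed.

End PowerSumEstimates.

(** * Excluding three parts *)

Section ThreeParts.
Variable R : realType.

(* With V = 2 v / C: either V <= 2 tau, or V <= (1 + 2 tau) / 3 and tau >= 3 / 40 give V^2 <= 2 tau. *)
Lemma three_part_ineq (t x tau v C : R) :
  0 < t -> t < 1 -> 0 < x -> 0 < tau -> tau <= 1 -> 3 / 40 <= tau -> 0 < C -> 0 <= v ->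
  6 * v <= C * (1 + 2 * tau) -> C * x <= 2 * ((1 - t) * v) ->
  t * x * v < C * tau * ((1 - t) + t * x).
Proof.
move=> t0 t1 x0 tau0 tau1 tau40 C0 v0 v_le x_le.
pose V := 2 * v / C.
have vE : v = C * V / 2 by rewrite /V; field; rewrite gt_eqF.
have V0 : 0 <= V by rewrite /V divr_ge0 ?mulr_ge0// ltW.
have V_le : 3 * V <= 1 + 2 * tau.
  by rewrite -(ler_pM2l C0); move: v_le; rewrite vE; lra.
have x_leV : x <= (1 - t) * V.
  by rewrite -(ler_pM2l C0); move: x_le; rewrite vE; lra.
suff : t * x * V / 2 < tau * ((1 - t) + t * x).
  by rewrite -(ltr_pM2l C0) vE; lra.
have tt : 0 < tau * (1 - t) by rewrite mulr_gt0// subr_gt0.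
have [V2|V2] := leP V (2 * tau).
  have : t * x * V <= t * x * (2 * tau) by rewrite ler_wpM2l// mulr_ge0// ltW.
  by lra.
have h1 : t * x * (V - 2 * tau) <= t * ((1 - t) * V) * (V - 2 * tau).
  by apply: ler_wpM2r; [rewrite subr_ge0 ltW|apply: ler_wpM2l => //; exact: ltW].
(* It suffices that (1 + 2 tau)^2 <= 18 tau, which on [0,1] holds from (7 - 3 sqrt 5)/4 = 0.0729...
   on; 3/40 lies just above. *)
have V2tau : V ^+ 2 <= 2 * tau by nra.
have h2 : V * (V - 2 * tau) < 2 * tau.
  have : 0 < V * tau by rewrite mulr_gt0//; lra.
  by lra.
have h3 : t * ((1 - t) * V) * (V - 2 * tau) <= (1 - t) * (V * (V - 2 * tau)).
  have -> : t * ((1 - t) * V) * (V - 2 * tau) = t * ((1 - t) * (V * (V - 2 * tau))) by ring.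
  rewrite ler_piMl ?(ltW t1)// mulr_ge0 ?subr_ge0 ?(ltW t1)// mulr_ge0// subr_ge0 ltW//.
have h4 : (1 - t) * (V * (V - 2 * tau)) < (1 - t) * (2 * tau).
  by rewrite ltr_pM2l ?subr_gt0.
by lra.
Qed.

(** The equation between [vsum] and [wsum] says that the first derivative vanishes. With it
    [zsum_ge] and [wsum_ge] become bounds in terms of [vsum], which [vsum_le] controls. *)
Lemma three_part_core m (t z : R) : (m <= 28)%N -> 0 < t -> t < 1 -> 1 < z ->
  (1 - t) * vsum m.+1 t = wsum m.+1 z ->
  0 < (z - 1) * zsum m.+1 z
    - (vsum m.+1 t - m.+1%:R * m.+2%:R * t ^+ m) * ((1 - t) + t * (z - 1)).
Proof.
move=> m28 t0 t1 z1 vw.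
have x0 : 0 < z - 1 by rewrite subr_gt0.
have v0 := vsum_ge0 m.+1 (ltW t0).
have v_le := vsum_le m (ltW t0).
have := zsum_ge m.+1 (ltW z1); have := wsum_ge m.+1 (ltW z1); rewrite -vw.
have tau0 : 0 < t ^+ m by rewrite exprn_gt0.
have tau1 : t ^+ m <= 1 by rewrite exprn_ile1// ltW.
have C0 : 0 < m.+1%:R * m.+2%:R :> R by rewrite mulr_gt0// ltr0n.
move=> x_le z_ge.
suff main : (z - 1) * vsum m.+1 t * (t - m.+3%:R / 3 * (1 - t)) <
    m.+1%:R * m.+2%:R * t ^+ m * ((1 - t) + t * (z - 1)).
  by move: z_ge main; move: (vsum _ _) (zsum _ _) (t ^+ m) (m.+1%:R * m.+2%:R) (m.+3%:R : R) => v y tau C K; lra.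
have pos : 0 < m.+1%:R * m.+2%:R * t ^+ m * ((1 - t) + t * (z - 1)).
  by rewrite !mulr_gt0// addr_gt0 ?subr_gt0// mulr_gt0.
(* For small t the left side is nonpositive. Otherwise t > (m + 3)/(m + 6), the hypothesis of
   [tail_power]. *)
have [small|big] := leP t (m.+3%:R / 3 * (1 - t)).
  by apply: le_lt_trans pos; rewrite mulr_ge0_le0 ?subr_le0// mulr_ge0// ltW.
have tau40 : 3 / 40 <= t ^+ m.
  apply: tail_power => //; rewrite ler_pdivrMr ?ltr0n//.
  move: big; rewrite -[m.+4.+2%:R]natr1 -[m.+4.+1%:R]natr1 -[m.+4%:R]natr1.
  by move: (m.+3%:R : R) => K; lra.
apply: le_lt_trans (three_part_ineq t0 t1 x0 tau0 tau1 tau40 C0 v0 v_le x_le).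
have : 0 <= (z - 1) * vsum m.+1 t * (m.+3%:R / 3 * (1 - t)).
  by rewrite mulr_ge0// ?mulr_ge0 ?divr_ge0 ?subr_ge0// ltW.
by lra.
Qed.

Lemma horner_one_subX n (y : R) : ((1 - 'X) ^+ n : {poly R}).[y] = (1 - y) ^+ n.
Proof. by rewrite horner_exp hornerD hornerN hornerX hornerC. Qed.

Lemma deriv_one_subX n : ((1 - 'X) ^+ n.+1 : {poly R})^`() = - n.+1%:R *: (1 - 'X) ^+ n.
Proof. by rewrite deriv_exp derivB derivX derivC sub0r mulN1r scaleNr scaler_nat mulNrn. Qed.

Lemma Hval_three_part m (t z : R) : z != 0 ->
  Hval ((1 - 'X) ^+ m.+2) ((z - 1) / z) (1 - t / z) * z ^+ m.+3 =
  (z - 1) * ((1 - t) ^+ 2 * vsum m.+1 t) - (1 - t) * ((z - 1) * wsum m.+1 z).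
Proof.
move=> z0; rewrite /Hval deriv_one_subX !hornerZ !horner_one_subX vsumE wsumE.
have -> : 1 - (1 - t / z) = t / z by ring.
have -> : 1 - (z - 1) / z = z^-1 by field.
rewrite subr0 expr1n !exprMn !exprVn !exprS -[m.+2%:R]natr1 -[m.+1%:R]natr1.
have zm0 : z ^+ m != 0 by rewrite expf_neq0.
move: zm0; move: (t ^+ m) (z ^+ m) (m%:R : R) => tau ze M ze0.
by field; rewrite z0.
Qed.

(** The last summand is a multiple of the expression in [Hval_three_part], so it drops out at a
    critical point. *)
Lemma DHval_three_part m (t z : R) : z != 0 ->
  (z - 1) * (1 - t) * (DHval ((1 - 'X) ^+ m.+2) ((z - 1) / z) (1 - t / z) * z ^+ m.+3) =
  (z - 1) * (1 - t) ^+ 2 * ((z - 1) ^+ 2 * zsum m.+1 z)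
  - (z - 1) ^+ 2 * ((1 - t) ^+ 2 * vsum m.+1 t) * ((1 - t) + t * (z - 1))
  + (z - 1) ^+ 2 * (1 - t) ^+ 2 * (m.+1%:R * m.+2%:R * t ^+ m) * ((1 - t) + t * (z - 1))
  + (z - 1) ^+ 2 * (1 + m.+1%:R * (1 - t)) *
      ((z - 1) * ((1 - t) ^+ 2 * vsum m.+1 t) - (1 - t) * ((z - 1) * wsum m.+1 z)).
Proof.
move=> z0; rewrite /DHval deriv_one_subX !derivZ deriv_one_subX !hornerZ !horner_one_subX.
rewrite vsumE wsumE zsumE.
have -> : 1 - (1 - t / z) = t / z by ring.
have -> : 1 - (z - 1) / z = z^-1 by field.
rewrite subr0 expr1n !exprMn !exprVn !exprS -[m.+2%:R]natr1 -[m.+1%:R]natr1.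
have zm0 : z ^+ m != 0 by rewrite expf_neq0.
move: zm0; move: (t ^+ m) (z ^+ m) (m%:R : R) => tau ze M ze0.
by field; rewrite z0.
Qed.

Lemma three_part_not_local_max m (b S : R) : (m <= 28)%N -> 0 < b -> b < S -> S < 1 ->
  exists b' S', [/\ 0 < b', b' < S', S' < 1, (2 * S' - b') * b' = (2 * S - b) * b &
    Fval ((1 - 'X) ^+ m.+2) b S < Fval ((1 - 'X) ^+ m.+2) b' S'].
Proof.
move=> m28 b0 bS S1; apply: contrapT => no.
(* With a = 1 - S and c = 1 - b, the sizes in [ladder_max_three_part], these are z = 1/c and t =
   a/c. *)
pose z := (1 - b)^-1; pose t := (1 - S) / (1 - b).
have b1 : 0 < 1 - b by lra.
have b1' : 1 - b != 0 by rewrite gt_eqF.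
have z0 : 0 < z by rewrite invr_gt0.
have z0' : z != 0 by rewrite gt_eqF.
have z1 : 1 < z by rewrite /z invf_gt1//; lra.
have t0 : 0 < t by rewrite divr_gt0//; lra.
have t1 : t < 1 by rewrite ltr_pdivrMr//; lra.
have bE : b = (z - 1) / z by rewrite /z; field.
have SE : S = 1 - t / z by rewrite /z /t; field.
have [||||H0 DH0] := @hyperbola_local_max R ((1 - 'X) ^+ m.+2) b S 1 => //.
  move=> b' S' b'0 b'S' S'u e; rewrite leNgt; apply/negP => lt.
  by apply: no; exists b', S'; split.
have := Hval_three_part m t z0'; rewrite -bE -SE H0 mul0r => vw0.
have x0 : 0 < z - 1 by rewrite subr_gt0.
have y0 : 0 < 1 - t by rewrite subr_gt0.
have vw : (1 - t) * vsum m.+1 t = wsum m.+1 z.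
  have : (z - 1) * (1 - t) * ((1 - t) * vsum m.+1 t - wsum m.+1 z) = 0 by rewrite vw0; ring.
  move/eqP; rewrite mulf_eq0 subr_eq0 => /orP[|/eqP//].
  by rewrite gt_eqF// mulr_gt0.
have core := three_part_core m28 t0 t1 z1 vw.
have := DHval_three_part m t z0'; rewrite -bE -SE -vw0 mulr0 addr0.
have pos : 0 < ((z - 1) * (1 - t)) ^+ 2 * ((z - 1) * zsum m.+1 z
    - (vsum m.+1 t - m.+1%:R * m.+2%:R * t ^+ m) * ((1 - t) + t * (z - 1))).
  by rewrite mulr_gt0// exprn_gt0// mulr_gt0.
have neg : (z - 1) * (1 - t) * (DHval ((1 - 'X) ^+ m.+2) b S * z ^+ m.+3) <= 0.
  by apply: mulr_ge0_le0; [rewrite mulr_ge0 ?ltW|rewrite mulr_le0_ge0// exprn_ge0// ltW].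
move=> e; move: neg; rewrite e leNgt => /negP; apply.
apply: (lt_le_trans pos); rewrite le_eqVlt; apply/orP; left; apply/eqP.
by move: (vsum _ _) (zsum _ _) (t ^+ m) (m.+1%:R * m.+2%:R) => v y tau C; ring.
Qed.

End ThreeParts.

(** * Excluding rectangles *)

Section RectangleReweighting.
Variable R : realFieldType.
Implicit Types X Y Z : R.

Lemma amgm_pow i X Y Z : 0 <= X -> 0 <= Y -> 0 <= Z -> Z ^+ 2 <= X * Y ->
  2 * Z ^+ i <= X ^+ i + Y ^+ i.
Proof.
move=> X0 Y0 Z0 ZXY.
rewrite -(@ler_pXn2r _ 2)// ?nnegrE; last 2 first.
- by rewrite mulr_ge0 ?exprn_ge0.
- by rewrite addr_ge0 ?exprn_ge0.
have : (Z ^+ i) ^+ 2 <= X ^+ i * Y ^+ i.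
  by rewrite exprAC -exprMn lerXn2r ?nnegrE ?mulr_ge0 ?sqr_ge0.
have := sqr_ge0 (X ^+ i - Y ^+ i).
by move: (Z ^+ i) (X ^+ i) (Y ^+ i) => z x y h1 h2; nra.
Qed.

Lemma amgm_pow_strict i X Y Z : 0 <= X -> 0 <= Y -> 0 <= Z -> X * Y = Z ^+ 2 -> X != Y ->
  2 * Z ^+ i.+1 < X ^+ i.+1 + Y ^+ i.+1.
Proof.
move=> X0 Y0 Z0 XYZ XY; rewrite lt_neqAle amgm_pow ?XYZ// andbT.
apply/eqP => e; move/eqP: XY; apply; apply/eqP.
rewrite -(@eqrXn2 _ i.+1)//.
have : X ^+ i.+1 * Y ^+ i.+1 = (Z ^+ i.+1) ^+ 2 by rewrite exprAC -XYZ exprMn.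
move: e; move: (Z ^+ i.+1) (X ^+ i.+1) (Y ^+ i.+1) => z x y e h.
have : (x - y) ^+ 2 = 0 by nra.
by move/eqP; rewrite sqrf_eq0 subr_eq0.
Qed.

(** b of the c clique vertices are joined to s outside vertices, and the remaining 1 - c - s are
    isolated. *)
Definition rect_star k (b c s : R) := b * (c + s) ^+ k + (c - b) * c ^+ k + s * b ^+ k.

(** The density depends on c and b s only. Scaling (b, s) by (th, 1/th) and by (1/th, th) preserves
    it; by AM-GM the two resulting star densities average to more than the original, so one of them
    is larger. *)
Lemma rect_not_local_max m (b c s : R) : 0 < b -> b < c -> 0 < s -> c + s < 1 ->
  exists b' s', [/\ 0 <= b' <= c, 0 <= s', c + s' <= 1, b' * s' = b * s &
    rect_star m.+2 b c s < rect_star m.+2 b' c s'].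
Proof.
move=> b0 bc s0 cs.
have c0 : 0 < c by lra.
(* The largest factor with b th <= c and s th <= 1 - c. *)
pose th := Num.min (c / b) ((1 - c) / s).
have th1 : 1 < th by rewrite /th lt_min !ltr_pdivlMr// !mul1r bc; lra.
have th0 : 0 < th by lra.
have thb : b * th <= c.
  by rewrite mulrC -ler_pdivlMr// /th ge_min lexx.
have ths : s * th <= 1 - c.
  by rewrite mulrC -ler_pdivlMr// /th ge_min lexx orbT.
have thV : 0 < th^-1 by rewrite invr_gt0.
have thVth : th^-1 * th = 1 by rewrite mulVf// gt_eqF.
have thV1 : th^-1 < 1 by rewrite invf_lt1.
(* q(y) is ((c + y)^k - c^k)/y with k = m + 2; for fixed b s the star density is increasing and
   affine in q(s) + b^(k-1). *)
pose q y := \sum_(i < m.+2) (c + y) ^+ (m.+1 - i) * c ^+ i.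
have rectE b' s' : b' * s' = b * s ->
    rect_star m.+2 b' c s' = c ^+ m.+3 + b * s * (q s' + b' ^+ m.+1).
  move=> e; have := subrXX (c + s') c m.+2; rewrite [c + s' - c]addrAC subrr add0r -/(q s').
  rewrite /rect_star -e => eq.
  transitivity (c ^+ m.+3 + b' * ((c + s') ^+ m.+2 - c ^+ m.+2) + s' * b' ^+ m.+2).
    by rewrite [c ^+ m.+3]exprS; ring.
  by rewrite eq [b' ^+ m.+2]exprS; ring.
have e1 : (b * th) * (s * th^-1) = b * s by rewrite mulrACA [th * _]mulrC thVth mulr1.
have e2 : (b * th^-1) * (s * th) = b * s by rewrite mulrACA thVth mulr1.
have qconv : 2 * q s <= q (s * th) + q (s * th^-1).
  rewrite /q mulr_sumr -big_split/=; apply: ler_sum => i _.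
  rewrite mulrA -mulrDl ler_wpM2r ?exprn_ge0 ?(ltW c0)//.
  have st : 0 < s * th by rewrite mulr_gt0.
  have stV : 0 < s * th^-1 by rewrite mulr_gt0.
  apply: amgm_pow; try lra.
  have -> : (c + s * th) * (c + s * th^-1) = c ^+ 2 + c * s * (th + th^-1) + s ^+ 2 * (th^-1 * th) by ring.
  rewrite thVth; have th2 : 2 <= th + th^-1.
    have := @amgm_pow 1 th th^-1 1; rewrite !expr1 expr1n mulr1; apply; try lra.
  have : c * s * 2 <= c * s * (th + th^-1) by rewrite ler_wpM2l// mulr_ge0// ltW.
  by lra.
have bconv : 2 * b ^+ m.+1 < (b * th) ^+ m.+1 + (b * th^-1) ^+ m.+1.
  apply: amgm_pow_strict; try by [rewrite ltW|rewrite mulr_ge0// ltW].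
  - by rewrite mulrACA mulfV ?gt_eqF// mulr1 expr2.
  - by rewrite (inj_eq (mulfI (lt0r_neq0 b0))) gt_eqF// (lt_trans thV1).
have gain : 2 * (q s + b ^+ m.+1) < (q (s * th^-1) + (b * th) ^+ m.+1) + (q (s * th) + (b * th^-1) ^+ m.+1).
  by lra.
have bs0 : 0 < b * s by rewrite mulr_gt0.
rewrite (rectE b s)//.
have [h|h] := ltP (q s + b ^+ m.+1) (q (s * th^-1) + (b * th) ^+ m.+1).
- exists (b * th), (s * th^-1); split=> //.
  + by rewrite thb mulr_ge0// ltW.
  + by rewrite mulr_ge0// ltW.
  + have : s * th^-1 <= s by rewrite ler_piMr// ltW.
    by lra.
  + by rewrite rectE// ltrD2l ltr_pM2l.
- exists (b * th^-1), (s * th); split=> //.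
  + apply/andP; split; first by rewrite mulr_ge0// ltW.
    by rewrite (le_trans _ (ltW bc))// ler_piMr// ltW.
  + by rewrite mulr_ge0// ltW.
  + by lra.
  + by rewrite rectE// ltrD2l ltr_pM2l//; lra.
Qed.

End RectangleReweighting.

(** * Classification of the maximal block kernels *)

Section Classification.
Variable R : realType.
Implicit Types (a b c s : R) (p q : bool -> bool -> R).

Definition lmass a c s (i j : bool) : R :=
  if i then if j then a else c - a else if j then s else 1 - c - s.

(** With [orb] between the parts, the cells of sizes a, c - a, s and 1 - c - s have degrees 1, c +
    s, c and a. Relations that depend on one coordinate only give the values for s = 0 or a = 0. *)
Definition ladder_star k a c s :=
  a + (c - a) * (c + s) ^+ k + s * c ^+ k + (1 - c - s) * a ^+ k.
Definition ladder_den a c s := a + (c - a) * (c + s) + s * c + (1 - c - s) * a.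

Definition ladder_max k a c s := forall a' c' s', 0 <= a' <= c' -> 0 <= s' -> c' + s' <= 1 ->
  ladder_den a' c' s' = ladder_den a c s -> ladder_star k a' c' s' <= ladder_star k a c s.

Lemma masses_lmass a c s : 0 <= a <= c -> 0 <= s -> c + s <= 1 -> masses (lmass a c s).
Proof.
move=> /andP[a0 ac] s0 cs; split; first by case; case; rewrite /lmass //; lra.
by rewrite /bsum /lmass !mulr1; ring.
Qed.

Lemma bstar_ladder k a c s : bstar k (split_rel orb) (lmass a c s) = ladder_star k a c s.
Proof.
rewrite /bstar /bdeg /bsum /split_rel /lmass /= ?mulr1 ?mulr0 ?addr0 ?add0r /ladder_star.
have -> : a + (c - a) + s + (1 - c - s) = 1 by ring.
have -> : a + (c - a) + s = c + s by ring.
have -> : a + (c - a) = c by ring.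
by rewrite expr1n; ring.
Qed.

Lemma bden_ladder a c s : bden (split_rel orb) (lmass a c s) = ladder_den a c s.
Proof. by rewrite -(expr1 (ladder_den a c s)) /bden /bdeg /bsum /split_rel /lmass /= /ladder_den; ring. Qed.

Lemma bstar_rect k a c s :
  bstar k (split_rel andb) (lmass a c s) = rect_star k a c s + (1 - c - s) * 0 ^+ k.
Proof.
rewrite /bstar /bdeg /bsum /split_rel /lmass /= ?mulr1 ?mulr0 ?addr0 ?add0r /rect_star.
have -> : a + (c - a) + s = c + s by ring.
have -> : a + (c - a) = c by ring.
by ring.
Qed.

Lemma bden_rect a c s : bden (split_rel andb) (lmass a c s) = c ^+ 2 + 2 * (a * s).
Proof. by rewrite /bden /bdeg /bsum /split_rel /lmass /=; ring. Qed.

(** The dominating part stays fixed while c and s move; it adds a to every other degree, whence the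
    shift in (a + X)^k. *)
Lemma ladder_max_interior m a c s : ladder_max m.+2 a c s ->
  0 <= a -> a < c -> 0 < s -> c + s < 1 -> False.
Proof.
move=> lmax a0 ac s0 cs.
have [||||b' [S' [b'0 b'S aS e lt]]] := @shift_not_local_max R a m (c - a) (c + s - a) => //; try lra.
have FE b S : ladder_star m.+2 a (a + b) (S - b) =
    Fval ((a%:P + 'X) ^+ m.+2) b S + (a + (1 - a) * a ^+ m.+2).
  rewrite /ladder_star /Fval !horner_exp !hornerD !hornerC !hornerX addr0.
  have -> : a + b + (S - b) = a + S by ring.
  by ring.
have DE b S : ladder_den a (a + b) (S - b) = 2 * a - a ^+ 2 + (2 * S - b) * b.
  by rewrite /ladder_den; ring.
have c1 : a + (c - a) = c by ring.
have s1 : (c + s - a) - (c - a) = s by ring.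
have F0 := FE (c - a) (c + s - a); have D0 := DE (c - a) (c + s - a).
rewrite c1 s1 in F0; rewrite c1 s1 in D0.
have h : ladder_star m.+2 a (a + b') (S' - b') <= ladder_star m.+2 a c s.
  apply: lmax; last by rewrite D0 DE e.
  - by apply/andP; split; lra.
  - by lra.
  - by lra.
by move: h; rewrite F0 FE lerD2r leNgt lt.
Qed.

(** Now a and c move. Degrees measured downwards from 1, with b = 1 - c and S = 1 - a, bring the
    star density into the form [Fval]. *)
Lemma ladder_max_three_part m a c : (m <= 28)%N -> ladder_max m.+2 a c 0 ->
  0 < a -> a < c -> c < 1 -> False.
Proof.
move=> m28 lmax a0 ac c1.
have [|||b' [S' [b'0 b'S S1 e lt]]] := @three_part_not_local_max R m (1 - c) (1 - a) m28; try lra.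
have FE b S : ladder_star m.+2 (1 - S) (1 - b) 0 = Fval ((1 - 'X) ^+ m.+2) b S + 1.
  rewrite /ladder_star /Fval !horner_one_subX !subr0 expr1n mul0r !addr0.
  by ring.
have DE b S : ladder_den (1 - S) (1 - b) 0 = 1 - (2 * S - b) * b.
  by rewrite /ladder_den; ring.
have aE : 1 - (1 - a) = a by ring.
have cE : 1 - (1 - c) = c by ring.
have F0 := FE (1 - c) (1 - a); have D0 := DE (1 - c) (1 - a).
rewrite aE cE in F0; rewrite aE cE in D0.
have h : ladder_star m.+2 (1 - S') (1 - b') 0 <= ladder_star m.+2 a c 0.
  apply: lmax => //; last by rewrite D0 DE e.
  - by apply/andP; split; lra.
  - by lra.
by move: h; rewrite F0 FE lerD2r leNgt lt.
Qed.

End Classification.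

Section BlockClassification.
Variable R : realType.
Implicit Types (a b c s : R) (p q : bool -> bool -> R).

(** f labels the blocks: [andb] makes the true labels a clique, [orb] the false labels an
    anticlique. Blocks of mass 0 are exempt, being invisible to densities. *)
Definition like_rel (op : bool -> bool -> bool) m p := exists f : bool -> bool -> bool,
  forall i j i' j', p i j != 0 -> p i' j' != 0 -> split_rel m i j i' j' = op (f i j) (f i' j').

Lemma mono2_cases m : mono2 m -> m = (fun _ _ => false) \/ m = (fun _ _ => true) \/
  m = andb \/ m = orb \/ m = (fun j _ => j) \/ m = (fun _ j => j).
Proof.
move=> mono.
have ext m' : m true true = m' true true -> m true false = m' true false ->
    m false true = m' false true -> m false false = m' false false -> m = m'.
  by move=> *; apply/funext => -[]; apply/funext => -[].
have tt (b b' : bool) : m b b' -> m true true by apply: mono; rewrite implybT.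
have := mono false false true false isT isT.
have := mono false false false true isT isT.
have := tt true false; have := tt false true.
case e1 : (m true true); case e2 : (m true false); case e3 : (m false true); case e4 : (m false false) => h1 h2 h3 h4;
  try (by have := h1 isT); try (by have := h2 isT); try (by have := h3 isT); try (by have := h4 isT).
- by right; left; apply: ext; rewrite ?e1 ?e2 ?e3 ?e4.
- by do 3 right; left; apply: ext; rewrite ?e1 ?e2 ?e3 ?e4.
- by do 4 right; left; apply: ext; rewrite ?e1 ?e2 ?e3 ?e4.
- by do 5 right; apply: ext; rewrite ?e1 ?e2 ?e3 ?e4.
- by do 2 right; left; apply: ext; rewrite ?e1 ?e2 ?e3 ?e4.
- by left; apply: ext; rewrite ?e1 ?e2 ?e3 ?e4.
Qed.

Lemma masses_lmassE p : masses p -> exists a c s,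
  [/\ 0 <= a <= c, 0 <= s, c + s <= 1 & p = lmass a c s].
Proof.
move=> [p0 p1]; exists (p true true), (p true true + p true false), (p false true).
have h1 := p0 true true; have h2 := p0 true false; have h3 := p0 false true; have h4 := p0 false false.
move: p1; rewrite /bsum !mulr1 => p1; split=> //.
- by rewrite h1 lerDl.
- by lra.
- by apply/funext => -[]; apply/funext => -[]; rewrite /lmass//=; lra.
Qed.

Lemma block_max_ladder k m p a c s : block_max k m p ->
  bden (split_rel m) p = ladder_den a c s -> bstar k (split_rel m) p = ladder_star k a c s ->
  ladder_max k a c s.
Proof.
move=> [_ pmax] dE sE a' c' s' ac' s0' cs' e.
rewrite -sE -bstar_ladder; apply: pmax; first exact: masses_lmass.
by rewrite bden_ladder dE.
Qed.

Lemma eq0_absurd (x : R) (Q : Prop) : x = 0 -> x != 0 -> Q.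
Proof. by move=> ->; rewrite eqxx. Qed.

(** The label is membership in the clique part; wherever the two relations differ, one of the two
    blocks has mass 0. *)
Ltac like := exists (fun i _ : bool => i); move=> [] [] [] []; rewrite /lmass/=; try (by []);
  first [by apply: eq0_absurd; lra | by move=> _; apply: eq0_absurd; lra].

Lemma block_max_classify n m p : (n <= 28)%N -> mono2 m -> block_max n.+2 m p ->
  like_rel andb m p \/ like_rel orb m p.
Proof.
move=> n28 /mono2_cases mcases pmax.
have [a [c [s [/andP[a0 ac] s0 cs pE]]]] := masses_lmassE pmax.1.
have k0 : (0 : R) ^+ n.+2 = 0 by rewrite expr0n.
rewrite {}pE in pmax *.
have three a' : ladder_max n.+2 a' c 0 -> 0 <= a' -> a' <= c -> c <= 1 -> [\/ a' = 0, a' = c | c = 1].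
  move=> lmax a'0 a'c c1.
  have [->|a'n] := eqVneq a' 0; first by constructor 1.
  have [->|a'nc] := eqVneq a' c; first by constructor 2.
  have [->|cn] := eqVneq c 1; first by constructor 3.
  by exfalso; apply: (ladder_max_three_part n28 lmax); rewrite lt_neqAle ?a'0 ?a'c ?c1 ?andbT// eq_sym.
have ladder a' : ladder_max n.+2 a' c s -> 0 <= a' -> a' <= c -> [\/ a' = c, s = 0 | c + s = 1].
  move=> lmax a'0 a'c.
  have [->|a'nc] := eqVneq a' c; first by constructor 1.
  have [->|sn] := eqVneq s 0; first by constructor 2.
  have [->|cn] := eqVneq (c + s) 1; first by constructor 3.
  by exfalso; apply: (ladder_max_interior lmax) => //; rewrite lt_neqAle ?a'c ?s0 ?cs ?andbT// eq_sym.
case: mcases => [me|[me|[me|[me|[me|me]]]]]; rewrite {}me in pmax *.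
- by left; like.
- by right; like.
- have [a00|an] := eqVneq a 0; first by left; like.
  have [s00|sn] := eqVneq s 0; first by left; like.
  (* For a = c the whole clique sees the s outside vertices: a ladder without dominating part. *)
  have [ace|acn] := eqVneq a c.
    have lmax : ladder_max n.+2 0 c s.
      apply: block_max_ladder pmax _ _.
      - by rewrite bden_rect /ladder_den ace; ring.
      - by rewrite bstar_rect /ladder_star /rect_star ace k0; ring.
    have [c00|s00|cs1] := ladder 0 lmax (lexx 0) (le_trans a0 ac).
    + by exfalso; move/eqP: an; apply; rewrite ace.
    + by rewrite s00 eqxx in sn.
    + by right; like.
  (* For c + s = 1 nothing is isolated and the a vertices dominate: a ladder with s = 0. *)
  have [cs1|csn] := eqVneq (c + s) 1.
    have lmax : ladder_max n.+2 a c 0.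
      have sE : s = 1 - c by lra.
      apply: block_max_ladder pmax _ _.
      - by rewrite bden_rect /ladder_den sE; ring.
      - by rewrite bstar_rect /ladder_star /rect_star sE k0 [c + (1 - c)]addrC subrK expr1n !addr0; ring.
    have [a00|//|c1] := three a lmax a0 ac ltac:(lra).
    + by rewrite a00 eqxx in an.
    + by move=> ace; rewrite ace eqxx in acn.
    + by exfalso; move/eqP: sn; apply; lra.
  exfalso.
  have [||||b' [s' [b'c s'0 cs' e]]] := @rect_not_local_max R n a c s.
  + by rewrite lt_neqAle eq_sym an.
  + by rewrite lt_neqAle acn.
  + by rewrite lt_neqAle eq_sym sn.
  + by rewrite lt_neqAle csn.
  have [_ /(_ andb (lmass b' c s'))] := pmax.
  rewrite !bden_rect e !bstar_rect k0 !mulr0 !addr0 => h.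
  by rewrite ltNge h//; exact: masses_lmass.
- have lmax : ladder_max n.+2 a c s.
    by apply: block_max_ladder pmax _ _; rewrite ?bden_ladder ?bstar_ladder.
  have [ace|s00|cs1] := ladder a lmax a0 ac.
  + by right; like.
  + rewrite s00 in lmax.
    have [a00|ace|c1] := three a lmax a0 ac ltac:(lra).
    * by left; like.
    * by right; like.
    * by right; like.
  + by right; like.
- have lmax : ladder_max n.+2 a c 0.
    apply: block_max_ladder pmax _ _.
    - by rewrite /bden /bdeg /bsum /split_rel /lmass /ladder_den/=; ring.
    - rewrite /bstar /bdeg /bsum /split_rel /lmass /ladder_star/= ?mulr1 ?mulr0 ?addr0 ?add0r.
      have -> : a + (c - a) + s + (1 - c - s) = 1 by ring.
      have -> : a + (c - a) = c by ring.
      by rewrite expr1n; ring.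
  have [a00|ace|c1] := three a lmax a0 ac ltac:(lra).
  + by left; like.
  + by right; like.
  + by left; like.
- have lmax : ladder_max n.+2 0 c s.
    apply: block_max_ladder pmax _ _.
    - by rewrite /bden /bdeg /bsum /split_rel /lmass /ladder_den/=; ring.
    - rewrite /bstar /bdeg /bsum /split_rel /lmass /ladder_star/= ?mulr1 ?mulr0 ?addr0 ?add0r.
      have -> : a + (c - a) + s = c + s by ring.
      have -> : a + (c - a) = c by ring.
      by rewrite k0; ring.
  have [c00|s00|cs1] := ladder 0 lmax (lexx 0) (le_trans a0 ac).
  + by left; like.
  + by left; like.
  + by right; like.
Qed.

End BlockClassification.

(** * Homomorphism densities of almost equal kernels *)

Section NullSetIntegral.
Context d (T : measurableType d) (R : realType) (mu : {measure set T -> \bar R}).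
Local Open Scope ereal_scope.
Implicit Types f g : T -> \bar R.
Import HBNNSimple.

(** The integral of a nonnegative function is a supremum over simple functions below it, and cutting
    such a function off on N keeps its integral and puts it below g. This avoids any measurability
    question for the inner integrals of [iint]. *)
Lemma ge0_le_integral_null (D N : set T) f g : measurable N -> mu N = 0 ->
  (forall x, D x -> 0 <= f x) -> (forall x, D x -> 0 <= g x) ->
  (forall x, D x -> ~ N x -> f x = g x) ->
  \int[mu]_(x in D) f x <= \int[mu]_(x in D) g x.
Proof.
move=> mN N0 f0 g0 fg; rewrite !ge0_integralE//.
apply/ge_ereal_sup => _ [h hf <-].
have mNC : measurable (~` N) by exact: measurableC.
pose h' := proj_nnsfun h mNC.
have h'E x : (h' x = h x * \1_(~` N) x)%R by [].
apply: (@le_trans _ _ (sintegral mu h')).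
  suff -> : sintegral mu h = sintegral mu h' by [].
  have mE (k : {nnsfun T >-> R}) : measurable_fun [set: T] (EFin \o k) by exact/measurable_EFinP.
  suff : \int[mu]_x (h x)%:E = \int[mu]_x (h' x)%:E by rewrite !integralT_nnsfun.
  apply: (ae_eq_integral (EFin \o h')) => //; first exact: mE.
  exists N; split; [exact: mN|exact: N0|] => x /= hx; apply: contrapT => Nx; apply: hx => _.
  by rewrite -[RHS]/((h' x)%:E) h'E indicE mem_set// mulr1.
apply: ereal_sup_ubound; exists h' => // x; rewrite h'E.
have [Nx|Nx] := pselect (N x).
  rewrite indicE memNset ?mulr0; last by move=> /(_ Nx).
  by rewrite patchE; case: ifPn => // /set_mem; exact: g0.
rewrite indicE mem_set// mulr1; apply: (le_trans (hf x)).
by rewrite !patchE; case: ifPn => // /set_mem Dx; rewrite fg.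
Qed.

Lemma ge0_eq_integral_null (D N : set T) f g : measurable N -> mu N = 0 ->
  (forall x, D x -> 0 <= f x) -> (forall x, D x -> 0 <= g x) ->
  (forall x, D x -> ~ N x -> f x = g x) ->
  \int[mu]_(x in D) f x = \int[mu]_(x in D) g x.
Proof.
move=> mN N0 f0 g0 fg; apply: le_anti; rewrite !(@ge0_le_integral_null _ N)//.
by move=> x Dx Nx; rewrite fg.
Qed.

End NullSetIntegral.

Section IteratedIntegral.
Variable R : realType.
Notation mu := (@lebesgue_measure R).
Notation I01 := (`[0%R, 1%R]%classic : set R).
Local Notation RT := (measurableTypeR R).
Implicit Types (f : (nat -> R) -> \bar R) (Q : (nat -> R) -> Prop).

Definition ins (m : nat) (t : R) (x : nat -> R) i := if i == m then t else x i.

Lemma iint_ge0 n f : (forall x, (forall i, (i < n)%N -> I01 (x i)) -> (0 <= f x)%E) ->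
  (0 <= iint n f)%E.
Proof.
elim: n f => [|n IH] f f0; first by apply: f0.
apply: integral_ge0 => t tI; apply: IH => x xI; apply: f0 => i ilt.
by case: eqVneq => [//|ine]; apply: xI; rewrite ltn_neqAle ine -ltnS.
Qed.

(* Iterated almost everywhere, in the order of the integrations of iint. *)
Fixpoint iae (n : nat) Q : Prop := match n with
  | 0%N => Q (fun _ => 0)
  | m.+1 => exists N : set RT, [/\ measurable N, mu N = 0%E &
      forall t, I01 t -> ~ N t -> iae m (fun x => Q (ins m t x))]
  end.

Lemma iae_mono n Q Q' : (forall x, (forall i, (i < n)%N -> I01 (x i)) -> Q x -> Q' x) ->
  iae n Q -> iae n Q'.
Proof.
elim: n Q Q' => [|n IH] Q Q' QQ'; first by apply: QQ'.
move=> [N [mN N0 NQ]]; exists N; split=> // t tI Nt.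
apply: IH (NQ t tI Nt) => x xI; apply: QQ' => i ilt; rewrite /ins.
by case: eqVneq => [//|ine]; apply: xI; rewrite ltn_neqAle ine -ltnS.
Qed.

Lemma iae_and n Q Q' : iae n Q -> iae n Q' -> iae n (fun x => Q x /\ Q' x).
Proof.
elim: n Q Q' => [|n IH] Q Q' /=; first by split.
move=> [N [mN N0 NQ]] [N' [mN' N'0 NQ']]; exists (N `|` N'); split.
- exact: measurableU.
- by apply/null_set_setU.
- move=> t tI /not_orP[Nt N't].
  by apply: IH; [exact: NQ|exact: NQ'].
Qed.

Lemma iae_all n (Q1 : R -> Prop) (N : set RT) : measurable N -> mu N = 0%E ->
  (forall t, I01 t -> ~ N t -> Q1 t) -> iae n (fun x => forall i, (i < n)%N -> Q1 (x i)).
Proof.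
move=> mN N0 NQ; elim: n => [|n IH]; first by [].
exists N; split=> // t tI Nt; apply: iae_mono IH => x _ xQ i ilt; rewrite /ins.
case: eqVneq => [_|ine]; first exact: NQ.
by apply: xQ; rewrite ltn_neqAle ine -ltnS.
Qed.

(** For i < j the variable of index j is fixed first, so the null set for the other one may depend
    on it. *)
Lemma iae_pairs n (Q2 : R -> R -> Prop) (N : set RT) : measurable N -> mu N = 0%E ->
  (forall t, I01 t -> ~ N t -> exists N' : set RT, [/\ measurable N', mu N' = 0%E &
     forall u, I01 u -> ~ N' u -> Q2 u t]) ->
  iae n (fun x => forall i j, (i < j)%N -> (j < n)%N -> Q2 (x i) (x j)).
Proof.
move=> mN N0 NQ; elim: n => [|n IH]; first by [].
exists N; split=> // t tI Nt; have [N' [mN' N'0 N'Q]] := NQ t tI Nt.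
have := iae_and IH (iae_all n mN' N'0 N'Q).
apply: iae_mono => x _ [xQ2 xQ1] i j ij jn; rewrite /ins.
have ijn : (i < n)%N by exact: leq_trans ij _.
rewrite [i == n]ltn_eqF//; case: eqVneq => [_|jne]; first exact: xQ1.
by apply: xQ2 => //; rewrite ltn_neqAle jne -ltnS.
Qed.

Lemma iint_iae n f f' : (forall x, (forall i, (i < n)%N -> I01 (x i)) -> (0 <= f x)%E) ->
  (forall x, (forall i, (i < n)%N -> I01 (x i)) -> (0 <= f' x)%E) ->
  iae n (fun x => f x = f' x) -> iint n f = iint n f'.
Proof.
elim: n f f' => [|n IH] f f' f0 f'0 //= [N [mN N0 NQ]].
have insI t x : I01 t -> (forall i, (i < n)%N -> I01 (x i)) ->
    forall i, (i < n.+1)%N -> I01 (ins n t x i).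
  move=> tI xI i ilt; rewrite /ins; case: eqVneq => [//|ine].
  by apply: xI; rewrite ltn_neqAle ine -ltnS.
apply: (ge0_eq_integral_null mN N0).
- by move=> t tI; apply: iint_ge0 => x xI; apply: f0; exact: insI.
- by move=> t tI; apply: iint_ge0 => x xI; apply: f'0; exact: insI.
- move=> t tI Nt; apply: IH; last exact: NQ.
  + by move=> x xI; apply: f0; exact: insI.
  + by move=> x xI; apply: f'0; exact: insI.
Qed.

(** The mean of F over n independent labels, each true with probability c. It shows that densities
    of a labelled kernel depend on the labelling through c alone. *)
Fixpoint label_sum (c : R) (n : nat) (F : (nat -> bool) -> R) : R := match n with
  | 0%N => F (fun _ => false)
  | m.+1 => c * label_sum c m (fun l => F (fun i => if i == m then true else l i))
     + (1 - c) * label_sum c m (fun l => F (fun i => if i == m then false else l i))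
  end.

Lemma label_sum_ge0 c n F : 0 <= c <= 1 -> (forall l, 0 <= F l) -> 0 <= label_sum c n F.
Proof.
move=> /andP[c0 c1]; elim: n F => [|n IH] F F0 //=.
by rewrite addr_ge0// mulr_ge0 ?subr_ge0//; apply: IH.
Qed.

Lemma integral_I01 (f : RT -> R) : bm f -> (forall x, 0 <= f x) ->
  (\int[mu]_(x in I01) (f x)%:E)%E = (Ex (unif R) f)%:E.
Proof.
move=> bf f0; rewrite EFin_Ex// /unif integral_uniform//.
- by rewrite subr0 invr1 mul1e.
- by apply: measurableT_comp => //; exact: bm_meas.
Qed.

Lemma iint_label (C : RT -> bool) n (F : (nat -> bool) -> R) : measurable_fun setT C ->
  (forall l, 0 <= F l) -> (forall l l', (forall i, (i < n)%N -> l i = l' i) -> F l = F l') ->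
  iint n (fun x => (F (fun i => C (x i)))%:E) =
  (label_sum (Ex (unif R) (fun x => if C x then 1 else 0)) n F)%:E.
Proof.
move=> mC; set c := Ex _ _.
have bC : bm (fun x => if C x then 1 else 0 : R) by apply: bm_if; bm.
have c01 : 0 <= c <= 1 by apply: Ex_itv => // x; case: ifP; rewrite ?lexx ler01.
(* At n = 0, [iint] evaluates at the constant 0, labelled [C 0], and [label_sum] at false; locality
   of F reconciles them. *)
elim: n F => [|n IH] F F0 Floc /=; first by congr (_%:E); apply: Floc.
pose a b := label_sum c n (fun l => F (fun i => if i == n then b else l i)).
transitivity (\int[mu]_(t in I01) (a (C t))%:E)%E.
  apply: eq_integral => t _; rewrite /a -IH; last 2 first.
  - by move=> l; exact: F0.
  - by move=> l l' ll'; apply: Floc => i ilt; case: eqVneq => // ine; apply: ll'; rewrite ltn_neqAle ine -ltnS.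
  by congr (iint n _); apply/funext => x; congr (F _)%:E; apply/funext => i; case: ifP.
have a0 b : 0 <= a b by apply: label_sum_ge0 => // l; exact: F0.
have ba : bm (fun t => a (C t)).
  have -> : (fun t => a (C t)) = (fun t => if C t then a true else a false).
    by apply/funext => t; case: (C t).
  by apply: bm_if => //; bm.
rewrite integral_I01//; congr (_%:E).
rewrite (eq_Ex _ (g := fun t => (a true - a false) * (if C t then 1 else 0) + a false)); last first.
  by move=> t; case: (C t); ring.
by rewrite ExD ?ExZ ?Ex_cst//; [rewrite -/c /a; ring|bm|bm].
Qed.

End IteratedIntegral.

Section HomomorphismDensities.
Variable R : realType.
Notation mu := (@lebesgue_measure R).
Notation I01 := (`[0%R, 1%R]%classic : set R).
Local Notation RT := (measurableTypeR R).
Local Notation Ex := (Ex (unif R)).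

Definition label_kernel (op : bool -> bool -> bool) (C : RT -> bool) (p : R * R) : R :=
  if op (C p.1) (C p.2) then 1 else 0.

Lemma homdens_label op (C : RT -> bool) n (E : rel 'I_n) : measurable_fun setT C ->
  homdens E (label_kernel op C) = (label_sum (Ex (fun x => if C x then 1 else 0)) n
    (fun l => \prod_(i < n) \prod_(j < n | (i < j)%N && E i j) (if op (l i) (l j) then 1 else 0)))%:E.
Proof.
move=> mC; rewrite -iint_label//.
- by move=> l; apply: prodr_ge0 => i _; apply: prodr_ge0 => j _; case: ifP.
- by move=> l l' ll'; apply: eq_bigr => i _; apply: eq_bigr => j _; rewrite !ll'.
Qed.

Lemma Ex_unif_null (f : RT -> R) : bm f -> (forall x, 0 <= f x) -> Ex f = 0 ->
  exists N : set RT, [/\ measurable N, mu N = 0%E & forall t, I01 t -> ~ N t -> f t = 0].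
Proof.
move=> bf f0 Ef; have := integral_I01 bf f0; rewrite Ef => If.
have mEf : measurable_fun (I01 : set RT) (EFin \o f).
  by apply: measurable_funTS; apply: measurableT_comp => //; exact: bm_meas.
have mI : measurable (I01 : set RT) by exact: measurable_itv.
have [N [mN N0 NP]] : ae_eq mu (I01 : set RT) (EFin \o f) (cst 0%E).
  apply: (ae_eq_integral_abs mu mI mEf).1.
  by rewrite -[RHS]If; apply: eq_integral => x _; rewrite /= ger0_norm.
exists N; split=> // t tI Nt; apply: contrapT => ft; apply: Nt; apply: NP => /= h.
by apply: ft; have [] := h tI.
Qed.

Lemma homdens_almost_eq (g k : R * R -> R) (F : RT * RT -> R) n (E : rel 'I_n) :
  (forall x y, I01 x -> I01 y -> 0 <= g (x, y)) -> (forall p, 0 <= k p) ->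
  bm F -> (forall p, 0 <= F p) -> Ex2 (unif R) F = 0 ->
  (forall x y, I01 x -> I01 y -> F (x, y) = 0 -> g (x, y) = k (x, y)) ->
  homdens E g = homdens E k.
Proof.
move=> g0 k0 bF F0 EF Fgk.
(* [iint] integrates larger indices outside and edges are read with i < j, so the second variable
   has to be the outer one. *)
have {}EF : Ex (fun y => Ex (fun x => F (x, y))) = 0 by rewrite -Ex2_swap.
have bFy : bm (fun y => Ex (fun x => F (x, y))).
  by apply: (@bm_Ex _ _ _ (unif R) (fun p => F (p.2, p.1))); bm.
have [|N [mN N0 NP]] := Ex_unif_null bFy _ EF; first by move=> y; apply: Ex_ge0.
apply: iint_iae.
- move=> x xI; rewrite lee_fin; apply: prodr_ge0 => i _; apply: prodr_ge0 => j _.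
  by apply: g0; apply: xI.
- by move=> x xI; rewrite lee_fin; apply: prodr_ge0 => i _; apply: prodr_ge0 => j _.
have : iae n (fun x => forall i j, (i < j)%N -> (j < n)%N ->
    F (x i, x j) = 0).
  apply: (@iae_pairs R n (fun u t => F (u, t) = 0) N mN N0) => t tI Nt.
  have bFt : bm (fun x => F (x, t)) by bm.
  by apply: (Ex_unif_null bFt) => //; exact: NP.
apply: iae_mono => x xI xF; congr (_%:E); apply: eq_bigr => i _; apply: eq_bigr => j /andP[ij _].
by apply: Fgk; [exact: xI|exact: xI|apply: xF].
Qed.

Lemma gclique_label (c : R) : gclique c = label_kernel andb (fun x => x < c).
Proof. by []. Qed.

Lemma ganticlique_label (c : R) : ganticlique c = label_kernel orb (fun x => x <= c).
Proof.
apply/funext => p; rewrite /ganticlique /label_kernel !ltNge -negb_or.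
by case: (_ || _).
Qed.

Lemma mb_ler (c : R) : measurable_fun setT (fun x : RT => x <= c).
Proof. by apply: measurable_fun_ler => //; exact: measurable_cst. Qed.

Lemma Ex_unif_le (c : R) : 0 <= c <= 1 -> Ex (fun x : RT => if x <= c then 1 else 0) = c.
Proof.
move=> c01; rewrite -[RHS]addr0 -[X in _ = _ + X](Ex_unif_eq c) -[X in _ = X + _](Ex_unif_lt c01).
have b1 : bm (fun x : RT => if x < c then 1 else 0 : R) by apply: bm_if; [exact: mb_ltr|bm|bm].
have b2 : bm (fun x : RT => if x == c then 1 else 0 : R).
  by apply: bm_if; [apply: measurable_fun_eqr|bm|bm].
rewrite -(ExD _ b1 b2); apply: eq_Ex => x.
by case: (ltgtP x c) => _; rewrite ?addr0 ?add0r.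
Qed.

End HomomorphismDensities.

(** * From graphons to kernels and back *)

Section Graphons.
Variable R : realType.
Notation mu := (@lebesgue_measure R).
Notation I01 := (`[0%R, 1%R]%classic : set R).
Local Notation RT := (measurableTypeR R).

(** A graphon is arbitrary outside the unit square; the extension by 0 is bounded, symmetric and
    measurable everywhere. *)
Definition extend (g : R * R -> R) : RT * RT -> R := g \_ (I01 `*` I01).

Lemma extendE g x y : I01 x -> I01 y -> extend g (x, y) = g (x, y).
Proof. by move=> xI yI; rewrite /extend patchE mem_set. Qed.

Lemma symker_extend g : is_graphon g -> symker (extend g).
Proof.
move=> [mg symg g01]; split.
- have mI : measurable (I01 : set RT) by exact: measurable_itv.
  have mD : measurable ((I01 : set RT) `*` (I01 : set RT)) by exact: measurableX.
  exact: (measurable_restrictT g mD).1 mg.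
- move=> x y; rewrite /extend !patchE.
  have [xy|xy] := pselect ((I01 `*` I01) (x, y)); have [yx|yx] := pselect ((I01 `*` I01) (y, x)).
  + by rewrite !mem_set//; case: xy => /= *; apply: symg.
  + by case: yx; case: xy.
  + by case: xy; case: yx.
  + by rewrite !memNset.
- move=> [x y]; rewrite /extend patchE; case: ifPn => [/set_mem[/= xI yI]|_].
  + exact: g01.
  + by rewrite lexx ler01.
Qed.

Lemma graphon_symker (h : RT * RT -> R) : symker h -> is_graphon (h : R * R -> R).
Proof.
move=> [mh symh h01]; split=> //.
exact: (measurable_funTS mh).
Qed.

Lemma tstar_star k (g : R * R -> R) (G : RT * RT -> R) : symker G ->
  (forall x y, I01 x -> I01 y -> G (x, y) = g (x, y)) -> tstar k g = star (unif R) k G.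
Proof.
move=> sG gG; have bG := bm_symker sG; have bd := bm_dg (unif R) bG.
have d0 x : 0 <= dg (unif R) G x by case/andP: (dg_itv (unif R) x sG).
rewrite /star Ex_unif_ge0; last 2 first.
- by bm.
- by move=> x; rewrite exprn_ge0.
congr fine; apply: eq_integral => x /set_mem xI; congr ((_ ^+ _)%:E).
rewrite /deg /dg Ex_unif_ge0; last 2 first.
- by bm.
- by move=> y; case: sG => _ _ /(_ (x, y))/andP[].
by congr fine; apply: eq_integral => y /set_mem yI; rewrite gG.
Qed.

End Graphons.

Section MaximizerStructure.
Variable R : realType.
Local Notation RT := (measurableTypeR R).
Local Notation Ex := (Ex (unif R)).
Local Notation Ex2 := (Ex2 (unif R)).

Lemma maximizer_label_kernel n (G : RT * RT -> R) : (n <= 28)%N ->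
  star_max (unif R) n.+2 G ->
  exists op (C : RT -> bool) (F : RT * RT -> R),
  [/\ op = andb \/ op = orb, measurable_fun setT C, bm F & (forall p, 0 <= F p)] /\
  Ex2 F = 0 /\ (forall p, F p = 0 -> G p = label_kernel op C p).
Proof.
move=> n28 Gmax.
have bG : bm G by apply: bm_symker; case: Gmax.
have [A [B [m [mA mB mono GK]]]] := block_reduction (@reweightable_unif R) (bm_unif_id R)
  (@atomless_unif_id R) Gmax.
have sK : symker (block_kernel R A B (split_rel m)).
  by apply: symker_block => // i j i' j'; exact: split_rel_sym.
have bK := bm_symker sK.
have bmax := block_max_unif mA mB (star_max_almost_eq sK GK Gmax).
have [op [opE [f fE]]] : exists op, (op = andb \/ op = orb) /\ like_rel op m (mass (unif R) A B).
  by have [h|h] := block_max_classify n28 mono bmax; [exists andb|exists orb]; split=> //; [left|right].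
pose C (x : RT) := f (A x) (B x).
have mC : measurable_fun setT C.
  have -> : C = fun x => if A x then if B x then f true true else f true false
      else if B x then f false true else f false false.
    by apply/funext => x; rewrite /C; case: (A x); case: (B x).
  by apply: measurable_fun_ifT => //; apply: measurable_fun_ifT.
(* Marks the blocks of mass 0, on which [like_rel] says nothing; its mean is 0, so it may be added
   to the certificate. *)
pose z i j : R := if mass (unif R) A B i j == 0 then 1 else 0.
pose bad (x : RT) := z (A x) (B x).
have bbad : bm bad by exact: bm_block.
have bad0 x : 0 <= bad x by rewrite /bad /z; case: ifP.
have Ebad : Ex bad = 0.
  rewrite /bad (Ex_block (unif R) mA mB z) /bsum /z.
  have e (u : R) : u * (if u == 0 then 1 else 0) = 0.
    by have [->|_] := eqVneq u 0; rewrite ?mul0r ?mulr0.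
  by rewrite !e !addr0.
have bb1 := @bm_fst _ _ RT RT _ bad bbad; have bb2 := @bm_snd _ _ RT RT _ bad bbad.
have bsq : bm (fun p => (G p - block_kernel R A B (split_rel m) p) ^+ 2).
  exact: (bmX 2 (bmD bG (bmN bK))).
exists op, C, (fun p => (G p - block_kernel R A B (split_rel m) p) ^+ 2 + (bad p.1 + bad p.2)).
split; first split=> //; first exact: (bmD bsq (bmD bb1 bb2)).
  by move=> p; apply: addr_ge0; [exact: sqr_ge0|apply: addr_ge0; exact: bad0].
split.
  have e1 : Ex2 (fun p => bad p.1) = 0.
    by apply: etrans Ebad; apply: eq_Ex => x; exact: (Ex_cst _ (bad x)).
  have e2 : Ex2 (fun p => bad p.2) = 0.
    by apply: etrans (Ex_cst (unif R) 0); apply: eq_Ex => x; exact: Ebad.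
  by rewrite (Ex2D _ bsq (bmD bb1 bb2)) GK add0r (Ex2D _ bb1 bb2) e1 e2 addr0.
move=> [x y] /eqP; rewrite (paddr_eq0 (sqr_ge0 _) (addr_ge0 (bad0 _) (bad0 _))).
rewrite (paddr_eq0 (bad0 _) (bad0 _)) sqrf_eq0 subr_eq0 => /andP[/eqP -> /andP[bx by_]].
have nz (u : RT) : bad u == 0 -> mass (unif R) A B (A u) (B u) != 0.
  by rewrite /bad /z; case: ifP => //; rewrite oner_eq0.
by rewrite /block_kernel /label_kernel /= (fE _ _ _ _ (nz _ bx) (nz _ by_)).
Qed.

Lemma bm_label (C : RT -> bool) : measurable_fun setT C ->
  bm (fun x => if C x then 1 else 0 : R).
Proof. by move=> mC; apply: bm_if; bm. Qed.

Lemma bm_label_kernel op (C : RT -> bool) : measurable_fun setT C ->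
  bm (label_kernel op C : RT * RT -> R).
Proof.
move=> mC.
have m1 : measurable_fun setT (fun p : RT * RT => C p.1) by exact: measurableT_comp mC measurable_fst.
have m2 : measurable_fun setT (fun p : RT * RT => C p.2) by exact: measurableT_comp mC measurable_snd.
pose u i j : R := if op i j then 1 else 0.
have -> : (label_kernel op C : RT * RT -> R) = fun p =>
    if C p.1 then if C p.2 then u true true else u true false
    else if C p.2 then u false true else u false false.
  by apply/funext => p; rewrite /label_kernel /u; case: (C p.1); case: (C p.2).
by apply: bm_if => //; apply: bm_if => //; bm.
Qed.

Lemma Ex2_label_andb (C : RT -> bool) : measurable_fun setT C ->
  Ex2 (label_kernel andb C) = Ex (fun x => if C x then 1 else 0) ^+ 2.
Proof.
move=> mC; have bC := bm_label mC; rewrite expr2 -(ExZr _ _ bC).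
apply: eq_Ex => x; rewrite -(ExZ _ _ bC); apply: eq_Ex => y; rewrite /label_kernel/=.
by case: (C x); case: (C y); rewrite /= ?mulr1 ?mulr0 ?mul0r.
Qed.

Lemma Ex2_label_orb (C : RT -> bool) : measurable_fun setT C ->
  Ex2 (label_kernel orb C) = 1 - (1 - Ex (fun x => if C x then 1 else 0)) ^+ 2.
Proof.
move=> mC; have bC := bm_label mC; set c := Ex _.
have e1 x : Ex (fun y => label_kernel orb C (x, y)) = c + (1 - c) * (if C x then 1 else 0).
  rewrite (eq_Ex _ (g := fun y => (1 - (if C x then 1 else 0)) * (if C y then 1 else 0) + (if C x then 1 else 0))).
    by rewrite ExD ?ExZ ?Ex_cst//; [rewrite -/c; ring|bm|bm].
  move=> y; rewrite /label_kernel/=.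
  by case: (C x); case: (C y); rewrite /=; ring.
transitivity (Ex (fun x => c + (1 - c) * (if C x then 1 else 0))); first exact: eq_Ex.
by rewrite ExD ?ExZ ?Ex_cst//; [rewrite -/c; ring|bm|bm].
Qed.

End MaximizerStructure.

Theorem theorem4p1 (R : realType) (k : nat) (eps : R) (g : R * R -> R) :
  (2 <= k <= 30)%N -> 0 <= eps <= 1 ->
  is_graphon g -> tstar 1 g = eps ->
  (forall h : R * R -> R, is_graphon h -> tstar 1 h = eps ->
     tstar k h <= tstar k g) ->
  graphon_equiv g (gclique (Num.sqrt eps)) \/
  graphon_equiv g (ganticlique (1 - Num.sqrt (1 - eps))).
Proof.
case: k => [|[|n]] //= n28 eps01 grg g1 gmax.
pose G := extend g.
have sG : symker G by exact: symker_extend.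
have starE (h : measurableTypeR R * measurableTypeR R -> R) : symker h ->
    forall j, tstar j h = star (unif R) j h by move=> sh j; exact: tstar_star.
have starG j : tstar j g = star (unif R) j G.
  by apply: tstar_star => // x y xI yI; exact: extendE.
have star1 (h : measurableTypeR R * measurableTypeR R -> R) : star (unif R) 1 h = Ex2 (unif R) h by [].
have Gmax : star_max (unif R) n.+2 G.
  split=> // h sh hG; rewrite -starG -(starE h sh); apply: gmax.
    exact: graphon_symker.
  by rewrite (starE h sh) star1 hG -star1 -starG.
have [op [C [F [[opE mC bF F0] [EF FG]]]]] := maximizer_label_kernel n28 Gmax.
pose c := Ex (unif R) (fun x => if C x then 1 else 0).
have bC := bm_label mC.
have c01 : 0 <= c <= 1 by apply: Ex_itv => // x; case: ifP; rewrite ?lexx ler01.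
have bG := bm_symker sG.
have bk := bm_label_kernel op mC.
(* This density is c^2 for [andb] and 1 - (1 - c)^2 for [orb], so it determines c. *)
have epsE : Ex2 (unif R) (label_kernel op C) = eps.
  rewrite -g1 starG star1; apply/esym.
  exact: (eq_Ex2_null bF bG bk F0 FG EF).
have homE (j : nat) (E : rel 'I_j) : homdens E g = homdens E (label_kernel op C).
  apply: (@homdens_almost_eq R g (label_kernel op C) F j E _ _ bF F0 EF).
  - by move=> x y xI yI; rewrite -extendE//; have [_ _ /(_ (x, y))/andP[]] := sG.
  - by move=> p; rewrite /label_kernel; case: ifP.
  - by move=> x y xI yI /FG <-; exact: esym (extendE g xI yI).
have /andP[c0 c1] := c01; have /andP[e0 e1] := eps01.
(* By [homdens_label] only the mass c of the true labels matters, so C may be exchanged for an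
   initial interval of length c. *)
case: opE => opE; rewrite {}opE in epsE homE *; [left|right] => j E _ _; rewrite homE.
- have -> : Num.sqrt eps = c by rewrite -epsE Ex2_label_andb// sqrtr_sqr ger0_norm.
  rewrite gclique_label !homdens_label//; last exact: mb_ltr.
  by rewrite Ex_unif_lt.
- have -> : 1 - Num.sqrt (1 - eps) = c.
    rewrite -epsE Ex2_label_orb// subKr sqrtr_sqr ger0_norm ?subr_ge0//.
    by rewrite subKr.
  rewrite ganticlique_label !homdens_label//; last exact: mb_ler.
  by rewrite Ex_unif_le.
Qed.
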